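(* Let $k$ be a field and $n,r\ge1$ natural numbers. The chain complex $$\cdots\to\mathcal{S}_{A_\infty}(n,r)\to\mathcal{S}_{A_\infty}(n,r)\to\mathcal{S}_{A_\infty}(n,r)\to\cdots,$$ with differential given by right multiplication by $d_r$, is a linear exact sequence of left $\mathcal{S}_{A_\infty}(n,r)$-modules. The chain complex $$\cdots\to\mathcal{D}_{A_\infty}(n,r)\to\mathcal{D}_{A_\infty}(n,r)\to\mathcal{D}_{A_\infty}(n,r)\to\cdots,$$ with differential given by right multiplication by $d_r$, is a linear exact sequence of left $\mathcal{D}_{A_\infty}(n,r)$-modules.
   Context: $A_\infty$ is the quiver with vertices $v_i$ ($i\in\mathbb{Z}$) and edges $e_i$ ($i\in\mathbb{Z}$), $e_i$ having source $v_{i+1}$ and tail $v_i$. $P_{A_\infty}$ is its path algebra modulo paths of length $>1$; $P_{A_\infty}(n)=\mathrm{End}_{P_{A_\infty}}(P_{A_\infty}^{\oplus n})\cong M^{\oplus V}\oplus M^{\oplus E}$, $M=M_n(k)$, a super-algebra with vertex components of parity $0$ and edge components of parity $1$ (edge components are bimodules over the adjacent vertex components by matrix multiplication, and products of edge components vanish). For a super-algebra $A$, $A^{\otimes r}$ is the super tensor power (sign rule $(a\otimes b)(a'\otimes b')=(-1)^{|b||a'|}aa'\otimes bb'$) with signed permutation action of $\Sigma_r$, and $\mathcal{S}(A)=\bigoplus_r(A^{\otimes r})^{\Sigma_r}$ with deconcatenation coproduct. For a quiver $Q$, $\mathcal{S}_Q(n)=\mathcal{S}(P_Q(n))=\bigoplus_r\mathcal{S}_Q(n,r)$,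 with graded dual $\mathcal{A}_Q(n)=\bigoplus_r\mathcal{A}_Q(n,r)$. Double: for a graded super-bialgebra $B$ with parity-preserving algebra and coalgebra anti-automorphism $\sigma$, $D(B)=B\otimes B^*$ has product $(a\otimes\alpha)(b\otimes\beta)=\sum(-1)^{s}a_{(2)}b_{(1)}\otimes\beta_{(2)}\alpha_{(1)}\langle a_{(1)}^\sigma,\beta_{(1)}\rangle\langle\alpha_{(2)},b_{(2)}^\sigma\rangle$, $s=|a_{(1)}|(|a_{(2)}|+|b_{(1)}|)+|b_{(1)}||\alpha|+|\alpha_{(1)}||\beta|$. The quiver $Q\coprod Q^{op}$ has the automorphism exchanging $Q$ and $Q^{op}$; with matrix transposition this gives $\sigma$ on $P_{Q\coprod Q^{op}}(n)$ and, via $a_1\otimes\dots\otimes a_r\mapsto\sigma(a_r)\otimes\dots\otimes\sigma(a_1)$, on $\mathcal{S}_{Q\coprod Q^{op}}(n)$. The Schiver double is the algebra summand $\mathcal{D}_Q(n)=\mathcal{S}_Q(n)\otimes\mathcal{A}_{Q^{op}}(n)$ of $D(\mathcal{S}_{Q\coprod Q^{op}}(n))$, and $\mathcal{D}_Q(n,r)=\bigoplus_{r_1+r_2=r}\mathcal{S}_Q(n,r_1)\otimes\mathcal{A}_{Q^{op}}(n,r_2)$. It contains $\mathcal{S}_Q(n,r)$ as the part $r_2=0$. As vector spaces, $\mathcal{S}_Q(n)\cong\mathcal{S}(n)^{\otimes V}\otimes\bigvee(n)^{\otimes E}$ and $\mathcal{A}_{Q^{op}}(n)\cong\mathcal{A}(n)^{\otimes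 V}\otimes\bigwedge(n)^{\otimes E}$ ($\mathcal{S}(n)$, $\bigvee(n)$ being invariants of permutation and signed permutation actions on tensor powers of $M$; $\mathcal{A}(n)$, $\bigwedge(n)$ symmetric and exterior algebras on $M^*$); the degree of a component $\bigotimes\mathcal{S}(n,a_v)\otimes\bigotimes\bigvee(n,b_e)\otimes\bigotimes\mathcal{A}(n,c_v)\otimes\bigotimes\bigwedge(n,d_e)$ is $\sum b_e+2\sum c_v+\sum d_e$ (on $\mathcal{S}_Q(n,r)$: $\sum b_e$). Differential: $d$ is the (infinite) sum over all edges of the identity matrix in the edge component of $P_{A_\infty}(n)$, with zero vertex components; $d_r=d\otimes1\otimes\dots\otimes1+1\otimes d\otimes1\otimes\dots\otimes1+\dots+1\otimes\dots\otimes1\otimes d$, which is $\Sigma_r$-invariant; right multiplication by this infinite sum is well defined on $\mathcal{S}_{A_\infty}(n,r)$ and on $\mathcal{D}_{A_\infty}(n,r)$. ''Linear'' means that the differential is homogeneous of degree $1$.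
   Formalization: In characteristic 2 the signed invariants are also required to vanish on tensors with a repeated odd basis element, so that the dual has exterior algebras on edges; with literal invariants the claim fails there (n=1, r=2, the cycle e⊗e); otherwise nothing changes. *)

(* Defs.v *)
From HB Require Import structures.
From mathcomp Require Import all_boot all_order all_algebra all_fingroup.
From mathcomp Require Import finmap.
From mathcomp.multinomials Require Import monalg.

Set Implicit Arguments.
Unset Strict Implicit.
Unset Printing Implicit Defensive.

Import GRing.Theory.
Local Open Scope ring_scope.

(** * Quivers *)

Record quiver := Quiver {
  vert : choiceType;
  edge : choiceType;
  src : edge -> vert;
  tgt : edge -> vert
}.

Definition op_quiver (Q : quiver) : quiver := Quiver (@tgt Q) (@src Q).

Definition coprod_quiver (Q R : quiver) : quiver :=
  @Quiver (vert Q + vert R)%type (edge Q + edge R)%type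
    (fun e => match e with inl a => inl (src a) | inr b => inr (src b) end)
    (fun e => match e with inl a => inl (tgt a) | inr b => inr (tgt b) end).

Definition dbl_quiver (Q : quiver) : quiver := coprod_quiver Q (op_quiver Q).

Definition Ainf : quiver := @Quiver int int (fun i => i + 1) (fun i => i).

(** * The super-algebra P_Q(n) and its tensor powers

  P_Q(n) is the free module on the matrix units of the components M_n(k)
  indexed by the vertices and the edges of Q; such a matrix unit is a letter
  [(c, i, j)].  The tensor algebra of P_Q(n) is the free module on words in
  these letters, its r-th tensor power being spanned by words of length r.
  An edge e lies in src(e) P tgt(e): it is multiplied by src(e) on the left
  and by tgt(e) on the right.  *)

Definition letter (Q : quiver) (n : nat) : choiceType :=
  ((vert Q + edge Q) * 'I_n * 'I_n)%type.

Definition word (Q : quiver) (n : nat) : choiceType := seq (letter Q n).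

Notation "''T[' k ]_ ( Q , n )" := {malg k[word Q n]}
  (at level 8, format "''T[' k ]_ ( Q ,  n )") : type_scope.

Section Words.
Variables (Q : quiver) (n : nat).
Implicit Types (a b c : letter Q n) (u v w : word Q n).

Definition is_edge a : bool := if a.1.1 is inr _ then true else false.

Definition nb_edges w : nat := count is_edge w.
Definition nb_verts w : nat := count (predC is_edge) w.

Definition parity w : bool := odd (nb_edges w).

Definition path_mul (x y : vert Q + edge Q) : option (vert Q + edge Q) :=
  match x, y with
  | inl v, inl v' => if v == v' then Some (inl v) else None
  | inl v, inr e => if v == src e then Some (inr e) else None
  | inr e, inl v => if tgt e == v then Some (inr e) else None
  | inr _, inr _ => None
  end.

Definition letter_mul a b : option (letter Q n) :=
  if a.2 == b.1.2 then
    if path_mul a.1.1 b.1.1 is Some c then Some (c, a.1.2, b.2) else None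
  else None.

Fixpoint word_mul u v : option (word Q n) :=
  match u, v with
  | [::], [::] => Some [::]
  | a :: u', b :: v' =>
      match letter_mul a b, word_mul u' v' with
      | Some c, Some w => Some (c :: w)
      | _, _ => None
      end
  | _, _ => None
  end.

(* The exponent of the sign in the product u v: each letter of v is moved to
   the left across the letters of u in later positions. *)
Fixpoint word_sign u v : bool :=
  match u, v with
  | _ :: u', b :: v' => (parity u' && is_edge b) (+) word_sign u' v'
  | _, _ => false
  end.

(* All factorizations of a basis element as a product of two basis elements
   (see [word_cofactP]). *)
Definition letter_cofact c : seq (letter Q n * letter Q n) :=
  let: (x, i, j) := c in
  flatten [seq
    match x return seq (letter Q n * letter Q n) with
    | inl v => [:: ((inl v, i, l), (inl v, l, j))]
    | inr e => [:: ((inl (src e), i, l), (inr e, l, j));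
                   ((inr e, i, l), (inl (tgt e), l, j))]
    end | l <- enum 'I_n].

Fixpoint word_cofact w : seq (word Q n * word Q n) :=
  if w is c :: w' then
    [seq (p.1 :: q.1, p.2 :: q.2) | p <- letter_cofact c, q <- word_cofact w']
  else [:: ([::], [::])].

Lemma letter_cofactP a b c :
  ((a, b) \in letter_cofact c) = (letter_mul a b == Some c).
Proof.
case: a b c => [[x i] j] [[y i'] j'] [[z l] l'] /=.
rewrite /letter_mul /=.
apply/flattenP/idP.
- case=> s /mapP[m _ ->]; case: z => [v|e]; rewrite !inE.
  + by move=> /eqP[-> -> -> -> -> ->] /=; rewrite !eqxx.
  + by case/orP=> /eqP[-> -> -> -> -> ->] /=; rewrite !eqxx.
- case: (j =P i') => // <-; case e: path_mul => [c|] // /eqP[<- <- <-].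
  exists (match c return seq (letter Q n * letter Q n) with
    | inl v => [:: ((inl v, i, j), (inl v, j, j'))]
    | inr e => [:: ((inl (src e), i, j), (inr e, j, j'));
                   ((inr e, i, j), (inl (tgt e), j, j'))]
    end); first by apply/mapP; exists j; rewrite ?mem_enum.
  case: x y e => [v|e] [v'|e'] //=; case: eqP => // E [<-]; rewrite !inE -?E ?eqxx ?orbT //.
Qed.

Lemma word_cofactP u v w : ((u, v) \in word_cofact w) = (word_mul u v == Some w).
Proof.
elim: w u v => [|c w IH] [|a u] [|b v] //=.
- by rewrite inE; case: letter_mul => // ?; case: word_mul.
- by apply/allpairsP; case=> -[p q] [_ _ []].
- by apply/allpairsP; case=> -[p q] [_ _ []].
- by apply/allpairsP; case=> -[p q] [_ _ []].
apply/allpairsP/idP.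
- case=> -[[a' b'] [u' v']] /= [Hl Hw [-> -> -> ->]].
  by move: Hl Hw; rewrite letter_cofactP IH => /eqP-> /eqP->.
- case El: letter_mul => [c'|] //; case Ew: word_mul => [w'|] // /eqP[Ec Ew'].
  exists ((a, b), (u, v)); split=> //=.
  + by rewrite letter_cofactP El Ec.
  + by rewrite IH Ew Ew'.
Qed.

(* The signed action of the symmetric group on basis elements of the r-th
   tensor power:  s sends w to (-1)^(perm_sign s w) perm_word s w. *)
Definition perm_word r (s : 'S_r) (w : r.-tuple (letter Q n)) :
    r.-tuple (letter Q n) := [tuple tnth w (s i) | i < r].

Definition perm_sign r (s : 'S_r) (w : r.-tuple (letter Q n)) : bool :=
  odd #|[set p : 'I_r * 'I_r |
         [&& p.1 < p.2, s p.2 < s p.1,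
             is_edge (tnth w (s p.1)) & is_edge (tnth w (s p.2))]%N]|.

End Words.

(** * The super-bialgebra S_Q(n) *)

Section Schur.
Variables (k : fieldType) (Q : quiver) (n : nat).
Implicit Types (x y : 'T[k]_(Q, n)).

Definition bilin (K : choiceType) (f : K -> K -> {malg k[K]})
    (x y : {malg k[K]}) : {malg k[K]} :=
  \sum_(u <- msupp x) \sum_(v <- msupp y) (x@_u * y@_v) *: f u v.

Definition tmul : 'T[k]_(Q, n) -> 'T[k]_(Q, n) -> 'T[k]_(Q, n) :=
  bilin (fun u v =>
    if word_mul u v is Some w then (-1) ^+ word_sign u v *: << w >> else 0).

Definition sym_invariant x : Prop :=
  forall r (s : 'S_r) (w : r.-tuple (letter Q n)),
    x@_(perm_word s w : seq _) = (-1) ^+ perm_sign s w * x@_(w : seq _).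

(* A word fixed by a permutation acting on it with sign -1 (that is, a word
   with a repeated odd letter) does not occur in x. *)
Definition alternating x : Prop :=
  forall r (s : 'S_r) (w : r.-tuple (letter Q n)),
    perm_word s w = w -> perm_sign s w -> x@_(w : seq _) = 0.

(* S_Q(n), the signed invariants.  In characteristic different from 2 the
   second condition follows from the first ([schurE]).  In characteristic 2
   it has to be imposed, the sign being invisible there: it makes S_Q(n) the
   base change to k of the signed invariants over the integers, and its graded
   dual the tensor product of the symmetric algebras on the vertex components
   and of the exterior algebras on the edge components. *)
Definition schur x : Prop := sym_invariant x /\ alternating x.

Lemma schurE x : (2%:R : k) != 0 -> schur x <-> sym_invariant x.
Proof.
move=> two; split=> [[] //|xP]; split=> // r s w sw odd_s.
have /eqP := xP r s w; rewrite sw odd_s expr1 mulN1r -subr_eq0 opprK.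
by rewrite -mulr2n -mulr_natl mulf_eq0 (negbTE two) => /eqP.
Qed.

Definition schur_deg (r : nat) x : Prop :=
  schur x /\ forall w, w \in msupp x -> size w = r.

Definition schur_homog (j : nat) x : Prop :=
  forall w, w \in msupp x -> nb_edges w = j.

End Schur.

(** * The double *)

Section Double.
Variables (k : fieldType) (Q : quiver) (n : nat).

Local Notation QQ := (dbl_quiver Q).
Local Notation W := (word QQ n).

(* Exchange of Q and its opposite, together with matrix transposition. *)
Definition letter_sigma (a : letter QQ n) : letter QQ n :=
  let: (x, i, j) := a in
  (match x with
   | inl (inl v) => inl (inr v)
   | inl (inr v) => inl (inl v)
   | inr (inl e) => inr (inr e)
   | inr (inr e) => inr (inl e)
   end, j, i).

Definition word_sigma (w : W) : W := rev (map letter_sigma w).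

(* Elements of S (x) A, where S = S_QQ(n) and A is its graded dual, are
   represented by finite sums of tensors w (x) w'^*, with w' ^* the dual basis
   of the basis of words; A is the quotient of the space spanned by the w'^*
   by the functionals vanishing on S.  With the pairing
   <a (x) b, x (x) y> = <a, x><b, y>, the product of A dual to
   deconcatenation is concatenation, and the coproduct of A dual to the
   product of S sends w^* to the sum of (-1)^(word_sign u v) u^* (x) v^* over
   the factorizations (u, v) of w. *)
Definition dbl_space := {malg k[(W * W)%type]}.

Implicit Types (x : dbl_space).

Definition pairing (u v : W) : k := (u == v)%:R.

(* Here p = (alpha_1, alpha_2) and q = (beta_1, beta_2). *)
Definition dbl_mul_basis (X Y : W * W) : dbl_space :=
  let: (a, alpha) := X in let: (b, beta) := Y in
  \sum_(i < (size a).+1) \sum_(j < (size b).+1)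
  \sum_(p <- word_cofact alpha) \sum_(q <- word_cofact beta)
    let a1 := take i a in let a2 := drop i a in
    let b1 := take j b in let b2 := drop j b in
    let s := (parity a1 && (parity a2 (+) parity b1))
             (+) (parity b1 && parity alpha)
             (+) (parity p.1 && parity beta) in
    ((-1) ^+ s * (-1) ^+ word_sign p.1 p.2 * (-1) ^+ word_sign q.1 q.2
      * pairing (word_sigma a1) q.1 * pairing p.2 (word_sigma b2)) *:
    (if word_mul a2 b1 is Some w
     then (-1) ^+ word_sign a2 b1 *: << (w, q.2 ++ p.1) >> else 0).

Definition dbl_mul : dbl_space -> dbl_space -> dbl_space := bilin dbl_mul_basis.

(* Evaluation of the second factor at y. *)
Definition contract x (y : 'T[k]_(QQ, n)) : 'T[k]_(QQ, n) :=
  \sum_(p <- msupp x) (x@_p * y@_(p.2)) *: << p.1 >>.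

Definition dbl_null x : Prop :=
  forall y : 'T[k]_(QQ, n), schur y -> contract x y = 0.

Definition is_left (a : letter QQ n) : bool :=
  match a.1.1 with
  | inl (inl _) | inr (inl _) => true
  | inl (inr _) | inr (inr _) => false
  end.

(* D_Q(n, r), up to [dbl_null]: the first factor is in S_Q(n, r1), the second
   one in A_{Q^op}(n, r2), with r1 + r2 = r. *)
Definition schiver_deg (r : nat) x : Prop :=
  (forall w' : W, schur (contract x << w' >>)) /\
  (forall p, p \in msupp x ->
     [/\ all is_left p.1, all (predC is_left) p.2
       & (size p.1 + size p.2)%N = r]).

Definition schiver_homog (j : nat) x : Prop :=
  forall p, p \in msupp x ->
    (nb_edges p.1 + 2 * nb_verts p.2 + nb_edges p.2)%N = j.

Definition letter_inl (a : letter Q n) : letter QQ n :=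
  let: (x, i, j) := a in
  (match x with inl v => inl (inl v) | inr e => inr (inl e) end, i, j).

End Double.

(** * Right multiplication by d_r *)

(* y is the product of x by the possibly infinite sum of the f t: all products
   of x by large enough finite partial sums are equal to y. *)
Definition is_mul_sum (k : fieldType) (M : lmodType k) (mul : M -> M -> M)
    (T : choiceType) (f : T -> M) (x y : M) : Prop :=
  exists F0 : {fset T}, forall F : {fset T},
    (F0 `<=` F)%fset -> mul x (\sum_(t <- F) f t) = y.

Section Differential.
Variables (k : fieldType) (Q : quiver) (n r : nat).

(* Coordinates of the unit of P_Q(n) and of the sum d over all edges of the
   identity matrix. *)
Definition one_coef (a : letter Q n) : k := (~~ is_edge a && (a.1.2 == a.2))%:R.
Definition d_coef (a : letter Q n) : k := (is_edge a && (a.1.2 == a.2))%:R.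

(* Coordinates of d_r = \sum_p 1 (x) ... (x) d (x) ... (x) 1. *)
Definition dr_coef (t : r.-tuple (letter Q n)) : k :=
  \sum_(p < r) \prod_(q < r)
    (if q == p then d_coef (tnth t q) else one_coef (tnth t q)).

Definition dr_schur (t : r.-tuple (letter Q n)) : 'T[k]_(Q, n) :=
  dr_coef t *: << (t : word Q n) >>.

Definition dr_schiver (t : r.-tuple (letter Q n)) : dbl_space k Q n :=
  dr_coef t *:
    << ((map (@letter_inl Q n) t : word (dbl_quiver Q) n),
        ([::] : word (dbl_quiver Q) n)) >>.

End Differential.

(** * Linear exact sequences *)

(* The periodic sequence ... -> A -> A -> A -> ... with differential d, where
   A = X / (X \cap Z) is an algebra with product induced by mul, regarded as a
   left module over itself: x and y in X have the same class when Z (x - y).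
   [deg j] is the set of homogeneous elements of
   degree j. *)
Record linear_exact_sequence (k : fieldType) (M : lmodType k)
    (X Z : M -> Prop) (mul : M -> M -> M) (deg : nat -> M -> Prop)
    (d : M -> M) : Prop := LinearExactSequence {
  les_mul : forall x y, X x -> X y -> X (mul x y);
  les_mul_null : forall x y, X x -> X y -> Z x \/ Z y -> Z (mul x y);
  les_diff : forall x, X x -> X (d x);
  les_diff_null : forall x, X x -> Z x -> Z (d x);
  les_diff_linear : forall (c : k) x y, X x -> X y ->
    Z (d (c *: x + y) - (c *: d x + d y));
  les_diff_module : forall a x, X a -> X x -> Z (d (mul a x) - mul a (d x));
  les_diff_degree : forall j x, X x -> deg j x -> deg j.+1 (d x);
  les_complex : forall x, X x -> Z (d (d x));
  les_exact : forall x, X x -> Z (d x) -> exists2 y, X y & Z (x - d y)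
}.

(* Main.v *)
Require Import Defs.
From HB Require Import structures.
From mathcomp Require Import all_boot all_order all_algebra all_fingroup.
From mathcomp Require Import finmap zify ring.
From mathcomp.multinomials Require Import monalg.

(** Right multiplication by [d] sends each matrix unit of the vertex [v_(i+1)] to
  the same matrix unit of the edge [e_i] and kills the edges: it matches the even
  and the odd matrix units of P(n) bijectively.  The r-th signed invariants with
  [d_r] are therefore the part of degree r of a tensor product, over the matched
  pairs (x, e), of the complexes sending the divided power x^(a) to x^(a-1) e;
  each of these is contractible in positive degree, in every characteristic.  To
  contract the tensor product one chooses a pair among those occurring in a word,
  by a rule depending only on the set of these pairs, and moves back from e to x.

  On the double, right multiplication by [d_r] sends [a (x) alpha] to
  [(-1)^|alpha| d a (x) alpha + a (x) d^* alpha], where [d^*] is the transpose of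
  right multiplication by [d].  It is contracted by the contraction [h] of the
  first factor when [a] has positive degree, and by the transpose of [h] on the
  second factor when [a] has degree 0.  Evaluating the second factor on signed
  invariants turns [d^*] into [d] and gives the statements modulo the functionals
  vanishing on them. *)

Set Implicit Arguments.
Unset Strict Implicit.
Unset Printing Implicit Defensive.

Import GRing.Theory.
Local Open Scope ring_scope.

(** Moving every edge back to its vertex, all occurrences at once, is a derivation [s] with
    [d s + s d = r], of no help when the characteristic divides [r]. Moving back a single letter of
    a single pair avoids this division: on divided powers it sends [x^(a) e] to [x^(a+1)] with
    coefficient 1. The sum [d_r] is infinite, but a word has only finitely many factorizations.
    Elements are therefore read as coefficient functions on words, where multiplying by a function
    of infinite support makes sense, and operators are followed through their transposes. The
    argument runs over any quiver whose source map is bijective; for the double the target map is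
    bijective too, being the source map of the opposite copy. On the double, [d^*] comes from the
    coproduct of [d_r], a sum of terms [d_i (x) 1 + 1 (x) d_j]: the first part multiplies [a], the
    second is paired with [alpha]. The contraction of the first factor breaks down only where that
    factor is the empty word; as [r >= 1], the second factor then has positive length and can be
    contracted instead. *)

Local Notation sg b := ((-1) ^+ nat_of_bool b).

(** * Linear extension *)

Section LinearExtension.
Variables (k : fieldType) (K : choiceType).
Implicit Types (x y : {malg k[K]}) (u v w : K).

Definition lext (V : lmodType k) (F : K -> V) x : V :=
  \sum_(u <- msupp x) x@_u *: F u.

Definition ev (g : K -> k) x : k := \sum_(u <- msupp x) x@_u * g u.

Lemma evE g x : ev g x = lext (g : K -> k^o) x.
Proof. by []. Qed.

Lemma lextEw (V : lmodType k) (F : K -> V) x (S : {fset K}) :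
  (msupp x `<=` S)%fset -> lext F x = \sum_(u <- S) x@_u *: F u.
Proof.
move=> sS; apply: big_fset_incl => // u _ nu.
by rewrite mcoeff_outdom // scale0r.
Qed.

Lemma lext_is_linear (V : lmodType k) (F : K -> V) : linear (lext F).
Proof.
move=> c x y.
pose S := (msupp x `|` msupp y `|` msupp (c *: x + y))%fset.
have sx : (msupp x `<=` S)%fset by rewrite /S -fsetUA fsubsetUl.
have sy : (msupp y `<=` S)%fset.
  by rewrite (fsubset_trans (fsubsetUr (msupp x) _)) // fsubsetUl.
have sxy : (msupp (c *: x + y) `<=` S)%fset by rewrite fsubsetUr.
rewrite (lextEw F sx) (lextEw F sy) (lextEw F sxy).
rewrite scaler_sumr -big_split; apply: eq_bigr => u _ /=.
by rewrite mcoeffD mcoeffZ scalerDl scalerA.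
Qed.

HB.instance Definition _ (V : lmodType k) (F : K -> V) :=
  GRing.isLinear.Build k {malg k[K]} V _ (lext F) (lext_is_linear F).

Lemma lextU (V : lmodType k) (F : K -> V) u : lext F << u >> = F u.
Proof.
by rewrite /lext msuppU oner_eq0 big_seq_fset1 mcoeffUU scale1r.
Qed.

Lemma eq_lext (V : lmodType k) (F G : K -> V) x :
  {in msupp x, F =1 G} -> lext F x = lext G x.
Proof. by move=> FG; rewrite /lext; apply: eq_big_seq => u /FG ->. Qed.

Lemma linear_lext (V V' : lmodType k) (h : {linear V -> V'}) (F : K -> V) x :
  h (lext F x) = lext (fun u => h (F u)) x.
Proof. by rewrite linear_sum; apply: eq_bigr => u _; rewrite linearZ. Qed.

Lemma lext_id x : lext (fun u => << u >>) x = x.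
Proof.
apply/malgP => w; rewrite {2}[x]monalgE !raddf_sum /=; apply: eq_bigr => u _.
by rewrite mcoeffZ !mcoeffU mulr_natr.
Qed.

Lemma lextD (V : lmodType k) (F G : K -> V) x :
  lext (fun u => F u + G u) x = lext F x + lext G x.
Proof. by rewrite -big_split; apply: eq_bigr => u _; rewrite scalerDr. Qed.

Lemma lext_scale (V : lmodType k) c (F : K -> V) x :
  lext (fun u => c *: F u) x = c *: lext F x.
Proof.
by rewrite scaler_sumr; apply: eq_bigr => u _; rewrite !scalerA mulrC.
Qed.

Lemma lext_sum (V : lmodType k) I (s : seq I) (P : pred I) (F : I -> K -> V) x :
  lext (fun u => \sum_(i <- s | P i) F i u) x = \sum_(i <- s | P i) lext (F i) x.
Proof.
rewrite exchange_big; apply: eq_bigr => u _ /=; by rewrite scaler_sumr.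
Qed.

Lemma lext0 (V : lmodType k) x : lext (fun=> 0 : V) x = 0.
Proof. by rewrite /lext big1 // => u _; rewrite scaler0. Qed.

Lemma evU g u : ev g << u >> = g u.
Proof. by rewrite evE lextU. Qed.

Lemma evD g x y : ev g (x + y) = ev g x + ev g y.
Proof. by rewrite !evE raddfD. Qed.

Lemma evZ g c x : ev g (c *: x) = c * ev g x.
Proof. by rewrite !evE linearZ. Qed.

Lemma ev0 g : ev g 0 = 0.
Proof. by rewrite !evE raddf0. Qed.

Lemma ev_sum g I (s : seq I) (P : pred I) (F : I -> {malg k[K]}) :
  ev g (\sum_(i <- s | P i) F i) = \sum_(i <- s | P i) ev g (F i).
Proof. by rewrite !evE raddf_sum. Qed.

Lemma eq_ev g g' x : {in msupp x, g =1 g'} -> ev g x = ev g' x.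
Proof. exact: (@eq_lext k^o). Qed.

Lemma ev_delta x w : ev (fun u => (u == w)%:R) x = x@_w.
Proof.
rewrite -[in RHS](lext_id x) raddf_sum; apply: eq_bigr => u _ /=.
by rewrite mcoeffZ mcoeffU.
Qed.

Lemma ev_scale c g x : ev (fun u => c * g u) x = c * ev g x.
Proof. by rewrite mulr_sumr; apply: eq_bigr => u _; rewrite mulrCA. Qed.

Lemma ev_sumf I (s : seq I) (P : pred I) (F : I -> K -> k) x :
  ev (fun u => \sum_(i <- s | P i) F i u) x = \sum_(i <- s | P i) ev (F i) x.
Proof. exact: (@lext_sum k^o). Qed.

(** Symmetry of the standard pairing. It turns a transposition identity between two operators on
    basis words into a formula for the coefficients of the image of any element. *)
Lemma evC x y : ev (mcoeff^~ y) x = ev (mcoeff^~ x) y.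
Proof.
pose S := (msupp x `|` msupp y)%fset.
rewrite !evE !(@lextEw _ _ _ S) ?fsubsetUl ?fsubsetUr //.
by apply: eq_bigr => u _; exact: mulrC.
Qed.

End LinearExtension.

Lemma mcoeff_lext (k : fieldType) (K K' : choiceType)
    (F : K -> {malg k[K']}) x w : (lext F x)@_w = ev (fun u => (F u)@_w) x.
Proof. by rewrite raddf_sum; apply: eq_bigr => u _ /=; rewrite mcoeffZ. Qed.

Lemma ev_lext (k : fieldType) (K K' : choiceType)
    (F : K -> {malg k[K']}) g x : ev g (lext F x) = ev (fun u => ev g (F u)) x.
Proof. by rewrite ev_sum; apply: eq_bigr => u _; rewrite evZ. Qed.

Lemma lext_comp (k : fieldType) (K K' : choiceType) (V : lmodType k)
    (G : K' -> V) (F : K -> {malg k[K']}) x :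
  lext G (lext F x) = lext (fun u => lext G (F u)) x.
Proof. exact: linear_lext. Qed.

Lemma msupp_lext (k : fieldType) (K K' : choiceType) (F : K -> {malg k[K']}) x w :
  w \in msupp (lext F x) -> exists2 u, u \in msupp x & w \in msupp (F u).
Proof.
rewrite -mcoeff_neq0 mcoeff_lext => nz.
have [/hasP[u ux uw]|/hasPn no] := boolP (has (fun u => w \in msupp (F u)) (msupp x)).
  by exists u.
case/eqP: nz; rewrite /ev big_seq big1 // => u /no.
by rewrite -mcoeff_eq0 => /eqP->; rewrite mulr0.
Qed.

Lemma bilinE (k : fieldType) (K : choiceType) (F : K -> K -> {malg k[K]}) x y :
  bilin F x y = lext (fun u => lext (F u) y) x.
Proof.
apply: eq_bigr => u _; rewrite scaler_sumr; apply: eq_bigr => v _.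
by rewrite scalerA.
Qed.

(** * Signed invariants as superalternating functions *)

Section Parity.
Variables (Q : quiver) (n : nat).
Implicit Types (a b : letter Q n) (u v w : word Q n).

Lemma parity_cons a w : parity (a :: w) = is_edge a (+) parity w.
Proof. by rewrite /parity /nb_edges /= oddD oddb. Qed.

Lemma parity_cat u v : parity (u ++ v) = parity u (+) parity v.
Proof. by rewrite /parity /nb_edges count_cat oddD. Qed.

End Parity.

Section Superalternating.
Variables (k : fieldType) (Q : quiver) (n : nat).
Local Notation W := (word Q n).
Implicit Types (a b : letter Q n) (u v w : W) (f g : W -> k).

(** A local form of [schur], on arbitrary functions of words: it involves adjacent letters only, so
    it can be checked by induction on the prefix [u], and it imposes no finiteness of support. The
    second clause carries the information that the sign loses in characteristic 2. *)
Definition superalt f : Prop :=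
  (forall u a b v,
     f (u ++ b :: a :: v) = sg (is_edge a && is_edge b) * f (u ++ a :: b :: v)) /\
  (forall u a v, is_edge a -> f (u ++ a :: a :: v) = 0).

Lemma superalt_ext f g : f =1 g -> superalt f -> superalt g.
Proof. by move=> E [f1 f2]; split=> *; rewrite -!E; [apply: f1|apply: f2]. Qed.

Lemma superalt_catl f z : superalt f -> superalt (fun w => f (z ++ w)).
Proof. by case=> f1 f2; split=> *; rewrite !catA; [apply: f1|apply: f2]. Qed.

Lemma superalt_cons f a : superalt f -> superalt (fun w => f (a :: w)).
Proof. exact: (@superalt_catl f [:: a]). Qed.

Lemma superalt_catr f z : superalt f -> superalt (fun w => f (w ++ z)).
Proof.
by case=> f1 f2; split=> *; rewrite -!catA /=; [apply: f1|apply: f2].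
Qed.

Lemma superalt_twist f (b : bool) : superalt f ->
  superalt (fun w => sg (parity w && b) * f w).
Proof.
case=> f1 f2; split=> [u a c v|u a v ea]; last by rewrite f2 ?mulr0.
rewrite f1 mulrCA; congr (_ * (sg (_ && b) * _)).
by rewrite !parity_cat !parity_cons [is_edge c (+) _]addbCA.
Qed.

Lemma superaltZ f c : superalt f -> superalt (fun w => c * f w).
Proof.
by case=> f1 f2; split=> [u a b v|*]; rewrite ?f2 ?mulr0 // f1 mulrCA.
Qed.

Lemma superalt0 : superalt (fun=> 0).
Proof. by split=> *; rewrite ?mulr0. Qed.

Lemma superaltD f g : superalt f -> superalt g -> superalt (fun w => f w + g w).
Proof.
move=> [f1 f2] [g1 g2]; split=> [u a b v|*]; last by rewrite f2 // g2 // addr0.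
by rewrite f1 g1 mulrDr.
Qed.

Lemma superalt_sum I (s : seq I) (P : pred I) (F : I -> W -> k) :
  (forall i, P i -> superalt (F i)) ->
  superalt (fun w => \sum_(i <- s | P i) F i w).
Proof.
move=> FP; elim: s => [|i s IH].
  by apply: superalt_ext superalt0 => w; rewrite big_nil.
have [Pi|nPi] := boolP (P i).
  by apply: superalt_ext (superaltD (FP i Pi) IH) => w; rewrite big_cons Pi.
by apply: superalt_ext IH => w; rewrite big_cons (negbTE nPi).
Qed.

Lemma superalt_move f u a v w : superalt f ->
  f (u ++ a :: v ++ w) = sg (is_edge a && parity v) * f (u ++ v ++ a :: w).
Proof.
move=> fP; elim: v u => [|b v IH] u; first by rewrite andbF mul1r.
rewrite /= fP.1 -cat_rcons IH cat_rcons mulrA; congr (_ * _).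
by rewrite -signr_addb parity_cons andb_addr [is_edge b && _]andbC.
Qed.

Lemma superalt_rep f u a v w : superalt f -> is_edge a ->
  f (u ++ a :: v ++ a :: w) = 0.
Proof. by move=> fP ea; rewrite superalt_move // catA fP.2 // mulr0. Qed.

Fixpoint odd_inversions (e : pred nat) (l : seq nat) : bool :=
  if l is p :: l' then
    (e p && odd (count (fun q => (q < p)%N && e q) l')) (+) odd_inversions e l'
  else false.

(** One step of insertion sort: moving [p] past the smaller entries collects the sign of the edges
    crossed. The list [t] is chosen before [f], because the induction applies the statement to
    [fun w => f (g q :: w)]. *)
Lemma superalt_insert (g : nat -> letter Q n) p s : sorted leq s ->
  exists t, [/\ sorted leq t, perm_eq t (p :: s) & forall f, superalt f ->
    f (map g (p :: s)) =
    sg (is_edge (g p) && odd (count (fun q => (q < p)%N && is_edge (g q)) s))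
    * f (map g t)].
Proof.
elim: s => [|q s IH] /= ss.
  by exists [:: p]; split=> // f _; rewrite andbF mul1r.
have [qp|pq] := ltnP q p.
  have [t [st pt tP]] := IH (path_sorted ss).
  exists (q :: t); split.
  - rewrite /= path_sortedE; last exact: leq_trans.
    rewrite st (perm_all _ pt) /= ltnW //=.
    by rewrite andbT; apply: order_path_min ss => //; apply: leq_trans.
  - by apply/seq.permP => z /=; rewrite (seq.permP pt) /= addnCA.
  - move=> f fP; have := fP.1 [::] (g q) (g p) (map g s) => /= ->.
    rewrite (tP _ (superalt_cons (g q) fP)) mulrA -signr_addb; congr (sg _ * _).
    by rewrite oddD oddb; case: (is_edge (g p)); case: (is_edge (g q)).
exists [:: p, q & s]; split=> //=; first by rewrite pq.
move=> f _; rewrite -[LHS]mul1r; congr (_ * _).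
have /allP min := order_path_min leq_trans ss.
rewrite (@eq_in_count _ _ pred0) ?count_pred0 ?andbF // => z /min qz.
by rewrite ltnNge (leq_trans pq qz).
Qed.

Lemma superalt_sort (g : nat -> letter Q n) s :
  exists t, [/\ sorted leq t, perm_eq t s & forall f, superalt f ->
    f (map g s) = sg (odd_inversions (fun i => is_edge (g i)) s) * f (map g t)].
Proof.
elim: s => [|p s [t [st pt tP]]]; first by exists [::]; split=> // f _; rewrite mul1r.
have [t' [st' pt' tP']] := superalt_insert g p st.
exists t'; split=> //; first by rewrite (perm_trans pt') // perm_cons.
move=> f fP /=; have := tP _ (superalt_cons (g p) fP) => /= ->.
rewrite (tP' f fP) mulrA -signr_addb addbC; congr (sg (_ && odd _ (+) _) * _).
exact/seq.permP.
Qed.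

Lemma perm_sign_odd_inversions r (s : 'S_r) (w : r.-tuple (letter Q n)) x0 :
  perm_sign s w = odd_inversions (fun i => is_edge (nth x0 w i))
                    [seq val (s i) | i <- enum 'I_r].
Proof.
set e := fun i => _.
have inv l : odd_inversions e l = odd (\sum_(i < size l) \sum_(j < size l)
    [&& (i < j)%N, (nth 0 l j < nth 0 l i)%N, e (nth 0 l i) & e (nth 0 l j)])%N.
  elim: l => [|p l IH] /=; first by rewrite big_ord0.
  rewrite big_ord_recl big_ord_recl /= add0n oddD IH; congr (_ (+) odd _).
    rewrite -sum1_count big_mkcond (big_nth 0%N) big_mkord /=.
    case: (e p) => /=; last by rewrite big1 // => j _; rewrite andbF.
    by congr odd; apply: eq_bigr => j _; rewrite /= lt0n; case: ifP => ->.
  by apply: eq_bigr => i _; rewrite big_ord_recl /= add0n.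
rewrite inv /perm_sign -sum1dep_card big_mkcond /=; congr odd.
have sz : size [seq val (s i) | i <- enum 'I_r] = r by rewrite size_map size_enum_ord.
have nv (p : 'I_r) : nth 0%N [seq val (s i) | i <- enum 'I_r] p = s p.
  by rewrite (nth_map p) ?size_enum_ord // nth_ord_enum.
rewrite sz pair_bigA /=.
apply: eq_bigr => -[i j] _ /=.
rewrite !nv.
by rewrite /e !(tnth_nth x0); case: ifP.
Qed.

(** Sorting the values of [s] gives [0, ..., r-1], so the same adjacent exchanges turn
    [perm_word s w] into [w]; the sign collected on the way is the parity of the inversions between
    edges. *)
Lemma superalt_perm_word f r (s : 'S_r) (w : r.-tuple (letter Q n)) :
  superalt f -> f (perm_word s w) = sg (perm_sign s w) * f w.
Proof.
move=> fP; case: r s w => [|r] s w.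
  rewrite tuple0 [in RHS]tuple0 /perm_sign.
  rewrite (_ : [set _ | _] = set0) ?cards0 ?mul1r //.
  by apply/setP=> -[[]].
pose x0 := thead w.
have [t [st pt tP]] := superalt_sort (nth x0 w) [seq val (s i) | i <- enum 'I_r.+1].
rewrite (perm_sign_odd_inversions _ _ x0).
have -> : (perm_word s w : seq _) = map (nth x0 w) [seq val (s i) | i <- enum 'I_r.+1].
  by rewrite /= -map_comp; apply: eq_map => i /=; rewrite (tnth_nth x0).
rewrite tP //; congr (_ * f _).
have -> : t = iota 0 r.+1.
  apply: (sorted_eq leq_trans anti_leq) => //; first exact: iota_sorted.
  apply: perm_trans pt _; apply: uniq_perm; rewrite ?iota_uniq //.
    by rewrite map_inj_uniq ?enum_uniq // => i j /val_inj/perm_inj.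
  move=> i; rewrite mem_iota add0n; apply/mapP/idP => [[j _ ->]|ir].
    exact: ltn_ord.
  by exists (s^-1%g (Ordinal ir)); rewrite ?mem_enum // permKV.
apply: (@eq_from_nth _ x0) => [|i]; rewrite size_map size_iota ?size_tuple // => ir.
by rewrite (nth_map 0%N) ?size_iota // nth_iota.
Qed.

Lemma perm_word_adjacent u a b v :
  exists s : 'S_(size (u ++ a :: b :: v)),
  (perm_word s (in_tuple (u ++ a :: b :: v)) : seq _) = u ++ b :: a :: v /\
  perm_sign s (in_tuple (u ++ a :: b :: v)) = is_edge a && is_edge b.
Proof.
set w := u ++ _; set r := size w.
have ir : (size u < r)%N by rewrite /r size_cat /=; lia.
have jr : ((size u).+1 < r)%N by rewrite /r size_cat /=; lia.
pose i := Ordinal ir; pose j := Ordinal jr.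
have ni : nth a w i = a by rewrite nth_cat ltnn subnn.
have nj : nth a w j = b by rewrite nth_cat ltnNge leqnSn /= subSnn.
exists (tperm i j); split.
  apply: (@eq_from_nth _ a) => [|p]; rewrite size_tuple.
    by rewrite /r !size_cat.
  move=> pr; rewrite -[p]/(val (Ordinal pr)) -tnth_nth tnth_mktuple (tnth_nth a).
  case: tpermP => [->|->|] /=.
  - by rewrite nj nth_cat ltnn subnn.
  - by rewrite ni nth_cat ltnNge leqnSn /= subSnn.
  - move=> /eqP/=; rewrite -val_eqE /= => pi /eqP; rewrite -val_eqE /= => pj.
    rewrite !nth_cat; case: ltnP => // pu.
    case E: (p - size u)%N => [|[|m]] //=; exfalso; move: pi pj pu E;
      move: (size u) => su *; lia.
rewrite /perm_sign.
have tn p : tnth (in_tuple w) p = nth a w p by rewrite (tnth_nth a).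
have tpv x : (tperm i j x : nat) = if x == size u :> nat then (size u).+1
    else if x == (size u).+1 :> nat then size u else x.
  case: tpermP => [->|->|/eqP + /eqP]; rewrite -?val_eqE /= ?eqxx //.
    by rewrite gtn_eqF.
  by move=> /negbTE-> /negbTE->.
(* A transposition of neighbours has exactly one inversion, so the sign depends only on whether both
   exchanged letters are edges. *)
have only (p q : 'I_r) : (p < q)%N -> (tperm i j q < tperm i j p)%N -> p = i /\ q = j.
  rewrite !tpv => pq qp; have [pu qu] : (p : nat) = size u /\ (q : nat) = (size u).+1.
    move: (p : nat) (q : nat) (size u) pq qp => {}p {}q su pq.
    by do !case: eqP => ?; lia.
  by split; apply: val_inj.
have [eab|neab] := boolP (is_edge a && is_edge b).
  rewrite (_ : [set _ | _] = [set (i, j)]) ?cards1 //.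
  apply/setP => -[p q]; rewrite !inE /= !tn.
  apply/idP/eqP => [/and4P[pq qp _ _]|[-> ->]].
    by have [-> ->] := only _ _ pq qp.
  by case/andP: eab => ea eb; rewrite tpermL tpermR ni nj ea eb /= !ltnSn.
rewrite (_ : [set _ | _] = set0) ?cards0 //.
apply/setP => -[p q]; rewrite !inE /= !tn; apply/negP => /and4P[pq qp].
have [-> ->] := only _ _ pq qp; rewrite tpermL tpermR ni nj => eb ea.
by rewrite ea eb in neab.
Qed.

(** Adjacent transpositions generate the symmetric group, which matches the first conditions. For
    [alternating], a permutation fixing [w] with sign -1 inverts some pair of edge positions, hence
    moves one of them; since it preserves [w], an edge occurs at two positions and the coefficient
    vanishes by [superalt_rep]. *)
Lemma schurP (x : 'T[k]_(Q, n)) : schur x <-> superalt (mcoeff^~ x).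
Proof.
split=> [[xs xa]|xP].
  split=> [u a b v|u a v ea].
    have [s [sw ss]] := perm_word_adjacent u a b v.
    by have := xs _ s (in_tuple (u ++ a :: b :: v)); rewrite sw ss.
  have [s [sw ss]] := perm_word_adjacent u a a v.
  have sw' : perm_word s (in_tuple (u ++ a :: a :: v)) = in_tuple (u ++ a :: a :: v).
    exact/val_inj.
  by have := xa _ s (in_tuple (u ++ a :: a :: v)) sw'; rewrite ss ea; apply.
split=> r s w; first exact: superalt_perm_word.
move=> sw; rewrite /perm_sign => odd_s.
have [[p q]] : exists p, p \in [set p : 'I_r * 'I_r |
         [&& p.1 < p.2, s p.2 < s p.1,
             is_edge (tnth w (s p.1)) & is_edge (tnth w (s p.2))]%N].
  by apply/set0Pn; apply: contraTneq odd_s => ->; rewrite cards0.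
rewrite inE /= => /and4P[pq sqp ep eq].
have rep (i j : 'I_r) : (i < j)%N -> tnth w i = tnth w j ->
    is_edge (tnth w i) -> x@_(w : seq _) = 0.
  move=> ij wij ei; pose a := tnth w i.
  have ai : nth a w i = a by rewrite -tnth_nth.
  have aj : nth a w j = a by rewrite -tnth_nth -wij.
  rewrite -(cat_take_drop i w) (drop_nth a) ?size_tuple // ai.
  rewrite -(cat_take_drop (j - i.+1) (drop _ _)) drop_drop subnK //.
  by rewrite (@drop_nth _ a j) ?size_tuple // aj; apply: superalt_rep.
have ws i : tnth w (s i) = tnth w i by rewrite -{2}sw tnth_mktuple.
have [sp|psp|/val_inj sp] := ltngtP (s p) p.
- exact: (rep _ _ sp).
- by apply: (rep _ _ psp) => //; rewrite -ws.
have [sq|qsq|/val_inj sq] := ltngtP (s q) q.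
- exact: (rep _ _ sq).
- by apply: (rep _ _ qsq) => //; rewrite -ws.
by move: sqp; rewrite sp sq ltnNge ltnW.
Qed.

End Superalternating.

(** The terms at [(s, t)] and [(t, s)] cancel. The vanishing of the diagonal is a separate
    assumption because it does not follow from antisymmetry in characteristic 2. *)
Lemma big_antisym (V : zmodType) (I : eqType) (l : seq I) (T : I -> I -> V) :
  {in l, forall s, T s s = 0} -> {in l &, forall s t, T t s = - T s t} ->
  \sum_(s <- l) \sum_(t <- l) T s t = 0.
Proof.
elim: l => [|x l IH] T0 TN; first by rewrite big_nil.
rewrite big_cons; under eq_bigr do rewrite big_cons.
rewrite big_cons big_split /= T0 ?mem_head // add0r IH; first last.
- by move=> s t sl tl; rewrite TN // inE ?sl ?tl orbT.
- by move=> s sl; rewrite T0 // inE sl orbT.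
rewrite addr0 -big_split big_seq big1 //= => t tl.
by rewrite (TN x t) ?mem_head ?inE ?tl ?orbT // addrN.
Qed.

Lemma uniq_flatten (T U : eqType) (F : T -> seq U) (g : U -> T) (s : seq T) :
  uniq s -> (forall x, uniq (F x)) -> (forall x, {in F x, forall y, g y = x}) ->
  uniq (flatten [seq F x | x <- s]).
Proof.
move=> us uF gF; elim: s us => //= x s IH /andP[xs us].
rewrite cat_uniq uF IH // andbT; apply/hasPn => y /flattenP[_ /mapP[z zs ->] yz].
by apply/negP => /gF yx; rewrite -(gF z y yz) yx (negbTE xs) in zs *.
Qed.

Lemma big_pred1_uniq (V : nmodType) (I : eqType) (s : seq I) i (F : I -> V) :
  uniq s -> i \in s -> \sum_(j <- s | j == i) F j = F i.
Proof.
elim: s => //= j s IH /andP[js us]; rewrite inE big_cons.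
have [ij|ij] := eqVneq i j => /= [_|si]; last by rewrite IH.
rewrite big_seq_cond big1 ?addr0 ?ij // => l /andP[ls /eqP li].
by move: js; rewrite -li ls.
Qed.

(** * The product of S_Q(n) on coefficient functions *)

Section Products.
Variables (k : fieldType) (Q : quiver) (n : nat).
Local Notation L := (letter Q n).
Local Notation W := (word Q n).
Local Notation T := 'T[k]_(Q, n).
Implicit Types (a b c : L) (u v w : W) (f g : W -> k) (x y : T).

(* [wmul] is the product of S_Q(n) read on coefficient functions ([tmulE]). *)
Definition mulw u v : T :=
  if word_mul u v is Some w then sg (word_sign u v) *: << w >> else 0.

Definition wmul f g w : k :=
  \sum_(p <- word_cofact w) sg (word_sign p.1 p.2) * (f p.1 * g p.2).

Lemma letter_cofact_uniq c : uniq (letter_cofact c).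
Proof.
case: c => [[x i] j].
apply: (@uniq_flatten _ _ _ (fun q : L * L => q.1.2)); first exact: enum_uniq.
  by case: x => [v|e] l //=; rewrite inE; apply/norP; split=> //; apply/eqP=> -[].
by case: x => [v|e] l q; rewrite !inE; [move=> /eqP-> | case/orP=> /eqP->].
Qed.

Lemma word_cofact_uniq w : uniq (word_cofact w).
Proof.
elim: w => //= c w IH; apply: allpairs_uniq => //; first exact: letter_cofact_uniq.
by move=> [[a b] [u v]] [[a' b'] [u' v']] _ _ /= [-> -> -> ->].
Qed.

Lemma letter_cofact_parity c q :
  q \in letter_cofact c -> is_edge c = is_edge q.1 (+) is_edge q.2.
Proof.
case: q => a b; rewrite letter_cofactP /letter_mul.
case: ifP => // _; case: a b => [[[v|e] i] j] [[[v'|e'] i'] j'] //=;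
  by case: ifP => // _ /eqP[<-].
Qed.

Lemma word_cofact_parity w p :
  p \in word_cofact w -> parity w = parity p.1 (+) parity p.2.
Proof.
elim: w p => [|c w IH] p /=; first by rewrite inE => /eqP->.
case/allpairsP=> -[q p'] /= [ql pl ->] /=; rewrite !parity_cons.
by rewrite (letter_cofact_parity ql) (IH _ pl); apply: addbACA.
Qed.

Lemma size_word_cofact w p : p \in word_cofact w -> size p.1 = size w /\ size p.2 = size w.
Proof.
elim: w p => [|c w IH] p /=; first by rewrite inE => /eqP->.
by case/allpairsP=> -[q p'] /= [_ /IH[e1 e2] ->] /=; rewrite e1 e2.
Qed.

(** Since [word_cofact w] lists each factorization of [w] exactly once, at most one summand is
    nonzero. *)
Lemma mcoeff_mulw u v w : (mulw u v)@_w =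
  \sum_(p <- word_cofact w) sg (word_sign p.1 p.2) * ((u == p.1)%:R * (v == p.2)%:R).
Proof.
have [uvw|uvw] := boolP ((u, v) \in word_cofact w).
  rewrite (bigD1_seq (u, v)) ?word_cofact_uniq //= !eqxx !mulr1 big1 ?addr0.
    by move: uvw; rewrite word_cofactP /mulw => /eqP->; rewrite mcoeffZ mcoeffUU mulr1.
  by move=> [u' v']; rewrite eq_sym xpair_eqE -natrM mulnb => /negbTE->; rewrite mulr0.
rewrite big_seq big1 => [|[u' v'] p'].
  move: uvw; rewrite word_cofactP /mulw; case: word_mul => [z|]; last by rewrite mcoeff0.
  move=> zw; rewrite mcoeffZ mcoeffU (_ : z == w = false) ?mulr0 //.
  by apply: contraNF zw => /eqP->.
have : (u, v) != (u', v') by apply: contraNneq uvw => ->.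
by rewrite xpair_eqE -natrM mulnb => /negbTE->; rewrite mulr0.
Qed.

Lemma ev_mulw x y w :
  ev (fun u => ev (fun v => (mulw u v)@_w) y) x = wmul (mcoeff^~ x) (mcoeff^~ y) w.
Proof.
pose c (p : W * W) : k := sg (word_sign p.1 p.2).
rewrite (eq_ev (g' := fun u => \sum_(p <- word_cofact w) (c p * y@_p.2) * (u == p.1)%:R)).
  rewrite ev_sumf; apply: eq_bigr => p _.
  by rewrite ev_scale ev_delta -mulrA [y@__ * _]mulrC.
move=> u _.
rewrite (eq_ev (g' := fun v => \sum_(p <- word_cofact w)
  (c p * (u == p.1)%:R) * (v == p.2)%:R)).
  by rewrite ev_sumf; apply: eq_bigr => p _; rewrite ev_scale ev_delta mulrAC.
by move=> v _; rewrite mcoeff_mulw; apply: eq_bigr => p _; rewrite mulrA.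
Qed.

Lemma tmulE x y w : (tmul x y)@_w = wmul (mcoeff^~ x) (mcoeff^~ y) w.
Proof.
rewrite -ev_mulw /tmul bilinE mcoeff_lext; apply: eq_ev => u _.
by rewrite mcoeff_lext.
Qed.

(** The twist is the sign for moving the first letter [q.2] of the second factor across the
    remaining letters [u] of the first. *)
Lemma wmul_cons f g c w :
  wmul f g (c :: w) = \sum_(q <- letter_cofact c)
    wmul (fun u => sg (parity u && is_edge q.2) * f (q.1 :: u))
         (fun v => g (q.2 :: v)) w.
Proof.
rewrite /wmul /= big_allpairs_dep; apply: eq_bigr => q _; apply: eq_bigr => p _ /=.
by rewrite signr_addb; ring.
Qed.

(** Induction on the prefix reduces to two leading letters, which are both factored. Exchanging them
    exchanges the two sums, and [swap] compares the summands: the sign depends on the total parity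
    of each factorization, which is the parity of the factored letter. *)
Lemma superalt_wmul f g : superalt f -> superalt g -> superalt (wmul f g).
Proof.
have swap f' g' (fP : superalt f') (gP : superalt g') q1 q2 w :
    wmul (fun u => sg (parity u && is_edge q1.2) *
            (sg (parity (q1.1 :: u) && is_edge q2.2) * f' (q2.1 :: q1.1 :: u)))
         (fun v => g' (q2.2 :: q1.2 :: v)) w =
    sg ((is_edge q1.1 (+) is_edge q1.2) && (is_edge q2.1 (+) is_edge q2.2)) *
    wmul (fun u => sg (parity u && is_edge q2.2) *
            (sg (parity (q2.1 :: u) && is_edge q1.2) * f' (q1.1 :: q2.1 :: u)))
         (fun v => g' (q1.2 :: q2.2 :: v)) w.
  rewrite mulr_sumr; apply: eq_bigr => p _.
  rewrite (fP.1 [::] q1.1) (gP.1 [::] q1.2) !parity_cons.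
  by do !case: (is_edge _); case: (parity _); rewrite /= ?expr0 ?expr1; ring.
move=> fP gP; split=> u.
  elim: u f g fP gP => [|c u IH] f g fP gP a b v /=; last first.
    rewrite !wmul_cons mulr_sumr; apply: eq_bigr => q _; apply: IH.
      exact: (superalt_twist _ (superalt_cons _ fP)).
    exact: superalt_cons.
  rewrite !wmul_cons; under eq_bigr do rewrite wmul_cons.
  under [in RHS]eq_bigr do rewrite wmul_cons.
  rewrite exchange_big mulr_sumr; apply: eq_big_seq => q1 q1a /=.
  rewrite mulr_sumr; apply: eq_big_seq => q2 q2b /=.
  by rewrite swap // (letter_cofact_parity q1a) (letter_cofact_parity q2b).
elim: u f g fP gP => [|c u IH] f g fP gP a v ea /=; last first.
  rewrite !wmul_cons big1 // => q _; apply: IH => //.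
    exact: (superalt_twist _ (superalt_cons _ fP)).
  exact: superalt_cons.
rewrite !wmul_cons; under eq_bigr do rewrite wmul_cons.
(* Two copies of one edge are factored independently. If both are factored in the same way, one of
   the two factors has a repeated edge; if not, exchanging the factorizations changes the sign. *)
apply: big_antisym.
  move=> q qa; rewrite /wmul big1 // => p _; have := letter_cofact_parity qa.
  rewrite ea; have [E _|E /= E2] := boolP (is_edge q.1).
    by rewrite (fP.2 [::]) // !(mulr0, mul0r).
  by rewrite (gP.2 [::]) ?mulr0 // -E2.
move=> q1 q2 q1a q2a.
rewrite swap // -(letter_cofact_parity q1a) -(letter_cofact_parity q2a) ea.
by rewrite expr1 mulN1r.
Qed.

End Products.

(** * The differential and its contraction *)

Section WordOperators.
Variables (k : fieldType) (Q : quiver) (n : nat).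
Local Notation L := (letter Q n).
Local Notation W := (word Q n).
Local Notation T := 'T[k]_(Q, n).
Implicit Types (a b c : L) (u v w : W) (f g : W -> k) (x y : T).

Definition consT a : T -> T := lext (fun w => << (a :: w : W) >>).
HB.instance Definition _ a := GRing.Linear.on (consT a).

Lemma lext_consT (V : lmodType k) (F : W -> V) a x :
  lext F (consT a x) = lext (fun w => F (a :: w)) x.
Proof.
by rewrite lext_comp; apply: eq_lext => w _; rewrite lextU.
Qed.

Lemma ev_consT f a x : ev f (consT a x) = ev (fun w => f (a :: w)) x.
Proof. exact: (@lext_consT k^o). Qed.

Lemma mcoeff_consT a x b w : (consT a x)@_(b :: w) = (a == b)%:R * x@_w.
Proof.
rewrite -ev_delta ev_consT -[in RHS]ev_delta -ev_scale; apply: eq_ev => u _.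
by rewrite eqseq_cons -mulnb natrM.
Qed.

Lemma mcoeff_consT0 a x : (consT a x)@_([::] : W) = 0.
Proof. by rewrite -ev_delta ev_consT /ev big1 // => u _; rewrite mulr0. Qed.

(** The parity automorphism. After evaluation at an invariant, the sign [(-1)^|alpha|] of the
    differential of the double becomes this operator. *)
Definition twist : T -> T := lext (fun w => sg (parity w) *: << w >>).
HB.instance Definition _ := GRing.Linear.on twist.

Lemma ev_twist f x : ev f (twist x) = ev (fun w => sg (parity w) * f w) x.
Proof. by rewrite ev_lext; apply: eq_ev => w _; rewrite evZ evU. Qed.

Lemma mcoeff_twist x w : (twist x)@_w = sg (parity w) * x@_w.
Proof.
rewrite -ev_delta ev_twist -[in RHS]ev_delta -ev_scale; apply: eq_ev => u _.
by case: eqP => [->|] //; rewrite !mulr0.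
Qed.

Lemma twistK : involutive twist.
Proof. by move=> x; apply/malgP => w; rewrite !mcoeff_twist signrMK. Qed.

Lemma schur_twist x : schur x -> schur (twist x).
Proof.
move=> /schurP/(superalt_twist true) xP; apply/schurP.
by apply: superalt_ext xP => w; rewrite mcoeff_twist andbT.
Qed.

End WordOperators.

Section Differential.
Variables (k : fieldType) (Q : quiver) (n : nat).
Variables (out : vert Q -> edge Q).
Hypotheses (outK : cancel out (@src Q)) (srcK : cancel (@src Q) out).
Local Notation L := (letter Q n).
Local Notation W := (word Q n).
Local Notation T := 'T[k]_(Q, n).
Local Notation consT := (@consT k Q n).
Implicit Types (a b c m : L) (u v w : W) (f g : W -> k) (x y : T).

Definition to_edge a : L :=
  let: (x, i, j) := a in (inr (match x with inl v => out v | inr e => e end), i, j).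

Definition to_vert a : L :=
  let: (x, i, j) := a in (inl (match x with inl v => v | inr e => src e end), i, j).

Lemma is_edge_to_edge a : is_edge (to_edge a).
Proof. by case: a => [[x i] j]. Qed.

Lemma is_edge_to_vert a : is_edge (to_vert a) = false.
Proof. by case: a => [[x i] j]. Qed.

Lemma to_edgeK a : to_vert (to_edge a) = to_vert a.
Proof. by case: a => [[[v|e] i] j] //=; rewrite outK. Qed.

Lemma to_vertK a : to_edge (to_vert a) = to_edge a.
Proof. by case: a => [[[v|e] i] j] //=; rewrite srcK. Qed.

Lemma to_edge_id a : is_edge a -> to_edge a = a.
Proof. by case: a => [[[v|e] i] j]. Qed.

Lemma to_vert_id a : ~~ is_edge a -> to_vert a = a.
Proof. by case: a => [[[v|e] i] j]. Qed.

Lemma to_vertKK a : to_vert (to_vert a) = to_vert a.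
Proof. by rewrite to_vert_id ?is_edge_to_vert. Qed.

Lemma eq_to_edge a b :
  (~~ is_edge a && (to_edge a == b)) = (is_edge b && (to_vert b == a)).
Proof.
apply/andP/andP => -[ea /eqP <-].
  by rewrite is_edge_to_edge to_edgeK to_vert_id.
by rewrite is_edge_to_vert to_vertK to_edge_id.
Qed.

(* [diff] is right multiplication by the sum of all [d_r], [codiff_word] its
   transpose, and [bd] the action of [diff] on coefficient functions; the latter
   is composition with [codiff_word] ([ev_codiff], [mcoeff_diff]). *)
Fixpoint diff_word w : T :=
  if w is a :: w' then
    (if is_edge a then 0 else sg (parity w') *: << (to_edge a :: w' : W) >>)
    + consT a (diff_word w')
  else 0.

Fixpoint codiff_word w : T :=
  if w is a :: w' then
    (if is_edge a then sg (parity w') *: << (to_vert a :: w' : W) >> else 0)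
    + consT a (codiff_word w')
  else 0.

Fixpoint bd f w : k :=
  if w is a :: w' then
    (if is_edge a then sg (parity w') * f (to_vert a :: w') else 0)
    + bd (fun v => f (a :: v)) w'
  else 0.

Definition diff : T -> T := lext diff_word.
HB.instance Definition _ := GRing.Linear.on diff.

Lemma ev_codiff f w : ev f (codiff_word w) = bd f w.
Proof.
elim: w f => [|a w IH] f /=; first exact: ev0.
by rewrite evD ev_consT IH; congr (_ + _); case: ifP; rewrite ?ev0 // evZ evU.
Qed.

(** Raising a vertex and lowering an edge are inverse to each other ([eq_to_edge]), and their common
    sign depends only on the letters to the right, which do not change. *)
Lemma mcoeff_diff_word u w : (diff_word u)@_w = (codiff_word w)@_u.
Proof.
elim: u w => [|a u IH] [|b w] /=.
- by [].
- rewrite mcoeffD mcoeff_consT0 mcoeff0 addr0; case: (is_edge b); last by rewrite mcoeff0.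
  by rewrite mcoeffZ mcoeffU mulr0.
- rewrite mcoeffD mcoeff_consT0 mcoeff0 addr0; case: (is_edge a); first by rewrite mcoeff0.
  by rewrite mcoeffZ mcoeffU mulr0.
rewrite !mcoeffD !mcoeff_consT IH eq_sym; congr (_ + _).
have := eq_to_edge a b; case: (is_edge a); case: (is_edge b) => /=.
- move=> ab; rewrite mcoeff0 mcoeffZ mcoeffU eqseq_cons -ab mulr0 //.
- by rewrite !mcoeff0.
- move=> ab; rewrite !mcoeffZ !mcoeffU !eqseq_cons ab [w == u]eq_sym.
  by have [->|_] := eqVneq u w; rewrite ?andbF ?mulr0.
- by move=> ab; rewrite mcoeff0 mcoeffZ mcoeffU eqseq_cons ab mulr0.
Qed.

Lemma mcoeff_diff x w : (diff x)@_w = bd (mcoeff^~ x) w.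
Proof.
rewrite mcoeff_lext -ev_codiff evC; apply: eq_ev => u _.
exact: mcoeff_diff_word.
Qed.

(** Records what is known of the words at which [bd f w] evaluates [f]: same underlying vertex
    letters, opposite parity, no new edge. In [bd_bh] this allows substituting under [bd] formulas
    that hold only for such words. *)
Lemma eq_bd f g w :
  (forall v, map to_vert v = map to_vert w -> parity v = ~~ parity w ->
     (forall a, is_edge a -> a \in v -> a \in w) -> f v = g v) ->
  bd f w = bd g w.
Proof.
elim: w f g => //= a w IH f g fg; congr (_ + _).
  case: ifP => // ea; congr (_ * _); apply: fg.
  - by rewrite /= to_vertKK.
  - by rewrite !parity_cons is_edge_to_vert ea addFb negbK.
  - move=> b eb; rewrite !inE => /predU1P[ba|->]; last exact: orbT.
    by rewrite ba is_edge_to_vert in eb.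
apply: IH => v vw pv sub; apply: fg; first by rewrite /= vw.
  by rewrite !parity_cons pv addbN.
by move=> b eb; rewrite !inE => /predU1P[->|/(sub _ eb)->]; rewrite ?eqxx ?orbT.
Qed.

Lemma bd_ext f g w : f =1 g -> bd f w = bd g w.
Proof. by move=> fg; apply: eq_bd => *; apply: fg. Qed.

Lemma bdZ (c : k) f w : bd (fun v => c * f v) w = c * bd f w.
Proof. by rewrite -!ev_codiff ev_scale. Qed.

Lemma bd0 w : bd (fun=> 0) w = 0.
Proof. by rewrite -ev_codiff /ev big1 // => u _; rewrite mulr0. Qed.

Lemma bd_twist f w :
  bd (fun v => sg (parity v) * f v) w = - (sg (parity w) * bd f w).
Proof.
rewrite -mulNr -signrN -bdZ; apply: eq_bd => v _ -> _; by [].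
Qed.

Lemma bd_cons f a w : bd f (a :: w) =
  (if is_edge a then sg (parity w) * f (to_vert a :: w) else 0)
    + bd (fun v => f (a :: v)) w.
Proof. by []. Qed.

(** Lowering the head and a letter of the tail occurs in both orders. Lowering in the tail changes
    the parity read by the sign of the head, so the two contributions are opposite ([bd_twist]). *)
Lemma bd_bd f w : bd (bd f) w = 0.
Proof.
elim: w f => //= a w IH f.
have bdD g h : bd (fun v => g v + h v) w = bd g w + bd h w.
  by rewrite -!ev_codiff /ev -big_split; apply: eq_bigr => u _ /=; rewrite mulrDr.
rewrite bdD IH addr0; case: ifP => ea; last by rewrite bd0 addr0.
by rewrite is_edge_to_vert add0r (bd_twist (fun v => f (to_vert a :: v))) addrN.
Qed.

(** For a repeated edge, lowering the first or the second copy gives opposite contributions, since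
    the sign of the first counts the second edge; lowering any other letter leaves the
    repetition. *)
Lemma superalt_bd f : superalt f -> superalt (bd f).
Proof.
move=> fP; split=> u.
  elim: u f fP => [|c u IH] f fP a b v /=; last first.
    rewrite mulrDr (IH _ (superalt_cons c fP)); congr (_ + _).
    case: ifP => _; last by rewrite mulr0.
    rewrite (superalt_cons (to_vert c) fP).1 !parity_cat !parity_cons.
    by rewrite mulrCA [is_edge b (+) _]addbCA.
  have -> : bd (fun w => f [:: b, a & w]) v =
      sg (is_edge a && is_edge b) * bd (fun w => f [:: a, b & w]) v.
    by rewrite -bdZ; apply: bd_ext => w; apply: (fP.1 [::]).
  rewrite !mulrDr !addrA; congr (_ + _); rewrite addrC; congr (_ + _).
    case ea: (is_edge a); last by rewrite mulr0.
    rewrite (fP.1 [::] (to_vert a)) is_edge_to_vert mul1r !parity_cons.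
    by rewrite mulrA -signr_addb; congr (sg _ * _); case: (is_edge b); case: (parity v).
  case eb: (is_edge b); last by rewrite mulr0.
  rewrite (fP.1 [::] _ (to_vert b)) is_edge_to_vert andbF mul1r !parity_cons.
  by rewrite mulrA -signr_addb; congr (sg _ * _); case: (is_edge a); case: (parity v).
elim: u f fP => [|c u IH] f fP a v ea /=; last first.
  rewrite (IH _ (superalt_cons c fP)) // addr0; case: ifP => // _.
  by rewrite (superalt_cons (to_vert c) fP).2 // mulr0.
rewrite ea (@bd_ext _ (fun=> 0)) ?bd0 ?addr0 => [|w]; last exact: (fP.2 [::]).
rewrite (fP.1 [::] _ (to_vert a)) is_edge_to_vert andbF mul1r parity_cons ea.
by rewrite addTb signrN mulNr addNr.
Qed.

Lemma schur_diff x : schur x -> schur (diff x).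
Proof.
move=> /schurP/superalt_bd xP; apply/schurP.
by apply: superalt_ext xP => w; rewrite mcoeff_diff.
Qed.

Lemma diff_diff x : diff (diff x) = 0.
Proof.
apply/malgP => w; rewrite mcoeff_diff mcoeff0 -[RHS](bd_bd (mcoeff^~ x) w).
by apply: bd_ext => v; rewrite mcoeff_diff.
Qed.

Lemma diff_twist x : diff (twist x) = - twist (diff x).
Proof.
apply/malgP => w; rewrite mcoeffN mcoeff_twist !mcoeff_diff -bd_twist.
by apply: bd_ext => v; rewrite mcoeff_twist.
Qed.

End Differential.

Lemma mem_swap (I : eqType) (u v : seq I) a b :
  u ++ [:: b, a & v] =i u ++ [:: a, b & v].
Proof. by move=> c; rewrite !mem_cat !inE; congr (_ || _); rewrite orbCA. Qed.

(** * The contracting homotopy attached to a pivot *)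

Section Homotopy.
Variables (k : fieldType) (Q : quiver) (n : nat).
Variables (out : vert Q -> edge Q).
Hypotheses (outK : cancel out (@src Q)) (srcK : cancel (@src Q) out).
Local Notation L := (letter Q n).
Local Notation W := (word Q n).
Local Notation T := 'T[k]_(Q, n).
Local Notation consT := (@consT k Q n).
Local Notation to_edge := (@to_edge Q n out).
Local Notation to_vert := (@to_vert Q n).
Local Notation bd := (@bd k Q n).
Local Notation diff := (@diff k Q n out).
Implicit Types (a b c m : L) (u v w : W) (f g : W -> k) (x y : T).

(* [choose] makes the pivot depend only on the set of the vertex letters
   underlying the letters of a :: w, hence invariant under permutations and under
   the replacement of a letter by its partner. *)
Definition pivot a w : L :=
  choose (fun b => b \in map to_vert (a :: w)) (to_vert a).

Lemma pivot_mem a w : pivot a w \in map to_vert (a :: w).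
Proof. by apply: (@chooseP _ (fun b => b \in _)); rewrite mem_head. Qed.

Lemma pivot_vert a w : is_edge (pivot a w) = false.
Proof. by have /mapP[b _ ->] := pivot_mem a w; rewrite is_edge_to_vert. Qed.

Lemma eq_pivot a u b v :
  map to_vert (a :: u) =i map to_vert (b :: v) -> pivot a u = pivot b v.
Proof.
move=> uv; rewrite /pivot (@eq_choose _ _ (fun c => c \in map to_vert (b :: v))).
  by apply: choose_id; rewrite ?mem_head // -uv mem_head.
exact: uv.
Qed.

Fixpoint raise m w : T :=
  if w is a :: w' then
    if a == m then
      if to_edge m \in w' then 0 else sg (parity w') *: << (to_edge m :: w' : W) >>
    else if a == to_edge m then 0 else consT a (raise m w')
  else 0.

Fixpoint lower m w : T :=
  if w is a :: w' then
    if a == to_edge m then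
      if to_edge m \in w' then 0 else sg (parity w') *: << (m :: w' : W) >>
    else if a == m then 0 else consT a (lower m w')
  else 0.

(* [cohomot_word] replaces the first occurrence of the pivot by its edge partner,
   provided that this partner does not already occur; [homot_word] is its
   transpose and [bh] the composition with it. *)
Definition homot_word w : T := if w is a :: w' then lower (pivot a w') w else 0.
Definition cohomot_word w : T := if w is a :: w' then raise (pivot a w') w else 0.
Definition homot : T -> T := lext homot_word.
HB.instance Definition _ := GRing.Linear.on homot.

(** With [e] the partner of [m], both coefficients are nonzero exactly when [w = w1 m w2] and
    [u = w1 e w2], where [w1] contains neither [m] nor [e] and [w2] does not contain [e]; both are
    then the sign of [w2]. *)
Lemma mcoeff_lower m u w : is_edge m = false -> (lower m u)@_w = (raise m w)@_u.
Proof.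
move=> vm; have mE : (m == to_edge m) = false.
  by apply: contraFF vm => /eqP->; apply: is_edge_to_edge.
elim: u w => [|a u IH] [|b w] /=.
- by [].
- case: (b == m); first by case: (_ \in _); rewrite !mcoeff0 ?mcoeffZ ?mcoeffU ?mulr0.
  by case: (b == _); rewrite ?mcoeff_consT0 !mcoeff0.
- case: (a == to_edge m); first by case: (_ \in _); rewrite !mcoeff0 ?mcoeffZ ?mcoeffU ?mulr0.
  by case: (a == m); rewrite ?mcoeff_consT0 !mcoeff0.
have [->|aE] := eqVneq a (to_edge m).
  have [->|bm] := eqVneq b m.
    have [->|uw] := eqVneq u w.
      by case: (_ \in _); [rewrite !mcoeff0 | rewrite !mcoeffZ !mcoeffUU].
    have N : forall c, (c :: u == c :: w :> W) = false.
      by move=> c; rewrite eqseq_cons eqxx (negbTE uw).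
    have N' : forall c, (c :: w == c :: u :> W) = false.
      by move=> c; rewrite eq_sym N.
    transitivity (0 : k).
      by case: (_ \in u); [rewrite mcoeff0 | rewrite mcoeffZ mcoeffU N mulr0].
    by case: (_ \in w); [rewrite mcoeff0 | rewrite mcoeffZ mcoeffU N' mulr0].
  transitivity (0 : k).
    case: ifP => _; first by rewrite mcoeff0.
    by rewrite mcoeffZ mcoeffU eqseq_cons eq_sym (negbTE bm) mulr0.
  have [_|bE] := eqVneq b (to_edge m); first by rewrite mcoeff0.
  by rewrite mcoeff_consT (negbTE bE) mul0r.
have [->|am] := eqVneq a m.
  have [->|bm] := eqVneq b m.
    case: ifP => _; first by rewrite !mcoeff0.
    by rewrite mcoeff0 mcoeffZ mcoeffU eqseq_cons eq_sym mE mulr0.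
  have [_|bE] := eqVneq b (to_edge m); first by rewrite !mcoeff0.
  by rewrite mcoeff0 mcoeff_consT (negbTE bm) mul0r.
have [->|bm] := eqVneq b m.
  rewrite mcoeff_consT (negbTE am) mul0r; case: ifP => _; first by rewrite mcoeff0.
  by rewrite mcoeffZ mcoeffU eqseq_cons eq_sym (negbTE aE) mulr0.
have [->|bE] := eqVneq b (to_edge m); first by rewrite mcoeff_consT (negbTE aE) mul0r mcoeff0.
by rewrite !mcoeff_consT IH eq_sym.
Qed.

Lemma raise_supp m w u : is_edge m = false -> u \in msupp (raise m w) ->
  exists w1 w2, w = w1 ++ m :: w2 /\ u = w1 ++ to_edge m :: w2.
Proof.
move=> vm; elim: w u => [|a w IH] u /=; first by rewrite msupp0.
have [->|am] := eqVneq a m.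
  case: ifP => _; first by rewrite msupp0.
  move=> /(fsubsetP (msuppZ_le _ _)); rewrite msuppU oner_eq0 inE => /eqP->.
  by exists [::], w.
case: ifP => _; first by rewrite msupp0.
case/msupp_lext => v /IH[w1 [w2 [-> ->]]].
by rewrite msuppU oner_eq0 inE => /eqP->; exists (a :: w1), w2.
Qed.

Lemma cohomot_supp w u : u \in msupp (cohomot_word w) ->
  exists w1 m w2, [/\ is_edge m = false, w = w1 ++ m :: w2 & u = w1 ++ to_edge m :: w2].
Proof.
case: w => [|a w]; first by rewrite msupp0.
have vm := pivot_vert a w.
case/(raise_supp vm) => w1 [w2 [-> ->]]; exists w1, (pivot a w), w2; by split.
Qed.

(** The two sides use the pivots of different words. These agree when the underlying vertex words
    agree, and otherwise both coefficients vanish, because [raise] preserves the underlying vertex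
    word. *)
Lemma mcoeff_homot_word u w : (homot_word u)@_w = (cohomot_word w)@_u.
Proof.
case: u w => [|a u] [|b w].
- by [].
- by rewrite /homot_word /cohomot_word -mcoeff_lower ?pivot_vert.
- by rewrite /homot_word /cohomot_word mcoeff_lower ?pivot_vert.
rewrite /homot_word /cohomot_word mcoeff_lower; last exact: pivot_vert.
have [/(congr1 (fun s z => z \in s)) E|ne] :=
    eqVneq (map to_vert (a :: u)) (map to_vert (b :: w)).
  by rewrite (eq_pivot (fun z => congr1 (@^~ z) E)).
have z m : is_edge m = false -> (raise m (b :: w))@_(a :: u) = 0.
  move=> vm; apply/eqP; rewrite mcoeff_eq0; apply: contra ne.
  case/(raise_supp vm) => w1 [w2 [-> ->]]; rewrite !map_cat /= to_edgeK //.
by rewrite !z ?pivot_vert.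
Qed.

Fixpoint raisef m f w : k :=
  if w is a :: w' then
    if a == m then
      if to_edge m \in w' then 0 else sg (parity w') * f (to_edge m :: w')
    else if a == to_edge m then 0 else raisef m (fun v => f (a :: v)) w'
  else 0.

Lemma ev_raise f m w : ev f (raise m w) = raisef m f w.
Proof.
elim: w f => [|a w IH] f /=; first exact: ev0.
case: (a == m); first by case: (_ \in _); [rewrite ev0 | rewrite evZ evU].
by case: (a == _); [rewrite ev0 | rewrite ev_consT IH].
Qed.

Lemma eq_raisef m f g w : f =1 g -> raisef m f w = raisef m g w.
Proof. by move=> fg; rewrite -!ev_raise; apply: eq_ev => v _. Qed.

Lemma raisefZ m (c : k) f w : raisef m (fun v => c * f v) w = c * raisef m f w.
Proof. by rewrite -!ev_raise ev_scale. Qed.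

(** The delicate case exchanges the raised [m] with another letter [b]: the sign of [b] against the
    edge partner compensates the change of the prefactor, leaving no sign, as befits the even letter
    [m]. *)
Lemma superalt_raisef f m : is_edge m = false -> superalt f -> superalt (raisef m f).
Proof.
move=> vm fP; split=> u.
  elim: u f fP => [|c u IH] f fP a b v /=; last first.
    rewrite (mem_swap u v a b) (IH _ (superalt_cons c fP)).
    rewrite (superalt_cons (to_edge m) fP).1.
    rewrite !parity_cat !parity_cons [is_edge b (+) _]addbCA.
    case: (c == m); last by case: (c == _); rewrite ?mulr0.
    by case: (_ \in _); rewrite ?mulr0 // mulrCA.
  have [am|am] := eqVneq a m; have [bm|bm] := eqVneq b m.
  - by rewrite am bm vm mul1r.
  - rewrite am vm mul1r inE; have [bE|bE] := eqVneq b (to_edge m); first by [].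
    rewrite /= (fP.1 [::] (to_edge m)) is_edge_to_edge parity_cons.
    by case: (_ \in _); rewrite //= mulrA -signr_addb addbC.
  - rewrite bm vm andbF mul1r inE; have [aE|aE] := eqVneq a (to_edge m); first by [].
    rewrite /= (fP.1 [::] a) is_edge_to_edge parity_cons andbT.
    by case: (_ \in _); rewrite //= mulrA -signr_addb addbC addKb.
  have [aE|aE] := eqVneq a (to_edge m); have [bE|bE] := eqVneq b (to_edge m);
    rewrite ?mulr0 //.
  by rewrite -raisefZ; apply: eq_raisef => w; apply: (fP.1 [::]).
elim: u f fP => [|c u IH] f fP a v ea /=; last first.
  rewrite (IH _ (superalt_cons c fP)) // (superalt_cons (to_edge m) fP).2 // mulr0.
  by rewrite !if_same.
have [am|am] := eqVneq a m; first by rewrite -am ea in vm.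
case: (a == _) => //; rewrite (@eq_raisef _ _ (fun v => 0 * f v)).
  by rewrite raisefZ mul0r.
by move=> w; rewrite mul0r; apply: (fP.2 [::]).
Qed.

Definition bh f w : k := if w is a :: w' then raisef (pivot a w') f w else 0.

Lemma ev_cohomot f w : ev f (cohomot_word w) = bh f w.
Proof. by case: w => [|a w]; [exact: ev0 | exact: ev_raise]. Qed.

Lemma mcoeff_homot x w : (homot x)@_w = bh (mcoeff^~ x) w.
Proof.
rewrite mcoeff_lext -ev_cohomot evC; apply: eq_ev => u _.
exact: mcoeff_homot_word.
Qed.

Lemma superalt_bh f : superalt f -> superalt (bh f).
Proof.
move=> fP; split=> [u a b v|u a v ea].
  have ne : exists c w c' w', [/\ u ++ [:: b, a & v] = c :: w,
     u ++ [:: a, b & v] = c' :: w' & pivot c w = pivot c' w'].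
    case: u => [|c u].
      exists b, (a :: v), a, (b :: v); split; [by []|by []|apply: eq_pivot].
      exact: (mem_swap [::] (map to_vert v)).
    exists c, (u ++ [:: b, a & v]), c, (u ++ [:: a, b & v]).
    split; [by []|by []|apply: eq_pivot].
    rewrite -!cat_cons !map_cat; exact: mem_swap.
  have [c [w [c' [w' [e1 e2 ep]]]]] := ne.
  rewrite e1 e2 /bh ep -e1 -e2; exact: (superalt_raisef (pivot_vert _ _) fP).1.
have [c [w e]] : exists c w, u ++ [:: a, a & v] = c :: w.
  by case: u => [|c u]; [exists a, (a :: v) | exists c, (u ++ [:: a, a & v])].
rewrite e /bh -e; exact: (superalt_raisef (pivot_vert _ _) fP).2.
Qed.

Lemma schur_homot x : schur x -> schur (homot x).
Proof.
move=> /schurP/superalt_bh xP; apply/schurP.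
by apply: superalt_ext xP => w; rewrite mcoeff_homot.
Qed.

(** The defect [G] is superalternating, so a letter of the pivot pair may be moved to the front. If
    it is the edge, lowering it and raising it again gives back [f], and all other terms vanish. If
    it is the vertex and the edge is absent, raising it and lowering it again gives [f], and the
    terms that also lower a letter of the tail cancel. *)
Lemma bd_bh f w : superalt f -> w != [::] -> bd (bh f) w + bh (bd f) w = f w.
Proof.
move=> fP; pose G w := bd (bh f) w + bh (bd f) w - f w.
suff: w != [::] -> G w = 0 by move=> h /h/subr0_eq.
have GP : superalt G.
  apply: superaltD; last first.
    by apply: superalt_ext (superaltZ (-1) fP) => v; rewrite mulN1r.
  apply: superaltD; first exact/superalt_bd/superalt_bh.
  exact/superalt_bh/superalt_bd.
case: w => // a w _; set m := pivot a w.
have vm : is_edge m = false by apply: pivot_vert.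
have mE : (m == to_edge m) = false.
  by apply: contraFF vm => /eqP->; apply: is_edge_to_edge.
(* The edge partner is preferred, so that [c] is the vertex only if the edge does not occur in the
   word. *)
have [c [w1 [w2 [aw cm cE]]]] : exists c w1 w2, [/\ a :: w = w1 ++ c :: w2,
    to_vert c = m & ~~ is_edge c -> to_edge m \notin a :: w].
  have [/splitPr[w1 w2]|nE] := boolP (to_edge m \in a :: w).
    exists (to_edge m), w1, w2; split=> //; last by rewrite is_edge_to_edge.
    by rewrite to_edgeK // to_vert_id // vm.
  have /mapP[c /splitPr[w1 w2] mc] := pivot_mem a w.
  by exists c, w1, w2.
have -> : G (a :: w) = sg (is_edge c && parity w1) * G (c :: w1 ++ w2).
  have := superalt_move [::] c w1 w2 GP; rewrite /= -aw => ->.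
  by rewrite signrMK.
suff -> : G (c :: w1 ++ w2) = 0 by rewrite mulr0.
have pm : pivot c (w1 ++ w2) = m.
  apply: eq_pivot => z; rewrite aw !map_cat /= !inE !mem_cat /= inE.
  by rewrite map_cat mem_cat orbCA.
have {cE} cE : ~~ is_edge c -> to_edge m \notin w1 ++ w2.
  by move=> /cE; rewrite aw !mem_cat inE orbCA negb_or => /andP[].
move: (w1 ++ w2) pm cE => {w1 w2 aw} z pm cE.
(* For a tail with the vertex letters of [z], the pivot is still [m], whether the head is [m] or its
   partner. *)
have bhm g v : map to_vert v = map to_vert z ->
    bh g (m :: v) = if to_edge m \in v then 0 else sg (parity v) * g (to_edge m :: v).
  move=> vz; rewrite /bh (_ : pivot m v = m) /= ?eqxx //.
  rewrite -{2}pm; apply: eq_pivot => t; rewrite /= vz cm (to_vert_id (negbT vm)) //.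
have bhE g v : map to_vert v = map to_vert z -> bh g (to_edge m :: v) = 0.
  move=> vz; rewrite /bh (_ : pivot (to_edge m) v = m).
    by rewrite /= eq_sym mE eqxx.
  rewrite -{2}pm; apply: eq_pivot => t /=.
  by rewrite vz cm (to_edgeK outK) (to_vert_id (negbT vm)).
have [ec|vc] := boolP (is_edge c).
  have -> : c = to_edge m by rewrite -cm to_vertK // to_edge_id.
  have [mz|mz] := boolP (to_edge m \in z).
    case/splitPr: mz => z1 z2; have := superalt_rep [::] z1 z2 GP (is_edge_to_edge out m).
    exact.
  rewrite /G bhE // addr0 bd_cons is_edge_to_edge to_edgeK // (to_vert_id (negbT vm)).
  rewrite bhm // (negbTE mz) signrMK.
  rewrite (@eq_bd _ _ _ _ (fun=> 0)) ?bd0 ?addr0 ?subrr //.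
  by move=> v vz _ _; apply: bhE.
have mz := cE vc; have cE' : c = m by rewrite -cm to_vert_id.
rewrite cE' /G (bhm _ z) // (negbTE mz) !bd_cons vm is_edge_to_edge add0r.
rewrite to_edgeK // (to_vert_id (negbT vm)) mulrDr signrMK.
(* No edge is created by [bd], so the partner of [m] stays absent from [v]; the parity of [v] is
   opposite to that of [z], which gives the minus sign needed to cancel. *)
rewrite (@eq_bd _ _ _ _ (fun v => - sg (parity z) * f (to_edge m :: v))).
  by rewrite bdZ mulNr addrCA addNr addr0 subrr.
move=> v vz pv sub; rewrite bhm // (_ : to_edge m \in v = false) ?pv ?signrN //.
by apply: contraNF mz => /sub; apply; apply: is_edge_to_edge.
Qed.

End Homotopy.

(** * Compatibility of the differential with products *)

Section ProductDifferential.
Variables (k : fieldType) (Q : quiver) (n : nat).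
Variables (out : vert Q -> edge Q).
Hypotheses (outK : cancel out (@src Q)) (srcK : cancel (@src Q) out).
Local Notation L := (letter Q n).
Local Notation W := (word Q n).
Local Notation T := 'T[k]_(Q, n).
Local Notation to_edge := (@to_edge Q n out).
Local Notation to_vert := (@to_vert Q n).
Local Notation bd := (@bd k Q n).
Local Notation wmul := (@wmul k Q n).
Local Notation diff := (@diff k Q n out).
Implicit Types (a b c m : L) (u v w : W) (f g : W -> k) (x y : T).

Lemma big_letter_cofact_vert (V : nmodType) (F : L * L -> V) z i j :
  \sum_(q <- letter_cofact ((inl z, i, j) : L)) F q =
  \sum_l F ((inl z, i, l), (inl z, l, j)).
Proof.
rewrite /letter_cofact big_flatten big_map big_enum /=.
by apply: eq_bigr => l _; rewrite big_seq1.
Qed.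

Lemma big_letter_cofact_edge (V : nmodType) (F : L * L -> V) e i j :
  \sum_(q <- letter_cofact ((inr e, i, j) : L)) F q =
  \sum_l (F ((inl (src e), i, l), (inr e, l, j)) +
          F ((inr e, i, l), (inl (tgt e), l, j))).
Proof.
rewrite /letter_cofact big_flatten big_map big_enum /=.
by apply: eq_bigr => l _; rewrite big_cons big_seq1.
Qed.

Lemma eq_wmul f f' g g' w : f =1 f' -> g =1 g' -> wmul f g w = wmul f' g' w.
Proof. by move=> ff gg; apply: eq_bigr => p _; rewrite ff gg. Qed.

Lemma eq_wmul_in f f' g g' w :
  (forall p, p \in word_cofact w -> f p.1 * g p.2 = f' p.1 * g' p.2) ->
  wmul f g w = wmul f' g' w.
Proof. by move=> fg; apply: eq_big_seq => p /fg ->. Qed.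

Lemma wmulDr f g g' w : wmul f (fun v => g v + g' v) w = wmul f g w + wmul f g' w.
Proof. by rewrite -big_split; apply: eq_bigr => p _; rewrite !mulrDr. Qed.

Lemma wmulDl f f' g w : wmul (fun v => f v + f' v) g w = wmul f g w + wmul f' g w.
Proof. by rewrite -big_split; apply: eq_bigr => p _; rewrite mulrDl mulrDr. Qed.

Lemma wmulZr (c : k) f g w : wmul f (fun v => c * g v) w = c * wmul f g w.
Proof. by rewrite mulr_sumr; apply: eq_bigr => p _; ring. Qed.

Lemma wmulZl (c : k) f g w : wmul (fun v => c * f v) g w = c * wmul f g w.
Proof. by rewrite mulr_sumr; apply: eq_bigr => p _; ring. Qed.

Lemma wmul0r f w : wmul f (fun=> 0) w = 0.
Proof. by rewrite /wmul big1 // => p _; rewrite !mulr0. Qed.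

Lemma wmul0l g w : wmul (fun=> 0) g w = 0.
Proof. by rewrite /wmul big1 // => p _; rewrite mul0r mulr0. Qed.

Lemma wmul_twist f g w :
  wmul (fun u => sg (parity u) * f u) (fun v => sg (parity v) * g v) w =
  sg (parity w) * wmul f g w.
Proof.
rewrite mulr_sumr; apply: eq_big_seq => p pw.
by rewrite (word_cofact_parity pw) signr_addb; ring.
Qed.

Lemma bd_sum I (s : seq I) (F : I -> W -> k) w :
  bd (fun v => \sum_(i <- s) F i v) w = \sum_(i <- s) bd (F i) w.
Proof. by rewrite -ev_codiff ev_sumf; apply: eq_bigr => i _; rewrite ev_codiff. Qed.

(** Among the factorizations of an edge [e], only [src e . e] has a second factor that can be
    lowered, and lowering it gives the factorization of the vertex [src e]. This is the left
    linearity of right multiplication by [d]. *)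
Lemma bd_wmul f g w : bd (wmul f g) w = wmul f (bd g) w.
Proof.
elim: w f g => [|c w IH] f g.
  by rewrite /wmul /= big_seq1 !mulr0.
rewrite bd_cons [RHS]wmul_cons.
have -> : bd (fun v => wmul f g (c :: v)) w = \sum_(q <- letter_cofact c)
    wmul (fun u => sg (parity u && is_edge q.2) * f (q.1 :: u))
      (bd (fun v => g (q.2 :: v))) w.
  rewrite (bd_ext _ (wmul_cons f g c)) bd_sum.
  by apply: eq_bigr => q _; apply: IH.
under [in RHS]eq_bigr do rewrite wmulDr.
rewrite [RHS]big_split /=; congr (_ + _).
case: c => [[[z|e] i] j].
  by rewrite big_letter_cofact_vert big1 // => l _; rewrite wmul0r.
rewrite /= wmul_cons big_letter_cofact_vert.
rewrite -[flatten _]/(letter_cofact ((inr e, i, j) : L)) big_letter_cofact_edge mulr_sumr.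
apply: eq_bigr => l _ /=; rewrite wmul0r addr0 -wmul_twist.
by apply: eq_wmul => v; rewrite ?andbF ?andbT ?mul1r.
Qed.

Definition to_tgt a : L :=
  let: (x, i, j) := a in (inl (match x with inl v => v | inr e => tgt e end), i, j).

(* The action on coefficient functions of left multiplication by [d]. *)
Fixpoint bdl f w : k :=
  if w is a :: w' then
    (if is_edge a then f (to_tgt a :: w') else 0)
    + sg (is_edge a) * bdl (fun v => f (a :: v)) w'
  else 0.

(** The associativity [(x d) y = x (d y)]. At an edge [e], the first factor of [e . tgt e] is
    lowered to [src e] on one side, the second factor of [src e . e] to [tgt e] on the other; both
    give the pair [(src e, tgt e)]. *)
Lemma wmul_bd f g w : wmul (bd f) g w = wmul f (bdl g) w.
Proof.
elim: w f g => [|c w IH] f g.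
  by rewrite /wmul /= !big_seq1 !(mulr0, mul0r).
rewrite !wmul_cons.
under eq_bigr => q _.
  rewrite (@eq_wmul _ (fun u => sg (parity u && is_edge q.2) *
     (if is_edge q.1 then sg (parity u) * f (to_vert q.1 :: u) else 0) +
     sg (is_edge q.2) * bd (fun u => sg (parity u && is_edge q.2) * f (q.1 :: u)) u)
     _ (fun v => g (q.2 :: v))) //.
    rewrite wmulDl wmulZl IH -wmulZr.
    over.
  move=> u /=; rewrite mulrDr; congr (_ + _).
  case: (is_edge q.2); last by rewrite andbF !mul1r; apply: bd_ext => v; rewrite andbF mul1r.
  rewrite andbT expr1 mulN1r -[LHS]opprK -bd_twist; congr (- _).
  by apply: bd_ext => v; rewrite andbT.
rewrite big_split; under [in RHS]eq_bigr do rewrite wmulDr.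
rewrite [RHS]big_split /=; congr (_ + _).
case: c => [[[z|e] i] j].
  rewrite !big_letter_cofact_vert !big1 // => l _ /=; first by rewrite wmul0r.
  rewrite (@eq_wmul _ (fun=> 0) _ _ _ _ (frefl _)) ?wmul0l // => u; exact: mulr0.
rewrite !big_letter_cofact_edge; apply: eq_bigr => l _ /=.
rewrite wmul0r addr0 (@eq_wmul _ (fun=> 0) _ _ _ _ (frefl _)); last by move=> u; exact: mulr0.
by rewrite wmul0l add0r; apply: eq_wmul => // u; rewrite andbF andbT mul1r.
Qed.

Lemma bd_cat f u v : bd f (u ++ v) =
  sg (parity v) * bd (fun u' => f (u' ++ v)) u + bd (fun v' => f (u ++ v')) v.
Proof.
elim: u f => [|a u IH] f /=; first by rewrite mulr0 add0r.
rewrite IH mulrDr addrA; congr (_ + _ + _).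
by case: ifP => _; rewrite ?mulr0 // parity_cat signr_addb; ring.
Qed.

Lemma diff_tmul x y : diff (tmul x y) = tmul x (diff y).
Proof.
apply/malgP => w; rewrite (mcoeff_diff outK srcK) tmulE.
rewrite (bd_ext _ (fun v => tmulE x y v)) bd_wmul.
by apply: eq_wmul => v //; rewrite (mcoeff_diff outK srcK).
Qed.

End ProductDifferential.

(** * The complex S_Q(n, r) *)

Section UnitCoefficients.
Variables (k : fieldType) (Q : quiver) (n : nat).
Local Notation L := (letter Q n).
Local Notation W := (word Q n).
Local Notation bd := (@bd k Q n).
Local Notation wmul := (@wmul k Q n).
Implicit Types (a b c : L) (u v w : W) (f g : W -> k).

(** Coordinates of the units of all tensor powers at once. Over an infinite quiver this function,
    like [dword_coef], has infinite support, so it can enter [wmul] but is not an element of the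
    tensor algebra. *)
Fixpoint unit_coef w : k :=
  if w is a :: w' then one_coef k a * unit_coef w' else 1.

Fixpoint dword_coef w : k :=
  if w is a :: w' then
    d_coef k a * unit_coef w' + one_coef k a * dword_coef w'
  else 0.

Lemma unit_coef_prod r (t : r.-tuple L) :
  unit_coef t = \prod_(q < r) one_coef k (tnth t q).
Proof.
elim: r t => [|r IH] t; first by rewrite tuple0 big_ord0.
case/tupleP: t => a t; rewrite big_ord_recl tnth0 /= IH; congr (_ * _).
by apply: eq_bigr => q _; rewrite tnthS.
Qed.

Lemma dr_coefE r (t : r.-tuple L) : dr_coef k t = dword_coef t.
Proof.
rewrite /dr_coef; elim: r t => [|r IH] t; first by rewrite tuple0 big_ord0.
case/tupleP: t => a t; rewrite big_ord_recl /= big_ord_recl eqxx tnth0.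
rewrite -IH mulr_sumr unit_coef_prod; congr (_ * _ + _).
  by apply: eq_bigr => q _; rewrite tnthS.
apply: eq_bigr => p _; rewrite big_ord_recl tnth0 /=; congr (_ * _).
by apply: eq_bigr => q _; rewrite tnthS (inj_eq lift_inj).
Qed.

Lemma wmul_unit f w : wmul f unit_coef w = f w.
Proof.
elim: w f => [|c w IH] f; first by rewrite /wmul /= big_seq1 mulr1 mul1r.
rewrite wmul_cons; under eq_bigr do rewrite wmulZr IH.
case: c => [[[z|e] i] j].
  rewrite big_letter_cofact_vert (bigD1 j) //= big1 => [|l lj].
    by rewrite /one_coef /= eqxx andbF !mul1r addr0.
  by rewrite /one_coef /= (negbTE lj) mul0r.
rewrite big_letter_cofact_edge (bigD1 j) //= big1 => [|l lj].
  by rewrite /one_coef /= eqxx andbF !mul1r mul0r add0r addr0.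
by rewrite /one_coef /= (negbTE lj) !mul0r addr0.
Qed.

(** Identifies [bd] with right multiplication by the infinite sum of all [d_r]; for a diagonal
    second letter only the index [l = j] survives in the factorization of a matrix unit. *)
Lemma wmul_dword f w : wmul f dword_coef w = bd f w.
Proof.
elim: w f => [|c w IH] f; first by rewrite /wmul /= big_seq1 !mulr0.
rewrite wmul_cons; under eq_bigr do rewrite wmulDr !wmulZr IH wmul_unit.
case: c => [[[z|e] i] j].
  rewrite big_letter_cofact_vert (bigD1 j) //= big1 => [|l lj].
    rewrite /one_coef /d_coef /= eqxx mul0r add0r mul1r addr0 add0r.
    by apply: bd_ext => v; rewrite andbF mul1r.
  by rewrite /one_coef /d_coef /= (negbTE lj) !mul0r addr0.
rewrite big_letter_cofact_edge (bigD1 j) //= big1 => [|l lj].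
  rewrite /one_coef /d_coef /= eqxx !mul0r addr0 !add0r !mul1r andbT addr0.
  by congr (_ + _); apply: bd_ext => v; rewrite andbF mul1r.
by rewrite /one_coef /d_coef /= (negbTE lj) !mul0r !addr0.
Qed.

Definition diag a : bool := a.1.2 == a.2.

Lemma unit_coef_diag w : unit_coef w != 0 -> all diag w.
Proof.
elim: w => //= a w IH; rewrite mulf_eq0 negb_or => /andP[] + /IH ->.
by rewrite /one_coef /diag; case: (a.1.2 == a.2) => //; rewrite andbF eqxx.
Qed.

Lemma dword_coef_diag w : dword_coef w != 0 -> all diag w.
Proof.
elim: w => [|a w IH] /=; first by rewrite eqxx.
have [da|nda] := boolP (diag a); last first.
  have nd : (a.1.2 == a.2) = false by apply: negbTE.
  by rewrite /one_coef /d_coef nd !andbF !mul0r addr0 eqxx.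
have [->|nz _] := eqVneq (unit_coef w) 0; last exact: unit_coef_diag.
by rewrite mulr0 add0r mulf_eq0 negb_or => /andP[_ /IH].
Qed.

Variables (out : vert Q -> edge Q).
Hypotheses (srcK : cancel (@src Q) out).

Definition unit_letter a : L :=
  (inl (match a.1.1 with inl v => v | inr e => tgt e end), a.2, a.2).

(** For a vertex [a] this is the only diagonal edge that can multiply [a] on the right. For an edge
    [a] the value is the diagonal edge that divides [a] on the right, as used in
    [letter_mul_diag_factor]. *)
Definition dedge_letter a : L :=
  (inr (match a.1.1 with inl v => out v | inr e => e end), a.2, a.2).

Lemma letter_mul_diag a b c : letter_mul a b = Some c -> diag b ->
  b \in [:: unit_letter a; dedge_letter a].
Proof.
move=> ab db; suff [->|->] : b = unit_letter a \/ b = dedge_letter a.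
- exact: mem_head.
- by rewrite in_cons mem_head orbT.
move: ab db; case: a b => [[x i] j] [[y i'] j']; rewrite /letter_mul /diag /=.
case: eqP => // <- + /eqP <-.
case: x y => [z|e] [z'|e'] //=; case: eqP => // E _; [left|right|left].
- by rewrite /unit_letter /= E.
- by rewrite /dedge_letter /= E srcK.
- by rewrite /unit_letter /= E.
Qed.

(** A finite window on [d_r]: all diagonal words whose product with [u] on the left is nonzero, and
    some others. *)
Fixpoint dword_support u : seq W :=
  if u is a :: u' then
    [seq b :: v | b <- [:: unit_letter a; dedge_letter a], v <- dword_support u']
  else [:: [::]].

Lemma word_mul_diag u v w : word_mul u v = Some w -> all diag v ->
  v \in dword_support u.
Proof.
elim: u v w => [|a u IH] [|b v] w //; rewrite [word_mul _ _]/=.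
case ab: letter_mul => [c|] //; case uv: word_mul => [w'|] // _ /andP[db dv].
by apply: (@allpairs_f _ _ _ cons); [apply: letter_mul_diag ab db | apply: IH uv dv].
Qed.

End UnitCoefficients.

Section Raise.
Variables (k : fieldType) (Q : quiver) (n : nat).
Variables (out : vert Q -> edge Q).
Hypotheses (outK : cancel out (@src Q)) (srcK : cancel (@src Q) out).
Local Notation L := (letter Q n).
Local Notation W := (word Q n).
Local Notation to_edge := (@to_edge Q n out).
Local Notation to_vert := (@to_vert Q n).
Implicit Types (a b c : L) (u v w : W).

(** The common trace on supports of both differentials and both contractions, from which lengths,
    parities and degrees are read off. *)
Definition raises u v : Prop :=
  exists w1 a w2, [/\ is_edge a = false, u = w1 ++ a :: w2 & v = w1 ++ to_edge a :: w2].

Lemma raises_size u v : raises u v -> size u = size v.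
Proof. by case=> w1 [a [w2 [_ -> ->]]]; rewrite !size_cat. Qed.

Lemma raises_nb_edges u v : raises u v -> nb_edges v = (nb_edges u).+1.
Proof.
case=> w1 [a [w2 [va -> ->]]].
by rewrite /nb_edges !count_cat /= is_edge_to_edge va addnS.
Qed.

Lemma raises_nb_verts u v : raises u v -> nb_verts u = (nb_verts v).+1.
Proof.
case=> w1 [a [w2 [va -> ->]]].
by rewrite /nb_verts !count_cat /= is_edge_to_edge va addnS.
Qed.

Lemma raises_parity u v : raises u v -> parity v = ~~ parity u.
Proof. by move=> /raises_nb_edges E; rewrite /parity E. Qed.

Lemma raises_all (P : pred L) u v : (forall a, P (to_edge a) = P a) ->
  raises u v -> all P v = all P u.
Proof. by move=> PE [w1 [a [w2 [_ -> ->]]]]; rewrite !all_cat /= PE. Qed.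

Lemma diff_word_supp w u : u \in msupp (diff_word k out w) -> raises w u.
Proof.
elim: w u => [|a w IH] u /=; first by rewrite msupp0.
move=> /(fsubsetP (msuppD_le _ _)); rewrite in_fsetU => /orP[].
  case ea: (is_edge a); first by rewrite msupp0.
  move=> /(fsubsetP (msuppZ_le _ _)); rewrite msuppU oner_eq0 inE => /eqP->.
  by exists [::], a, w.
case/msupp_lext => v /IH[w1 [b [w2 [vb -> ->]]]].
by rewrite msuppU oner_eq0 inE => /eqP->; exists (a :: w1), b, w2.
Qed.

Lemma codiff_word_supp w u : u \in msupp (codiff_word k w) -> raises u w.
Proof.
by rewrite -mcoeff_neq0 -(mcoeff_diff_word k outK srcK) mcoeff_neq0 => /diff_word_supp.
Qed.

Lemma cohomot_word_supp w u : u \in msupp (cohomot_word k out w) -> raises w u.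
Proof. by case/cohomot_supp => w1 [m [w2 [vm -> ->]]]; exists w1, m, w2. Qed.

Lemma homot_word_supp w u : u \in msupp (homot_word k out w) -> raises u w.
Proof.
by rewrite -mcoeff_neq0 (mcoeff_homot_word k outK) mcoeff_neq0 => /cohomot_word_supp.
Qed.

End Raise.

Section SchurComplex.
Variables (k : fieldType) (Q : quiver) (n : nat).
Variables (out : vert Q -> edge Q).
Hypotheses (outK : cancel out (@src Q)) (srcK : cancel (@src Q) out).
Local Notation L := (letter Q n).
Local Notation W := (word Q n).
Local Notation T := 'T[k]_(Q, n).
Local Notation bd := (@bd k Q n).
Local Notation wmul := (@wmul k Q n).
Local Notation diff := (@diff k Q n out).
Local Notation homot := (@homot k Q n out).
Implicit Types (a b c : L) (u v w : W) (f g : W -> k) (x y : T).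

Lemma bh_ext f g w : f =1 g -> bh out f w = bh out g w.
Proof. by move=> fg; rewrite -!ev_cohomot; apply: eq_ev => v _. Qed.

Lemma bd_nil f : bd f [::] = 0.
Proof. by []. Qed.

Lemma bh_nil f : bh out f [::] = 0.
Proof. by []. Qed.

Lemma diff_homot x : schur x -> x@_([::] : W) = 0 ->
  diff (homot x) + homot (diff x) = x.
Proof.
move=> /schurP xP x0; apply/malgP => w.
rewrite mcoeffD (mcoeff_diff outK srcK) (mcoeff_homot outK).
have [->|w0] := eqVneq w [::]; first by rewrite bd_nil bh_nil addr0 x0.
rewrite -[RHS](bd_bh outK srcK xP w0); congr (_ + _).
  by apply: bd_ext => v; rewrite (mcoeff_homot outK).
by apply: bh_ext => v; rewrite (mcoeff_diff outK srcK).
Qed.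

Lemma schur_tmul x y : schur x -> schur y -> schur (tmul x y).
Proof.
move=> /schurP xP /schurP yP; apply/schurP.
by apply: superalt_ext (superalt_wmul xP yP) => w; rewrite tmulE.
Qed.

Lemma msupp_tmul x y w : w \in msupp (tmul x y) ->
  exists p, [/\ p \in word_cofact w, p.1 \in msupp x & p.2 \in msupp y].
Proof.
rewrite -mcoeff_neq0 tmulE => nz.
have [/hasP[p pw /andP[px py]]|/hasPn no] :=
    boolP (has (fun p => (p.1 \in msupp x) && (p.2 \in msupp y)) (word_cofact w)).
  by exists p.
case/eqP: nz; rewrite /wmul big_seq big1 // => p /no.
rewrite negb_and -!mcoeff_eq0 => /orP[] /eqP->; by rewrite ?mul0r ?mulr0.
Qed.

Lemma diff_supp x w : w \in msupp (diff x) ->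
  exists2 u, u \in msupp x & raises out u w.
Proof. by case/msupp_lext => u ux /diff_word_supp uw; exists u. Qed.

Lemma homot_supp x w : w \in msupp (homot x) ->
  exists2 u, u \in msupp x & raises out w u.
Proof. by case/msupp_lext => u ux /(homot_word_supp outK) uw; exists u. Qed.

Lemma schur_deg_diff r x : schur_deg r x -> schur_deg r (diff x).
Proof.
move=> [xs xr]; split; first exact: schur_diff.
by move=> w /diff_supp[u /xr <- /raises_size].
Qed.

(** Only finitely many diagonal words can multiply a word of the support of [x]. Once a partial sum
    contains them, it has the coefficients of the whole [d_r] at every word that matters. *)
Lemma dr_schur_sum r x : schur_deg r x ->
  is_mul_sum (@tmul k Q n) (@dr_schur k Q n r) x (diff x).
Proof.
move=> [_ xr].
exists [fset t | t in (pmap insub (flatten [seq dword_support out u | u <- msupp x])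
  : seq (r.-tuple L))]%fset.
move=> F /fsubsetP F0; apply/malgP => w.
rewrite tmulE (mcoeff_diff outK srcK) -wmul_dword.
apply: eq_wmul_in => -[u v] /= uvw.
have [ux|] := boolP (u \in msupp x); last first.
  by rewrite -mcoeff_eq0 => /eqP->; rewrite !mul0r.
congr (_ * _); have [su sv] := size_word_cofact uvw; rewrite /= in su sv.
have vr : size v == r by rewrite sv -su (xr _ ux).
rewrite raddf_sum /=.
have E (t : r.-tuple L) : (dr_schur k t)@_v = if t == Tuple vr then dword_coef k v else 0.
  rewrite mcoeffZ mcoeffU dr_coefE -val_eqE /=.
  by case: eqP => [->|]; rewrite ?mulr1 ?mulr0.
rewrite (eq_bigr _ (fun t _ => E t)) -big_mkcond /=.
have [vF|vF] := boolP (Tuple vr \in F).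
  by rewrite big_pred1_uniq ?fset_uniq.
(* For [v] outside [F] the coefficient in [d_r] must vanish: otherwise [v] would be diagonal, hence
   in the window. *)
rewrite big_seq_cond big1 => [|t /andP[tF /eqP E']]; last by rewrite -E' tF in vF.
apply/esym/eqP; apply: contraNT vF => /dword_coef_diag dv; apply: F0.
rewrite !inE /= mem_pmap_sub /=; apply/flattenP; exists (dword_support out u).
  by apply/mapP; exists u.
by move: uvw; rewrite word_cofactP => /eqP/(word_mul_diag srcK); apply.
Qed.

Lemma schur_linear_exact r : (1 <= r)%N ->
  linear_exact_sequence (@schur_deg k Q n r) (fun x => x = 0)
    (@tmul k Q n) (@schur_homog k Q n) diff.
Proof.
move=> r1; split.
- move=> x y [xs xr] [ys _]; split; first exact: schur_tmul.
  by move=> w /msupp_tmul[p [/size_word_cofact[<- _] /xr]].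
- move=> x y _ _ [->|->]; apply/malgP => w; rewrite tmulE mcoeff0.
    by rewrite /wmul big1 // => p _; rewrite mcoeff0 mul0r mulr0.
  by rewrite /wmul big1 // => p _; rewrite mcoeff0 !mulr0.
- exact: schur_deg_diff.
- by move=> x _ ->; rewrite raddf0.
- by move=> c x y _ _; rewrite linearP subrr.
- by move=> a x _ _; rewrite (diff_tmul outK srcK) subrr.
- by move=> j x _ xj w /diff_supp[u /xj uj /raises_nb_edges ->]; rewrite uj.
- by move=> x _; rewrite (diff_diff outK srcK).
move=> x [xs xr] dx0; exists (homot x).
  split; first exact: schur_homot.
  by move=> w /homot_supp[u /xr <- /raises_size].
(* The contraction identity fails at the empty word, whose length 0 is excluded by [r >= 1]. *)
have x0 : x@_([::] : W) = 0.
  by apply/eqP; rewrite mcoeff_eq0; apply/negP => /xr r0; rewrite -r0 in r1.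
by rewrite -{1}(diff_homot xs x0) dx0 raddf0 addr0 subrr.
Qed.

End SchurComplex.

(** * The double *)

Section SchurSpace.
Variables (k : fieldType) (Q : quiver) (n : nat).
Local Notation W := (word Q n).
Local Notation T := 'T[k]_(Q, n).
Implicit Types (w : W) (x y : T).

Lemma schur0 : schur (0 : T).
Proof.
by apply/schurP; apply: superalt_ext (@superalt0 k Q n) => w; rewrite mcoeff0.
Qed.

Lemma schurZ (c : k) x : schur x -> schur (c *: x).
Proof.
move=> /schurP/(superaltZ c) xP; apply/schurP.
by apply: superalt_ext xP => w; rewrite mcoeffZ.
Qed.

Lemma schurD x y : schur x -> schur y -> schur (x + y).
Proof.
move=> /schurP xP /schurP yP; apply/schurP.
by apply: superalt_ext (superaltD xP yP) => w; rewrite mcoeffD.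
Qed.

Lemma schur_nil : schur (<< ([::] : W) >> : T).
Proof.
apply/schurP; have nz u a b v : (<< ([::] : W) >> : T)@_(u ++ a :: b :: v) = 0.
  by case: u => [|c u]; rewrite mcoeffU.
by split=> [u a b v|u a v _]; rewrite !nz ?mulr0.
Qed.

Lemma schur_lext (K : choiceType) (F : K -> T) z :
  (forall i, i \in msupp z -> schur (F i)) -> schur (lext F z).
Proof.
move=> FP; rewrite /lext big_seq; elim/big_ind: _ => [|x y|i /FP].
- exact: schur0.
- exact: schurD.
- exact: schurZ.
Qed.

(** Both operators vanish on the empty word, so the homotopy joins the identity to the projection on
    tensor degree 0. On the double it is applied to invariants of mixed tensor degree. *)
Lemma diff_homot_nil out (outK : cancel out (@src Q)) (srcK : cancel (@src Q) out) x :
  schur x ->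
  diff out (homot out x) + homot out (diff out x) = x - x@_([::] : W) *: << [::] >>.
Proof.
move=> xs; set c := x@__.
have ds : schur (x - c *: << ([::] : W) >>).
  by rewrite -scaleNr; apply: schurD => //; apply: schurZ; apply: schur_nil.
rewrite -(diff_homot outK srcK ds); last by rewrite mcoeffB mcoeffZ mcoeffUU mulr1 subrr.
have -> : homot out (x - c *: << ([::] : W) >>) = homot out x.
  by rewrite linearB linearZ /= [homot _ << _ >>]lextU scaler0 subr0.
have -> // : diff out (x - c *: << ([::] : W) >>) = diff out x.
by rewrite linearB linearZ /= [diff _ << _ >>]lextU scaler0 subr0.
Qed.

End SchurSpace.

Section DoubleComplex.
Variables (k : fieldType) (Q : quiver) (n : nat).
Variables (out inn : vert Q -> edge Q).
Hypotheses (outK : cancel out (@src Q)) (srcK : cancel (@src Q) out).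
Hypotheses (innK : cancel inn (@tgt Q)) (tgtK : cancel (@tgt Q) inn).
Local Notation QQ := (dbl_quiver Q).
Local Notation L := (letter QQ n).
Local Notation W := (word QQ n).
Local Notation T := 'T[k]_(QQ, n).
Local Notation D := (dbl_space k Q n).
Implicit Types (u v w : W) (s y z : T) (x : D).

Definition tens s z : D :=
  lext (fun a => lext (fun c => << ((a, c) : W * W) >>) z) s.

Lemma lext_tens (V : lmodType k) (F : W * W -> V) s z :
  lext F (tens s z) = lext (fun a => lext (fun c => F (a, c)) z) s.
Proof.
rewrite lext_comp; apply: eq_lext => a _; rewrite lext_comp.
by apply: eq_lext => c _; rewrite lextU.
Qed.

Lemma msupp_tens s z p : p \in msupp (tens s z) ->
  p.1 \in msupp s /\ p.2 \in msupp z.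
Proof.
case/msupp_lext => a sa /msupp_lext[c zc].
by rewrite msuppU oner_eq0 inE => /eqP->.
Qed.

Lemma contractE x y : contract x y = lext (fun p => y@_p.2 *: << p.1 >>) x.
Proof. by apply: eq_bigr => p _; rewrite scalerA. Qed.

Lemma contract_lext (K : choiceType) (F : K -> D) t y :
  contract (lext F t) y = lext (fun i => contract (F i) y) t.
Proof. by rewrite contractE lext_comp; apply: eq_lext => i _; rewrite contractE. Qed.

Lemma contract_tens s z y : contract (tens s z) y = ev (mcoeff^~ y) z *: s.
Proof.
rewrite contractE lext_tens -[in RHS](lext_id s) -lext_scale; apply: eq_lext => a _.
by rewrite /lext /ev scaler_suml; apply: eq_bigr => c _; rewrite scalerA.
Qed.

Lemma contractDl x x' y : contract (x + x') y = contract x y + contract x' y.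
Proof. by rewrite !contractE raddfD. Qed.

Lemma contractZl c x y : contract (c *: x) y = c *: contract x y.
Proof. by rewrite !contractE linearZ. Qed.

Lemma contractDr x y y' : contract x (y + y') = contract x y + contract x y'.
Proof.
rewrite !contractE -lextD; apply: eq_lext => p _.
by rewrite mcoeffD scalerDl.
Qed.

Lemma contractZr c x y : contract x (c *: y) = c *: contract x y.
Proof.
rewrite !contractE -lext_scale; apply: eq_lext => p _.
by rewrite mcoeffZ scalerA.
Qed.

Lemma contract0r x : contract x 0 = 0.
Proof.
by rewrite contractE -[RHS](lext0 _ x); apply: eq_lext => p _; rewrite mcoeff0 scale0r.
Qed.

Lemma contract_lextr x y : contract x y = lext (fun w => contract x << w >>) y.
Proof.
rewrite -[in LHS](lext_id y) (big_morph (contract x) (contractDr x) (contract0r x)).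
by apply: eq_bigr => w _; rewrite contractZr.
Qed.

Lemma schur_contract x y : (forall w, schur (contract x << w >>)) ->
  schur (contract x y).
Proof. by move=> xs; rewrite contract_lextr; apply: schur_lext. Qed.

(** In the opposite copy the edge leaving a vertex is the one entering it in [Q], whence [inn]. *)
Definition dbl_out (v : vert QQ) : edge QQ :=
  match v with inl v => inl (out v) | inr v => inr (inn v) end.

Lemma dbl_outK : cancel dbl_out (@src QQ).
Proof. by case=> v /=; rewrite ?outK ?innK. Qed.

Lemma dbl_srcK : cancel (@src QQ) dbl_out.
Proof. by case=> e /=; rewrite ?srcK ?tgtK. Qed.

Local Notation diff_word := (@diff_word k QQ n dbl_out).
Local Notation codiff_word := (@codiff_word k QQ n).
Local Notation diff := (@diff k QQ n dbl_out).
Local Notation homot := (@homot k QQ n dbl_out).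
Local Notation twist := (@twist k QQ n).

Definition ddiff_basis (p : W * W) : D :=
  sg (parity p.2) *: tens (diff_word p.1) << p.2 >> + tens << p.1 >> (codiff_word p.2).

Definition ddiff : D -> D := lext ddiff_basis.
HB.instance Definition _ := GRing.Linear.on ddiff.

Lemma contract_ddiff_basis a c y : contract (ddiff_basis (a, c)) y =
  (sg (parity c) * y@_c) *: diff_word a + bd (mcoeff^~ y) c *: << a >>.
Proof.
rewrite /ddiff_basis [LHS]contractDl [X in X + _]contractZl.
rewrite [contract _ _ in X in X + _]contract_tens evU scalerA.
by rewrite [contract _ _]contract_tens ev_codiff.
Qed.

(** Evaluation at [y] turns the sign into [twist] and the transpose into [diff]. Statements modulo
    [dbl_null] thereby reduce to identities between [diff], [homot] and [twist]. *)
Lemma contract_ddiff x y :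
  contract (ddiff x) y = diff (contract x (twist y)) + contract x (diff y).
Proof.
rewrite contract_lext [contract x _ in X in diff X]contractE linear_lext contractE -lextD.
apply: eq_lext => -[a c] _; rewrite [LHS]contract_ddiff_basis.
rewrite linearZ /= mcoeff_twist (mcoeff_diff dbl_outK dbl_srcK).
by rewrite [diff _]lextU.
Qed.

(** At most one term is nonzero, since [homot_word] vanishes on the empty word. *)
Definition dhomot_basis (p : W * W) : D :=
  sg (parity p.2) *: tens (homot_word k dbl_out p.1) << p.2 >>
  + (p.1 == [::])%:R *: tens << [::] >> (cohomot_word k dbl_out p.2).

Definition dhomot : D -> D := lext dhomot_basis.
HB.instance Definition _ := GRing.Linear.on dhomot.

Lemma contract_dhomot_basis a c y : contract (dhomot_basis (a, c)) y =
  (sg (parity c) * y@_c) *: homot_word k dbl_out a +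
  ((a == [::])%:R * bh dbl_out (mcoeff^~ y) c) *: << [::] >>.
Proof.
rewrite /dhomot_basis [LHS]contractDl [X in X + _]contractZl.
rewrite [contract _ _ in X in X + _]contract_tens evU scalerA.
by rewrite [X in _ + X]contractZl [contract _ _]contract_tens ev_cohomot scalerA.
Qed.

Lemma contract_dhomot x y : contract (dhomot x) y =
  homot (contract x (twist y)) + (contract x (homot y))@_([::] : W) *: << [::] >>.
Proof.
rewrite contract_lext [contract x _ in X in homot X]contractE linear_lext.
rewrite [contract x (homot y)]contractE mcoeff_lext.
rewrite (_ : ev _ x *: _ = lext (fun p => ((p.1 == [::])%:R *
    bh dbl_out (mcoeff^~ y) p.2) *: (<< ([::] : W) >> : T)) x).
  rewrite -lextD; apply: eq_lext => -[a c] _; rewrite [LHS]contract_dhomot_basis.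
  by rewrite linearZ /= mcoeff_twist [homot _]lextU.
rewrite /ev scaler_suml; apply: eq_bigr => p _.
rewrite mcoeffZ mcoeffU (mcoeff_homot dbl_outK) -scalerA; congr (_ *: (_ *: _)).
exact: mulrC.
Qed.

Lemma ddiff_null x : dbl_null x -> dbl_null (ddiff x).
Proof.
move=> x0 y ys; rewrite contract_ddiff x0 ?x0 ?raddf0 ?addr0 //.
  exact: (schur_diff dbl_outK dbl_srcK).
exact: schur_twist.
Qed.

Lemma contractNr x y : contract x (- y) = - contract x y.
Proof. by rewrite -scaleN1r contractZr scaleN1r. Qed.

(** After evaluation the two squares of [diff] vanish and the mixed terms cancel, because [diff]
    anticommutes with [twist]. *)
Lemma ddiff_ddiff_null x : dbl_null (ddiff (ddiff x)).
Proof.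
move=> y _; rewrite contract_ddiff.
have -> : contract (ddiff x) (diff y) = diff (contract x (twist (diff y))).
  rewrite contract_ddiff (diff_diff dbl_outK dbl_srcK y) contract0r; exact: addr0.
have -> : contract (ddiff x) (twist y) =
    diff (contract x (twist (twist y))) - contract x (twist (diff y)).
  by rewrite contract_ddiff (diff_twist dbl_outK dbl_srcK y) contractNr.
rewrite raddfB /= (diff_diff dbl_outK dbl_srcK (contract x (twist (twist y)))).
by rewrite sub0r addNr.
Qed.

(** For [S = contract x y], nullity at [twist y] moves the differential across the contraction:
    [diff S = contract x (twist (diff y))]. The homotopy of the first factor then recovers [S] up to
    its coefficient at the empty word, and contracting [y] supplies that coefficient. *)
Lemma ddiff_exact x : (forall w, schur (contract x << w >>)) ->
  x@_([::], [::]) = 0 -> dbl_null (ddiff x) -> dbl_null (x - ddiff (dhomot x)).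
Proof.
move=> xs x0 dx0 y ys; pose S := contract x y.
have Ss : schur S by apply: schur_contract.
have dS : diff S = contract x (twist (diff y)).
  have := dx0 _ (schur_twist ys); rewrite contract_ddiff twistK.
  by rewrite (diff_twist dbl_outK dbl_srcK) contractNr => /subr0_eq.
have d0 : diff << ([::] : W) >> = 0 by rewrite [diff _]lextU.
have -> : contract (x - ddiff (dhomot x)) y = S - contract (ddiff (dhomot x)) y.
  by rewrite -scaleN1r contractDl contractZl scaleN1r.
rewrite contract_ddiff.
have -> : diff (contract (dhomot x) (twist y)) = diff (homot S).
  by rewrite contract_dhomot twistK linearD linearZ /= d0 scaler0 addr0.
rewrite contract_dhomot -dS addrA (diff_homot_nil dbl_outK dbl_srcK Ss).
(* The left side is the contribution of the second term of [dhomot]. *)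
rewrite (_ : (contract x (homot (diff y)))@_([::] : W) = S@_([::] : W)).
  by rewrite subrK subrr.
have hd := diff_homot_nil dbl_outK dbl_srcK ys.
rewrite -[homot (diff y)](addKr (diff (homot y))) hd !contractDr !contractNr contractZr.
rewrite !mcoeffD !mcoeffN mcoeffZ.
(* Nullity at the invariant [homot y], read at the empty word, where every [diff] has coefficient
   0. *)
have -> : (contract x (diff (homot y)))@_([::] : W) = 0.
  have := dx0 _ (schur_homot dbl_outK ys); rewrite contract_ddiff => /(congr1 (mcoeff [::])).
  by rewrite mcoeffD mcoeff0 (mcoeff_diff dbl_outK dbl_srcK) add0r.
have -> : (contract x << ([::] : W) >>)@_([::] : W) = 0.
  rewrite contractE mcoeff_lext -[RHS]x0 -[RHS]ev_delta; apply: eq_ev => -[a c] _ /=.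
  by rewrite mcoeffZ !mcoeffU xpair_eqE -mulnb natrM mulrC [[::] == c]eq_sym.
by rewrite mulr0 oppr0 add0r addr0.
Qed.

End DoubleComplex.

(** * Deconcatenation with independent summation indices *)

Lemma mem_takes (T : eqType) (s : seq (seq T)) u i : u \in s ->
  take i u \in [seq take i u | u <- s, i <- iota 0 (size u).+1].
Proof.
move=> su; have [iu|iu] := ltnP i (size u).+1.
  by apply: allpairs_f_dep; rewrite // mem_iota.
rewrite take_oversize 1?ltnW // -[u]take_size.
by apply: (allpairs_f_dep (fun u i => take i u)); rewrite // mem_iota leqnn.
Qed.

Lemma mem_drops (T : eqType) (s : seq (seq T)) u i : u \in s ->
  drop i u \in [seq drop i u | u <- s, i <- iota 0 (size u).+1].
Proof.
move=> su; have [iu|iu] := ltnP i (size u).+1.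
  by apply: allpairs_f_dep; rewrite // mem_iota.
rewrite drop_oversize 1?ltnW // -[[::]](drop_size u).
by apply: (allpairs_f_dep (fun u i => drop i u)); rewrite // mem_iota leqnn.
Qed.

Section FiniteSums.
Variables (k : fieldType) (Q : quiver) (n : nat).
Local Notation W := (word Q n).
Implicit Types (u v w : W) (f g : W -> k).

Lemma sum_delta (I : eqType) (s : seq I) i (F : I -> k) : uniq s ->
  (i \notin s -> F i = 0) -> \sum_(j <- s) (i == j)%:R * F j = F i.
Proof.
move=> us Fi; have [si|si] := boolP (i \in s).
  rewrite (bigD1_seq i) //= eqxx mul1r big1 ?addr0 // => j.
  by rewrite eq_sym => /negbTE->; rewrite mul0r.
rewrite Fi // big_seq big1 // => j js.
by case: eqP => [ij|]; [rewrite ij js in si | rewrite mul0r].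
Qed.

(** Recognizes a bilinear sum of word products as [wmul], to which [superalt_wmul] applies. *)
Lemma sum_mulw (s t : seq W) f g w : uniq s -> uniq t ->
  (forall u, u \notin s -> f u = 0) -> (forall v, v \notin t -> g v = 0) ->
  \sum_(u <- s) \sum_(v <- t) f u * g v * (mulw k u v)@_w = wmul f g w.
Proof.
move=> us ut fs gt.
transitivity (\sum_(u <- s) \sum_(v <- t) \sum_(p <- word_cofact w)
    sg (word_sign p.1 p.2) * ((p.1 == u)%:R * f u * ((p.2 == v)%:R * g v))).
  apply: eq_bigr => u _; apply: eq_bigr => v _; rewrite mcoeff_mulw mulr_sumr.
  by apply: eq_bigr => p _; rewrite [u == _]eq_sym [v == _]eq_sym; ring.
under eq_bigr do rewrite exchange_big /=.
rewrite exchange_big; apply: eq_bigr => p _.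
under eq_bigr do rewrite -!mulr_sumr (sum_delta ut (gt _)).
by rewrite -mulr_sumr -mulr_suml (sum_delta us (fs _)).
Qed.

Lemma sum_cat_delta (s t : seq W) u (G : W -> W -> k) : uniq s -> uniq t ->
  (forall i, take i u \in s) -> (forall i, drop i u \in t) ->
  \sum_(a <- s) \sum_(b <- t) (u == a ++ b)%:R * G a b =
  \sum_(i < (size u).+1) G (take i u) (drop i u).
Proof.
move=> us ut su tu.
transitivity (\sum_(a <- s) \sum_(b <- t) \sum_(i < (size u).+1)
    (take i u == a)%:R * ((drop i u == b)%:R * G a b)).
  apply: eq_bigr => a _; apply: eq_bigr => b _.
  have [uab|uab] := eqVneq u (a ++ b).
    have ia : (size a < (size u).+1)%N by rewrite uab size_cat ltnS leq_addr.
    have ta : take (size a) u = a by rewrite uab take_size_cat.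
    have db : drop (size a) u = b by rewrite uab drop_size_cat.
    rewrite mul1r (bigD1 (Ordinal ia)) //= ta db !eqxx !mul1r.
    rewrite big1 ?addr0 // => i; rewrite -val_eqE /= => ia'.
    case: eqP => [E|]; last by rewrite mul0r.
    by case/eqP: ia'; rewrite -E size_takel // -ltnS.
  rewrite mul0r big1 // => i _.
  case: eqP => [E|]; last by rewrite mul0r.
  case: eqP => [E'|]; last by rewrite mul0r mulr0.
  by rewrite -E -E' cat_take_drop eqxx in uab.
under eq_bigr do rewrite exchange_big /=.
rewrite exchange_big; apply: eq_bigr => i _.
under eq_bigr do rewrite -mulr_sumr sum_delta ?tu //.
by rewrite sum_delta ?su.
Qed.

End FiniteSums.

Section DoubleProduct.
Variables (k : fieldType) (Q : quiver) (n : nat).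
Local Notation QQ := (dbl_quiver Q).
Local Notation L := (letter QQ n).
Local Notation W := (word QQ n).
Local Notation T := 'T[k]_(QQ, n).
Local Notation D := (dbl_space k Q n).
Implicit Types (a b u v w : W) (s z : T) (x y : D) (f g h : W -> k).

Lemma eq_pairE (p : W * W) a b : (p == (a, b)) = (p.1 == a) && (p.2 == b).
Proof. by case: p. Qed.

Definition prefixes x : seq W :=
  undup [seq take i u | u <- [seq p.1 | p <- msupp x], i <- iota 0 (size u).+1].
Definition suffixes x : seq W :=
  undup [seq drop i u | u <- [seq p.1 | p <- msupp x], i <- iota 0 (size u).+1].
Definition seconds x : seq W := undup [seq p.2 | p <- msupp x].

Lemma mem_prefixes x p i : p \in msupp x -> take i p.1 \in prefixes x.
Proof. by move=> xp; rewrite mem_undup; apply: mem_takes; apply: map_f. Qed.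

Lemma mem_suffixes x p i : p \in msupp x -> drop i p.1 \in suffixes x.
Proof. by move=> xp; rewrite mem_undup; apply: mem_drops; apply: map_f. Qed.

Lemma mem_seconds x p : p \in msupp x -> p.2 \in seconds x.
Proof. by move=> xp; rewrite mem_undup; apply: map_f. Qed.

Lemma coeff0_prefixes x a b c : a \notin prefixes x -> x@_((a ++ b), c) = 0.
Proof.
move=> ax; apply/eqP; rewrite mcoeff_eq0; apply: contra ax => abc.
by have := mem_prefixes (size a) abc; rewrite take_size_cat.
Qed.

Lemma coeff0_suffixes x a b c : b \notin suffixes x -> x@_((a ++ b), c) = 0.
Proof.
move=> ax; apply/eqP; rewrite mcoeff_eq0; apply: contra ax => abc.
by have := mem_suffixes (size a) abc; rewrite drop_size_cat.
Qed.

(** With the two parts [a] and [b] of a word as independent indices, the coefficient at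
    [(a ++ b, c)] is visibly superalternating in each part; a sum over cut positions hides this. *)
Lemma ev_split (G : W -> W -> W -> k) x :
  ev (fun p => \sum_(i < (size p.1).+1) G (take i p.1) (drop i p.1) p.2) x =
  \sum_(a <- prefixes x) \sum_(b <- suffixes x) \sum_(c <- seconds x)
    x@_((a ++ b), c) * G a b c.
Proof.
transitivity (ev (fun p => \sum_(a <- prefixes x) \sum_(b <- suffixes x)
    \sum_(c <- seconds x) G a b c * (p == (a ++ b, c))%:R) x).
  apply: eq_ev => p xp.
  have us := undup_uniq.
  rewrite -(sum_cat_delta (fun a b => G a b p.2) (us _ _) (us _ _)
    (fun i => mem_prefixes i xp) (fun i => mem_suffixes i xp)).
  apply: eq_bigr => a _; apply: eq_bigr => b _.
  rewrite -(@sum_delta _ _ (seconds x) p.2 (fun c => G a b c) (us _ _)); last first.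
    by rewrite mem_seconds.
  rewrite mulr_sumr; apply: eq_bigr => c _.
  by rewrite eq_pairE -mulnb natrM; ring.
rewrite ev_sumf; apply: eq_bigr => a _; rewrite ev_sumf; apply: eq_bigr => b _.
rewrite ev_sumf; apply: eq_bigr => c _.
by rewrite ev_scale ev_delta mulrC.
Qed.

Lemma mcoeff_contract x z w :
  (contract x z)@_w = ev (fun p => (p.1 == w)%:R * z@_p.2) x.
Proof.
rewrite contractE mcoeff_lext; apply: eq_ev => p _.
by rewrite mcoeffZ mcoeffU mulrC.
Qed.

Lemma ev_slice x w h :
  ev (fun p => (p.1 == w)%:R * h p.2) x = \sum_(c <- seconds x) x@_(w, c) * h c.
Proof.
transitivity (ev (fun p => \sum_(c <- seconds x) h c * (p == (w, c))%:R) x).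
  apply: eq_ev => p xp.
  rewrite -(@sum_delta _ _ (seconds x) p.2 h (undup_uniq _)); last by rewrite mem_seconds.
  rewrite mulr_sumr; apply: eq_bigr => c _.
  by rewrite eq_pairE -mulnb natrM; ring.
rewrite ev_sumf; apply: eq_bigr => c _.
by rewrite ev_scale ev_delta mulrC.
Qed.

Lemma superalt_slice x c : schur (contract x << c >>) ->
  superalt (fun w => x@_(w, c)).
Proof.
move=> /schurP xP; apply: superalt_ext xP => w; rewrite mcoeff_contract -ev_delta.
apply: eq_ev => p _; rewrite mcoeffU eq_pairE -mulnb natrM.
by rewrite [c == _]eq_sym.
Qed.

(* [h] may have infinite support: it is truncated to the permutations of the words
   paired with [x]. *)
Lemma dbl_null_superalt x w h : dbl_null x -> superalt h ->
  \sum_(c <- seconds x) x@_(w, c) * h c = 0.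
Proof.
move=> x0 hP; pose S := [fset v | v in flatten [seq permutations c | c <- seconds x]]%fset.
pose z : T := [malg v in S => h v].
have zE v : z@_v = (has (perm_eq v) (seconds x))%:R * h v.
  rewrite mcoeffE (_ : (v \in S) = has (perm_eq v) (seconds x)).
    by case: has; rewrite ?mul1r ?mul0r.
  rewrite inE /=; apply/flattenP/hasP => [[s /mapP[c xc ->]]|[c xc vc]].
    by rewrite mem_permutations => vc; exists c.
  by exists (permutations c); rewrite ?map_f // mem_permutations.
have zs : schur z.
  apply/schurP; case: hP => h1 h2; split=> [u a b v|u a v ea]; last by rewrite zE h2 ?mulr0.
  rewrite !zE h1 mulrCA; congr (_ * (_%:R * _)); congr nat_of_bool; apply: eq_has => c.
  by apply: permPl; rewrite perm_cat2l; apply/seq.permP => P /=; rewrite addnCA.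
have := congr1 (mcoeff w) (x0 z zs).
rewrite mcoeff_contract (ev_slice x w (mcoeff^~ z)) mcoeff0 => z0.
rewrite -[RHS]z0; apply: eq_big_seq => c xc; rewrite zE (_ : has _ _ = true) ?mul1r //.
by apply/hasP; exists c.
Qed.

Lemma letter_sigmaK : involutive (@letter_sigma Q n).
Proof. by case=> [[[[v|v]|[e|e]] i] j]. Qed.

Lemma is_edge_sigma (a : L) : is_edge (letter_sigma a) = is_edge a.
Proof. by case: a => [[[[v|v]|[e|e]] i] j]. Qed.

Lemma word_sigmaK : involutive (@word_sigma Q n).
Proof.
move=> w; rewrite /word_sigma -map_rev revK -map_comp map_id_in // => a _.
exact: letter_sigmaK.
Qed.

Lemma parity_sigma w : parity (word_sigma w) = parity w.
Proof.
rewrite /parity /nb_edges /word_sigma count_rev count_map; congr odd.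
by apply: eq_count => a /=; rewrite is_edge_sigma.
Qed.

Lemma eq_sigma u v : (word_sigma u == v) = (word_sigma v == u).
Proof. by rewrite -(inj_eq (can_inj word_sigmaK)) word_sigmaK eq_sym. Qed.

Lemma superalt_sigma f : superalt f -> superalt (fun w => f (word_sigma w)).
Proof.
have E (u : W) (a b : L) (v : W) : word_sigma (u ++ [:: a, b & v]) =
    word_sigma v ++ [:: letter_sigma b, letter_sigma a & word_sigma u].
  by rewrite /word_sigma map_cat rev_cat /= !rev_cons -!cats1 -!catA.
move=> [f1 f2]; split=> [u a b v|u a v ea]; rewrite !E.
  by rewrite f1 !is_edge_sigma andbC.
by rewrite f2 // is_edge_sigma.
Qed.

End DoubleProduct.

(** * The product of the double preserves invariants and null elements *)

Section DoubleIdeal.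
Variables (k : fieldType) (Q : quiver) (n : nat).
Local Notation QQ := (dbl_quiver Q).
Local Notation L := (letter QQ n).
Local Notation W := (word QQ n).
Local Notation T := 'T[k]_(QQ, n).
Local Notation D := (dbl_space k Q n).
Local Notation sigma := (@word_sigma Q n).
Implicit Types (a b c d u v w : W) (s z : T) (x y : D) (f g h : W -> k).

(** The second tensor factor of a summand of the product, evaluated by [f]: [c] and [d] stand for
    alpha and beta, the two Kronecker symbols are the pairings, and [q.2 ++ p.1] is
    [beta_(2) alpha_(1)]. *)
Definition dbl_core f a1 b2 c d : k :=
  \sum_(p <- word_cofact c) \sum_(q <- word_cofact d)
    sg (parity p.1 && parity d) * sg (word_sign p.1 p.2) * sg (word_sign q.1 q.2)
    * (sigma a1 == q.1)%:R * (p.2 == sigma b2)%:R * f (q.2 ++ p.1).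

Definition dbl_term g f a1 a2 b1 b2 c d : k :=
  sg (parity a1 && (parity a2 (+) parity b1)) * sg (parity b1 && parity c)
  * dbl_core f a1 b2 c d * ev g (mulw k a2 b1).

Lemma ev_dbl_mul_basis g f a c b d :
  ev (fun p => g p.1 * f p.2) (dbl_mul_basis k (a, c) (b, d)) =
  \sum_(i < (size a).+1) \sum_(j < (size b).+1)
    dbl_term g f (take i a) (drop i a) (take j b) (drop j b) c d.
Proof.
rewrite /dbl_mul_basis ev_sum; apply: eq_bigr => i _.
rewrite ev_sum; apply: eq_bigr => j _; rewrite /dbl_term /dbl_core.
move E: (ev g _) => m.
rewrite mulr_sumr mulr_suml ev_sum; apply: eq_bigr => p _.
rewrite mulr_sumr mulr_suml ev_sum; apply: eq_bigr => q _.
rewrite -E evZ /pairing /mulw; case: word_mul => [t|]; last by rewrite !ev0 !mulr0.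
by rewrite !evZ !evU !signr_addb /=; ring.
Qed.

Lemma mcoeff_contract_dbl_mul x y z w :
  (contract (dbl_mul x y) z)@_w =
  \sum_(a1 <- prefixes x) \sum_(a2 <- suffixes x) \sum_(c <- seconds x)
    x@_((a1 ++ a2), c) *
    \sum_(b1 <- prefixes y) \sum_(b2 <- suffixes y) \sum_(d <- seconds y)
      y@_((b1 ++ b2), d) * dbl_term (fun u => (u == w)%:R) (mcoeff^~ z) a1 a2 b1 b2 c d.
Proof.
rewrite mcoeff_contract [dbl_mul _ _]bilinE ev_lext -ev_split.
apply: eq_ev => -[a c] _; rewrite ev_lext.
rewrite (@eq_ev _ _ _ (fun p => \sum_(i < (size a).+1) \sum_(j < (size p.1).+1)
    dbl_term (fun u => (u == w)%:R) (mcoeff^~ z)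
      (take i a) (drop i a) (take j p.1) (drop j p.1) c p.2)).
  rewrite ev_sumf; apply: eq_bigr => i _.
  by rewrite (ev_split (fun b1 b2 d => dbl_term _ _ _ _ b1 b2 c d)).
move=> [b d] _; exact: (ev_dbl_mul_basis (fun u => (u == w)%:R)).
Qed.

(** For fixed [a1], [c], [b2], [d], the sum over [a2] and [b1] is a product [wmul] of slices of [x]
    and [y], the parity signs being absorbed as twists in [F] and [G]. Slices, twists and products
    are superalternating. *)
Lemma schur_dbl_mul x y z :
  (forall w, schur (contract x << w >>)) -> (forall w, schur (contract y << w >>)) ->
  schur (contract (dbl_mul x y) z).
Proof.
move=> xs ys; apply/schurP.
pose F a1 c a2 := sg (parity a2 && parity a1) * x@_(a1 ++ a2, c).
pose G a1 c b2 d b1 := sg (parity b1 && (parity a1 (+) parity c)) * y@_(b1 ++ b2, d).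
have FP a1 c : superalt (F a1 c).
  exact/superalt_twist/(superalt_catl _ (superalt_slice (xs c))).
have GP a1 c b2 d : superalt (G a1 c b2 d).
  exact/superalt_twist/(superalt_catr _ (superalt_slice (ys d))).
have P : superalt (fun w => \sum_(a1 <- prefixes x) \sum_(c <- seconds x)
    \sum_(b2 <- suffixes y) \sum_(d <- seconds y)
    dbl_core (mcoeff^~ z) a1 b2 c d * wmul (F a1 c) (G a1 c b2 d) w).
  apply: superalt_sum => a1 _; apply: superalt_sum => c _.
  apply: superalt_sum => b2 _; apply: superalt_sum => d _.
  exact/superaltZ/superalt_wmul.
apply: superalt_ext P => w; rewrite mcoeff_contract_dbl_mul; apply: eq_bigr => a1 _.
rewrite [RHS]exchange_big; apply: eq_bigr => c _.
transitivity (\sum_(b2 <- suffixes y) \sum_(d <- seconds y) \sum_(a2 <- suffixes x)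
    \sum_(b1 <- prefixes y)
    x@_(a1 ++ a2, c) *
      (y@_(b1 ++ b2, d) * dbl_term (fun u => (u == w)%:R) (mcoeff^~ z) a1 a2 b1 b2 c d)).
  apply: eq_bigr => b2 _; apply: eq_bigr => d _.
  rewrite -(@sum_mulw _ _ _ (suffixes x) (prefixes y)) ?undup_uniq //.
  - rewrite mulr_sumr; apply: eq_bigr => a2 _; rewrite mulr_sumr; apply: eq_bigr => b1 _.
    rewrite /F /G /dbl_term ev_delta; set m := mcoeff w _; set C := dbl_core _ _ _ _ _.
    by case: (parity a1); case: (parity a2); case: (parity b1); case: (parity c) => /=; ring.
  - by move=> a2 a2x; rewrite /F coeff0_suffixes ?mulr0.
  - by move=> b1 b1y; rewrite /G coeff0_prefixes ?mulr0.
under [LHS]eq_bigr => b2 _ do rewrite exchange_big /=.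
rewrite [LHS]exchange_big /=; apply: eq_bigr => a2 _.
under [LHS]eq_bigr => b2 _ do rewrite exchange_big /=.
rewrite [LHS]exchange_big mulr_sumr /=; apply: eq_bigr => b1 _.
by rewrite mulr_sumr; apply: eq_bigr => b2 _; rewrite mulr_sumr.
Qed.

(** Summing over [b2] consumes the pairing [p.2 = sigma b2] and leaves a product over the
    factorizations of [c], hence a function superalternating in [c]. The companion [dbl_core_suml]
    does the same with [a1] and [d]. *)
Lemma dbl_core_sumr f a1 b1 c d y :
  \sum_(b2 <- suffixes y) y@_(b1 ++ b2, d) * dbl_core f a1 b2 c d =
  \sum_(q <- word_cofact d) sg (word_sign q.1 q.2) * (sigma a1 == q.1)%:R *
    wmul (fun u => sg (parity u && parity d) * f (q.2 ++ u))
         (fun v => y@_(b1 ++ sigma v, d)) c.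
Proof.
under eq_bigr do rewrite mulr_sumr.
rewrite exchange_big [RHS](eq_bigr _ (fun q _ => mulr_sumr _ _ _ _)) [RHS]exchange_big.
apply: eq_bigr => p _ /=; under eq_bigr do rewrite mulr_sumr.
rewrite exchange_big; apply: eq_bigr => q _ /=.
rewrite -(@sum_delta _ _ (suffixes y) (sigma p.2) (fun v => y@_(b1 ++ v, d)));
  rewrite ?undup_uniq //; last exact: coeff0_suffixes.
rewrite !mulr_sumr; apply: eq_bigr => b2 _.
by rewrite [sigma p.2 == b2]eq_sigma [sigma b2 == _]eq_sym; ring.
Qed.

Lemma dbl_core_suml f a2 b2 c d x (t : bool) :
  \sum_(a1 <- prefixes x) x@_(a1 ++ a2, c) * (sg (parity a1 && t) * dbl_core f a1 b2 c d) =
  \sum_(p <- word_cofact c) sg (parity d && parity p.1) * (sg (word_sign p.1 p.2)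
    * (p.2 == sigma b2)%:R *
    wmul (fun u => sg (parity u && t) * x@_(sigma u ++ a2, c))
         (fun v => f (v ++ p.1)) d).
Proof.
under eq_bigr do rewrite mulrA mulr_sumr.
rewrite exchange_big; apply: eq_bigr => p _ /=.
under eq_bigr do rewrite mulr_sumr.
rewrite exchange_big !mulr_sumr; apply: eq_bigr => q _ /=.
rewrite -(parity_sigma q.1) -(@sum_delta _ _ (prefixes x) (sigma q.1)
   (fun v => sg (parity v && t) * x@_(v ++ a2, c))); last first.
- by move=> ax; rewrite coeff0_prefixes ?mulr0.
- exact: undup_uniq.
rewrite mulr_suml !mulr_sumr; apply: eq_bigr => a1 _.
by rewrite [sigma q.1 == a1]eq_sigma [parity d && _]andbC; ring.
Qed.

(** With [a1] and [a2] fixed, each coefficient pairs the second factor of [x] with a function of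
    [c], superalternating by [dbl_core_sumr]; such a pairing vanishes for null [x]. *)
Lemma dbl_mul_nulll x y : dbl_null x -> (forall w, schur (contract y << w >>)) ->
  dbl_null (dbl_mul x y).
Proof.
move=> x0 ys z /schurP zP; apply/malgP => w; rewrite mcoeff0 mcoeff_contract_dbl_mul.
rewrite big1 // => a1 _; rewrite big1 // => a2 _.
apply: (dbl_null_superalt _ x0 (h := fun c => \sum_(b1 <- prefixes y) _)).
apply: superalt_sum => b1 _.
apply: (@superalt_ext _ _ _ (fun c => \sum_(d <- seconds y)
  sg (parity a1 && (parity a2 (+) parity b1)) * (mulw k a2 b1)@_w *
  (sg (parity c && parity b1) * \sum_(q <- word_cofact d)
    sg (word_sign q.1 q.2) * (sigma a1 == q.1)%:R *
    wmul (fun u => sg (parity u && parity d) * z@_(q.2 ++ u))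
         (fun v => y@_(b1 ++ sigma v, d)) c))).
  move=> c; rewrite exchange_big; apply: eq_bigr => d _ /=.
  rewrite -(dbl_core_sumr (mcoeff^~ z)) !mulr_sumr; apply: eq_bigr => b2 _.
  by rewrite /dbl_term ev_delta [parity c && _]andbC; ring.
apply: superalt_sum => d _; apply/superaltZ/superalt_twist/superalt_sum => q _.
apply/superaltZ/superalt_wmul.
  exact/superalt_twist/superalt_catl.
exact/(superalt_sigma (superalt_catl _ (superalt_slice (ys d)))).
Qed.

(** The mirror argument: [a2], [c], [b1], [b2] are fixed, and the sum over [a1] is superalternating
    in [d]. *)
Lemma dbl_mul_nullr x y : dbl_null y -> (forall w, schur (contract x << w >>)) ->
  dbl_null (dbl_mul x y).
Proof.
move=> y0 xs z /schurP zP; apply/malgP => w; rewrite mcoeff0 mcoeff_contract_dbl_mul.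
under eq_bigr => a1 _ do (under eq_bigr => a2 _ do (under eq_bigr => c _ do
  (rewrite mulr_sumr; under eq_bigr => b1 _ do rewrite mulr_sumr))).
rewrite exchange_big big1 // => a2 _ /=.
rewrite exchange_big big1 // => c _ /=.
rewrite exchange_big big1 // => b1 _ /=.
rewrite exchange_big big1 // => b2 _ /=.
transitivity (\sum_(d <- seconds y) y@_(b1 ++ b2, d) *
  (sg (@parity QQ n b1 && @parity QQ n c) * (@mulw k QQ n a2 b1)@_w *
   \sum_(a1 <- prefixes x) x@_(a1 ++ a2, c) *
     (sg (@parity QQ n a1 && (@parity QQ n a2 (+) @parity QQ n b1)) *
      dbl_core (mcoeff^~ z) a1 b2 c d))).
  under eq_bigr do rewrite mulr_sumr.
  rewrite exchange_big; apply: eq_bigr => d _ /=.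
  rewrite !mulr_sumr; apply: eq_bigr => a1 _; rewrite /dbl_term ev_delta; ring.
apply: (dbl_null_superalt _ y0 (h := fun d => _ * \sum_(a1 <- prefixes x) _)).
apply: superaltZ; apply: superalt_ext (fun d => esym (dbl_core_suml _ _ _ _ _ _ _)) _.
apply: superalt_sum => p _; apply/superalt_twist/superaltZ/superalt_wmul.
  exact/superalt_twist/(superalt_sigma (superalt_catr _ (superalt_slice (xs c)))).
exact: superalt_catr.
Qed.

End DoubleIdeal.

(** * The differential of the double commutes with left multiplication *)

Section SplitDifferential.
Variables (k : fieldType) (Q : quiver) (n : nat) (out : vert Q -> edge Q).
Local Notation W := (word Q n).
Local Notation diff_word := (@diff_word k Q n out).
Implicit Types (a : letter Q n) (u v w : W).

Lemma ev_diff_word_cons (g : W -> k) a w : ev g (diff_word (a :: w)) =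
  (if is_edge a then 0 else sg (parity w) * g (to_edge out a :: w))
  + ev (fun v => g (a :: v)) (diff_word w).
Proof.
rewrite [diff_word _]/= evD ev_consT; congr (_ + _).
by case: ifP; rewrite ?ev0 // evZ evU.
Qed.

(** The differential is a coderivation for deconcatenation: the raised letter lies on one side of
    the cut, and on the left side its sign also counts the letters beyond the cut. *)
Lemma ev_diff_word_split (G : W -> W -> k) w :
  ev (fun u => \sum_(j < (size u).+1) G (take j u) (drop j u)) (diff_word w) =
  \sum_(j < (size w).+1)
    (sg (parity (drop j w)) * ev (G^~ (drop j w)) (diff_word (take j w)) +
     ev (G (take j w)) (diff_word (drop j w))).
Proof.
elim: w G => [|a w IH] G; first by rewrite big_ord1 /= !ev0 mulr0 addr0.
rewrite ev_diff_word_cons [RHS]big_ord_recl [take _ _]/= [drop _ _]/=.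
rewrite [diff_word [::]]/= ev0 mulr0 add0r ev_diff_word_cons -!addrA.
have -> : ev (fun v => \sum_(j < (size (a :: v)).+1) G (take j (a :: v)) (drop j (a :: v)))
    (diff_word w) = ev (fun v => G [::] (a :: v)) (diff_word w) +
    ev (fun v => \sum_(j < (size v).+1) G (a :: take j v) (drop j v)) (diff_word w).
  rewrite [ev _ _ + _](esym (@lextD _ _ k^o _ _ _)); apply: eq_ev => v _.
  by rewrite big_ord_recl.
rewrite (IH (fun u => G (a :: u))) [LHS]addrCA [RHS]addrCA; congr (_ + _).
pose A (i : 'I_(size w).+1) : k := if is_edge a then 0 else
  sg (parity w) * G (to_edge out a :: take i w) (drop i w).
rewrite [X in _ = _ + X](eq_bigr (fun i : 'I_(size w).+1 => A i +
    (sg (parity (drop i w)) * ev (fun v => G (a :: v) (drop i w)) (diff_word (take i w)) +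
     ev (G (a :: take i w)) (diff_word (drop i w))))); last first.
  move=> i _; rewrite [take _ _]/= [drop _ _]/= ev_diff_word_cons mulrDr -addrA.
  congr (_ + _); rewrite /A; case: ifP => _; first by rewrite mulr0.
  rewrite mulrA -signr_addb; congr (sg _ * _).
  by have := parity_cat (take i w) (drop i w); rewrite cat_take_drop addbC => ->.
rewrite [X in _ = _ + X]big_split [RHS]addrA; congr (_ + _); rewrite /A.
case: (is_edge a).
  by rewrite big1 // addr0.
by rewrite big_ord_recl mulrDr mulr_sumr.
Qed.

End SplitDifferential.

Section DoubleDifferential.
Variables (k : fieldType) (Q : quiver) (n : nat).
Variables (out inn : vert Q -> edge Q).
Hypotheses (outK : cancel out (@src Q)) (srcK : cancel (@src Q) out).
Hypotheses (innK : cancel inn (@tgt Q)) (tgtK : cancel (@tgt Q) inn).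
Local Notation QQ := (dbl_quiver Q).
Local Notation L := (letter QQ n).
Local Notation W := (word QQ n).
Local Notation T := 'T[k]_(QQ, n).
Local Notation D := (dbl_space k Q n).
Local Notation sigma := (@word_sigma Q n).
Local Notation bd := (@bd k QQ n).
Local Notation diff_word := (@diff_word k QQ n (dbl_out out inn)).
Local Notation codiff_word := (@codiff_word k QQ n).
Local Notation ddiff := (@ddiff k Q n out inn).
Let dbloK := dbl_outK outK innK.
Let dblsK := dbl_srcK srcK tgtK.
Implicit Types (a b c d u v w : W) (s z : T) (x y : D) (f g h : W -> k).

Lemma bdl_ext f g w : f =1 g -> bdl f w = bdl g w.
Proof.
elim: w f g => //= a w IH f g fg; rewrite fg; congr (_ + _ * _).
by apply: IH => v; apply: fg.
Qed.

(** The anti-automorphism fixes the sum [d] over all edges of the doubled quiver, so it exchanges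
    left and right multiplication by [d]; reversal exchanges the letters before and after, hence the
    signs. *)
Lemma bdl_sigma f w : bdl (fun v => f (sigma v)) w = bd f (sigma w).
Proof.
have sigma_cons (a : L) v : sigma (a :: v) = sigma v ++ [:: letter_sigma a].
  by rewrite /word_sigma /= rev_cons cats1.
have tv (a : L) : to_vert (letter_sigma a) = letter_sigma (to_tgt a).
  by case: a => [[[[z|z]|[e|e]] i] j].
elim: w f => [|a w IH] f //=.
rewrite (sigma_cons a w) bd_cat /= addr0 parity_cons addbF is_edge_sigma tv addrC.
rewrite -(IH (fun u => f (u ++ [:: letter_sigma a]))) (sigma_cons (to_tgt a)) mul1r.
congr (_ * _ + _); apply: bdl_ext => v; exact: congr1 (sigma_cons a v).
Qed.

Lemma mcoeff_diff_word_sigma w v :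
  (diff_word w)@_(sigma v) = bdl (fun u => (u == sigma w)%:R) v.
Proof.
have -> : diff_word w = diff (dbl_out out inn) << w >> by rewrite [diff _ _]lextU.
rewrite (mcoeff_diff dbloK dblsK) -bdl_sigma; apply: bdl_ext => u.
by rewrite mcoeffU -[in LHS](word_sigmaK w) (inj_eq (can_inj (@word_sigmaK Q n))) eq_sym.
Qed.

Lemma dbl_coreEl f a1 b2 c d : dbl_core f a1 b2 c d =
  \sum_(q <- word_cofact d) sg (word_sign q.1 q.2) * (sigma a1 == q.1)%:R *
    wmul (fun u => sg (parity u && parity d) * f (q.2 ++ u))
         (fun v => (v == sigma b2)%:R) c.
Proof.
rewrite /dbl_core exchange_big; apply: eq_bigr => q _ /=.
by rewrite mulr_sumr; apply: eq_bigr => p _; ring.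
Qed.

Lemma dbl_coreEr f a1 b2 c d : dbl_core f a1 b2 c d =
  \sum_(p <- word_cofact c) sg (word_sign p.1 p.2) * (p.2 == sigma b2)%:R *
    (sg (parity d && parity p.1) *
     wmul (fun u => (sigma a1 == u)%:R) (fun v => f (v ++ p.1)) d).
Proof.
apply: eq_bigr => p _ /=; rewrite [parity d && _]andbC.
by rewrite !mulr_sumr; apply: eq_bigr => q _; ring.
Qed.

Lemma ev_wmulr g (F : W -> W -> k) z c :
  ev (fun b => wmul g (F b) c) z = wmul g (fun v => ev (fun b => F b v) z) c.
Proof.
rewrite ev_sumf; apply: eq_bigr => p _.
by rewrite ev_scale ev_scale.
Qed.

(** By [bd_cat] the operator acts on [p.1] or on [q.2]. On [p.1] it passes to [p.2] as left
    multiplication ([wmul_bd]), which the pairing and [sigma] turn into [diff_word] of [b2]. On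
    [q.2] it comes out as [codiff_word] of [d] ([bd_wmul]). *)
Lemma dbl_core_bd f a1 b2 c d : dbl_core (bd f) a1 b2 c d =
  sg (parity d) * ev (fun b => dbl_core f a1 b c d) (diff_word b2) +
  ev (fun b => dbl_core f a1 b2 c b) (codiff_word d).
Proof.
have -> : dbl_core (bd f) a1 b2 c d =
    \sum_(q <- word_cofact d) sg (word_sign q.1 q.2) * (sigma a1 == q.1)%:R *
      wmul (fun u => sg (parity u && parity d) * bd (fun v => f (q.2 ++ v)) u)
           (fun v => (v == sigma b2)%:R) c +
    \sum_(p <- word_cofact c) sg (word_sign p.1 p.2) * (p.2 == sigma b2)%:R *
      (sg (parity d && parity p.1) * (sg (parity p.1) *
       wmul (fun u => (sigma a1 == u)%:R) (bd (fun v => f (v ++ p.1))) d)).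
  under eq_bigr do rewrite mulr_sumr.
  rewrite [X in X + _]exchange_big -big_split; apply: eq_bigr => p _ /=.
  rewrite !mulr_sumr -big_split; apply: eq_bigr => q _ /=.
  by rewrite bd_cat [parity d && _]andbC; ring.
congr (_ + _).
  rewrite (eq_ev (fun b _ => dbl_coreEl f a1 b c d)) ev_sumf mulr_sumr.
  apply: eq_bigr => q _; rewrite ev_scale mulrCA; congr (_ * _).
  rewrite (ev_wmulr _ (fun b v => (v == sigma b)%:R)).
  have E v : ev (fun b => (v == sigma b)%:R) (diff_word b2) =
      bdl (fun u => (u == sigma b2)%:R) v.
    rewrite -mcoeff_diff_word_sigma -ev_delta; apply: eq_ev => b _.
    by rewrite eq_sym eq_sigma eq_sym.
  rewrite [X in _ = _ * X](eq_wmul _ (frefl _) E).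
  rewrite -wmul_bd -wmulZl; apply: eq_wmul => // u.
  case: (parity d); last first.
    by rewrite andbF !mul1r; apply: bd_ext => v; rewrite andbF mul1r.
  rewrite andbT expr1 mulN1r -[LHS]opprK -bd_twist; congr (- _).
  by apply: bd_ext => v; rewrite andbT.
rewrite (eq_ev (fun b _ => dbl_coreEr f a1 b2 c b)) ev_sumf.
apply: eq_bigr => p _; rewrite ev_scale -bd_wmul -ev_codiff; congr (_ * _).
rewrite mulrA -ev_scale; apply: eq_ev => b /(codiff_word_supp dbloK dblsK)/raises_parity->.
by rewrite -signr_addb; congr (sg _ * _); case: (parity b); case: (parity p.1).
Qed.

Lemma dbl_core_twist f a1 b2 c d :
  dbl_core (fun w => sg (parity w) * f w) a1 b2 c d =
  sg (parity a1 (+) parity b2 (+) parity c (+) parity d) * dbl_core f a1 b2 c d.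
Proof.
rewrite mulr_sumr; apply: eq_big_seq => p pc; rewrite mulr_sumr.
apply: eq_big_seq => q qd.
have [qa|_] := eqVneq (sigma a1) q.1; last by rewrite !(mulr0, mul0r).
have [pb|_] := eqVneq p.2 (sigma b2); last by rewrite !(mulr0, mul0r).
have -> : parity (q.2 ++ p.1) = parity a1 (+) parity b2 (+) parity c (+) parity d.
  rewrite (word_cofact_parity pc) (word_cofact_parity qd) pb -qa !parity_sigma parity_cat.
  by case: (parity a1); case: (parity b2); case: (parity q.2); case: (parity p.1).
by ring.
Qed.

Lemma ev_ddiff_basis g f p : ev (fun p => g p.1 * f p.2) (ddiff_basis k out inn p) =
  sg (parity p.2) * f p.2 * ev g (diff_word p.1) + g p.1 * bd f p.2.
Proof.
have ev_tens s z : ev (fun p => g p.1 * f p.2) (tens s z) = ev g s * ev f z.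
  rewrite evE lext_tens mulr_suml; apply: eq_bigr => a _ /=.
  rewrite -mulrA; congr (_ * _); rewrite mulr_sumr; apply: eq_bigr => c _ /=.
  by rewrite /GRing.scale /=; ring.
rewrite /ddiff_basis [LHS]evD; congr (_ + _); last by rewrite ev_tens evU ev_codiff.
by rewrite [LHS]evZ ev_tens evU; ring.
Qed.

Lemma ev_ddiff g f x : ev (fun p => g p.1 * f p.2) (ddiff x) =
  ev (fun p => ev g (diff_word p.1) * (sg (parity p.2) * f p.2)) x +
  ev (fun p => g p.1 * bd f p.2) x.
Proof.
rewrite ev_lext [RHS](esym (@lextD _ _ k^o _ _ _)); apply: eq_ev => p _.
by rewrite ev_ddiff_basis; congr (_ + _); ring.
Qed.

Lemma ev_mulw_diff g a b : ev (fun u => ev g (diff_word u)) (mulw k a b) =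
  ev (fun v => ev g (mulw k a v)) (diff_word b).
Proof.
have mulwE u v : mulw k u v = tmul << u >> << v >> by rewrite [tmul _ _]bilinE !lextU.
rewrite -ev_lext mulwE [lext _ _](diff_tmul dbloK dblsK) [tmul _ _]bilinE lextU.
by rewrite [diff _ _]lextU ev_lext.
Qed.

(** One summand of left linearity. On the product of [a2] and [b1] the differential reaches [b1]
    only ([ev_mulw_diff]); on the second factor it splits by [dbl_core_bd] into contributions of
    [b2] and [d]. The remainder compares signs. *)
Lemma dbl_term_diff g f a1 a2 b1 b2 c d :
  dbl_term (fun u => ev g (diff_word u)) (fun w => sg (parity w) * f w) a1 a2 b1 b2 c d +
  dbl_term g (bd f) a1 a2 b1 b2 c d =
  sg (parity d) *
    (sg (parity b2) * ev (fun u => dbl_term g f a1 a2 u b2 c d) (diff_word b1) +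
     ev (fun u => dbl_term g f a1 a2 b1 u c d) (diff_word b2)) +
  ev (fun u => dbl_term g f a1 a2 b1 b2 c u) (codiff_word d).
Proof.
pose S := sg (parity a1 && (parity a2 (+) parity b1)) * sg (parity b1 && parity c) : k.
set M := ev g (mulw k a2 b1).
have -> : ev (fun u => dbl_term g f a1 a2 b1 u c d) (diff_word b2) =
    S * M * ev (fun u => dbl_core f a1 u c d) (diff_word b2).
  by rewrite -ev_scale; apply: eq_ev => u _; rewrite /dbl_term -/M /S; ring.
have -> : ev (fun u => dbl_term g f a1 a2 b1 b2 c u) (codiff_word d) =
    S * M * ev (fun u => dbl_core f a1 b2 c u) (codiff_word d).
  by rewrite -ev_scale; apply: eq_ev => u _; rewrite /dbl_term -/M /S; ring.
have -> : ev (fun u => dbl_term g f a1 a2 u b2 c d) (diff_word b1) =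
    sg (parity a1 (+) parity c) * S * dbl_core f a1 b2 c d *
    ev (fun u => ev g (mulw k a2 u)) (diff_word b1).
  rewrite -ev_scale; apply: eq_ev => u /(@diff_word_supp k)/raises_parity pu.
  rewrite /dbl_term pu /S; set N := ev _ _; set C := dbl_core _ _ _ _ _.
  by case: (parity a1); case: (parity a2); case: (parity b1); case: (parity c) => /=; ring.
rewrite -ev_mulw_diff /dbl_term dbl_core_twist dbl_core_bd -/M -/S.
set N := ev _ (mulw _ _ _); set C := dbl_core _ _ _ _ _; set X := ev _ _; set Y := ev _ _.
rewrite !signr_addb; ring.
Qed.

Lemma ddiff_dbl_mul_basis X Y :
  ddiff (dbl_mul_basis k X Y) = lext (dbl_mul_basis k X) (ddiff_basis k out inn Y).
Proof.
case: X Y => a c [b d]; apply/malgP => -[w w'].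
pose g u : k := (u == w)%:R; pose f u : k := (u == w')%:R.
have gf (t : D) : t@_(w, w') = ev (fun p => g p.1 * f p.2) t.
  by rewrite -ev_delta; apply: eq_ev => p _; rewrite eq_pairE -mulnb natrM.
rewrite !gf ev_ddiff ev_lext (ev_dbl_mul_basis (fun u => ev g (diff_word u))
  (fun u => sg (parity u) * f u)) ev_dbl_mul_basis.
pose H (p : W * W) := \sum_(i < (size a).+1) \sum_(j < (size p.1).+1)
  dbl_term g f (take i a) (drop i a) (take j p.1) (drop j p.1) c p.2.
rewrite (eq_ev (g' := H)); last by move=> [p p'] _; apply: ev_dbl_mul_basis.
have -> : ev H (ddiff_basis k out inn (b, d)) =
    sg (parity d) * ev (fun u => H (u, d)) (diff_word b) +
    ev (fun u => H (b, u)) (codiff_word d).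
  rewrite /ddiff_basis [LHS]evD; congr (_ + _).
    rewrite [LHS]evZ; congr (_ * _); rewrite evE lext_tens.
    by apply: (@eq_lext _ _ k^o) => u _; rewrite lextU.
  by rewrite evE lext_tens lextU.
rewrite /H !ev_sumf mulr_sumr -!big_split; apply: eq_bigr => i _ /=.
rewrite (ev_diff_word_split (dbl_out out inn)
  (fun u v => dbl_term g f (take i a) (drop i a) u v c d)) ev_sumf.
rewrite mulr_sumr -!big_split; apply: eq_bigr => j _ /=.
exact: dbl_term_diff.
Qed.

Lemma ddiff_dbl_mul x y : ddiff (dbl_mul x y) = dbl_mul x (ddiff y).
Proof.
rewrite [dbl_mul _ _]bilinE [in RHS]/dbl_mul bilinE linear_lext.
apply: eq_lext => X _; rewrite linear_lext lext_comp.
by apply: eq_lext => Y _; apply: ddiff_dbl_mul_basis.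
Qed.

End DoubleDifferential.

(** * Right multiplication by [d_r] in the double *)

Section CoefficientWords.
Variables (k : fieldType) (Q : quiver) (n : nat).
Local Notation L := (letter Q n).
Local Notation W := (word Q n).
Implicit Types (a b c : L) (u v w : W).

Lemma unit_coef_cat u v : unit_coef k (u ++ v) = unit_coef k u * unit_coef k v.
Proof. by elim: u => [|a u IH] /=; rewrite ?mul1r // IH mulrA. Qed.

Lemma dword_coef_cat u v : dword_coef k (u ++ v) =
  dword_coef k u * unit_coef k v + unit_coef k u * dword_coef k v.
Proof.
elim: u => [|a u IH] /=; first by rewrite mul0r add0r mul1r.
by rewrite IH unit_coef_cat; ring.
Qed.

Lemma unit_coef_parity w : unit_coef k w != 0 -> parity w = false.
Proof.
elim: w => // a w IH /=; rewrite mulf_eq0 negb_or => /andP[] + /IH.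
by rewrite parity_cons /one_coef; case: (is_edge a); rewrite /= ?eqxx // => _ ->.
Qed.

Lemma dword_coef_parity w : dword_coef k w != 0 -> parity w.
Proof.
elim: w => [|a w IH] /=; first by rewrite eqxx.
rewrite parity_cons /one_coef /d_coef; case: (is_edge a) => /=.
  rewrite mul0r addr0 mulf_eq0 negb_or => /andP[_ /unit_coef_parity ->]; done.
by rewrite mul0r add0r mulf_eq0 negb_or => /andP[_ /IH].
Qed.

Lemma letter_mul_diag_factor out a b c : letter_mul a b = Some c -> diag b ->
  b \in [:: unit_letter c; dedge_letter out c].
Proof.
move=> ab db; suff [->|->] : b = unit_letter c \/ b = dedge_letter out c.
- exact: mem_head.
- by rewrite in_cons mem_head orbT.
move: ab db; case: a b => [[x i] j] [[y i'] j']; rewrite /letter_mul /diag /=.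
case: eqP => // <- xy /eqP jj; move: xy; rewrite -jj.
case: x y => [z|e] [z'|e'] //=; case: eqP => // E [<-]; [left|right|left].
- by rewrite /unit_letter /= E.
- by rewrite /dedge_letter.
- by rewrite /unit_letter /= E.
Qed.

(** Here the product is known instead of the left factor. This bounds the part of [d_r] that is
    paired with a factor of alpha. *)
Lemma word_mul_diag_factor out u v w : word_mul u v = Some w -> all (@diag Q n) v ->
  v \in dword_support out w.
Proof.
elim: u v w => [|a u IH] [|b v] w; rewrite [word_mul _ _]/= //; first by case=> <-.
case ab: letter_mul => [c|] //; case uv: word_mul => [w'|] // [<-] /andP[db dv].
by apply: (@allpairs_f _ _ _ cons); [apply: letter_mul_diag_factor ab db | apply: IH uv dv].
Qed.

Lemma sum_wmulr (s : seq W) (h : W -> k) (a w : W) : uniq s ->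
  (forall p, p \in word_cofact w -> p.1 = a -> h p.2 != 0 -> p.2 \in s) ->
  \sum_(b <- s) h b * (mulw k a b)@_w = wmul (fun u => (a == u)%:R) h w.
Proof.
move=> us sP; under eq_bigr do rewrite mcoeff_mulw mulr_sumr.
rewrite exchange_big; apply: eq_big_seq => p pw /=.
have [ap|_] := eqVneq a p.1; last first.
  by rewrite mul0r mulr0 big1 // => b _; rewrite mul0r !mulr0.
have hs : p.2 \notin s -> h p.2 = 0.
  by move=> ps; apply/eqP; apply: contraNT ps; apply: sP.
rewrite mul1r -(sum_delta us hs) mulr_sumr; apply: eq_bigr => b _.
by rewrite mul1r [b == _]eq_sym; ring.
Qed.

Lemma sum_wmul_delta (s : seq W) (sigma : W -> W) (f h : W -> k) (c : W) :
  involutive sigma -> uniq s ->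
  (forall p, p \in word_cofact c -> h (sigma p.2) != 0 -> sigma p.2 \in s) ->
  \sum_(b <- s) h b * wmul f (fun v => (v == sigma b)%:R) c =
  wmul f (fun v => h (sigma v)) c.
Proof.
move=> sK us sP; under eq_bigr do rewrite mulr_sumr.
rewrite exchange_big; apply: eq_big_seq => p pc /=.
have hs : sigma p.2 \notin s -> h (sigma p.2) = 0.
  by move=> ps; apply/eqP; apply: contraNT ps; apply: sP.
rewrite -(sum_delta us hs) !mulr_sumr; apply: eq_bigr => b _.
by rewrite -(inj_eq (can_inj sK)) sK; ring.
Qed.

End CoefficientWords.

Section LeftWords.
Variables (k : fieldType) (Q : quiver) (n : nat).
Local Notation QQ := (dbl_quiver Q).
Local Notation L := (letter QQ n).
Local Notation W := (word QQ n).
Local Notation is_left := (@Defs.is_left Q n).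
Local Notation inl_word := (map (@letter_inl Q n)).
Implicit Types (a b c : L) (u v w : W).

Definition letter_out a : letter Q n :=
  let: (x, i, j) := a in
  (match x with
   | inl (inl v) | inl (inr v) => inl v
   | inr (inl e) | inr (inr e) => inr e
   end, i, j).

Lemma letter_inlK : cancel (@letter_inl Q n) letter_out.
Proof. by case=> [[[v|e] i] j]. Qed.

Lemma letter_outK a : is_left a -> letter_inl (letter_out a) = a.
Proof. by case: a => [[[[v|v]|[e|e]] i] j]. Qed.

Lemma is_left_inl (a : letter Q n) : is_left (letter_inl a).
Proof. by case: a => [[[v|e] i] j]. Qed.

Lemma all_left_inl (t : word Q n) : all is_left (inl_word t).
Proof. by rewrite all_map; apply/allP => a _; apply: is_left_inl. Qed.

Lemma inl_word_out w : all is_left w -> inl_word (map letter_out w) = w.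
Proof.
by move=> /allP wl; rewrite -map_comp -[RHS]map_id; apply/eq_in_map => a /wl/letter_outK.
Qed.

Lemma dword_coef_inl (t : word Q n) : dword_coef k (inl_word t) = dword_coef k t.
Proof.
have one_inl (a : letter Q n) : one_coef k (letter_inl a) = one_coef k a.
  by case: a => [[[v|e] i] j].
have d_inl (a : letter Q n) : d_coef k (letter_inl a) = d_coef k a.
  by case: a => [[[v|e] i] j].
have unit_inl (u : word Q n) : unit_coef k (inl_word u) = unit_coef k u.
  by elim: u => //= a u ->; rewrite one_inl.
by elim: t => //= a t ->; rewrite one_inl d_inl unit_inl.
Qed.

Lemma letter_mul_left a b c : letter_mul a b = Some c ->
  is_left a = is_left c /\ is_left b = is_left c.
Proof.
case: a b => [[x i] j] [[y i'] j']; rewrite /letter_mul /=; case: (j == i') => //.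
by case: x y => [[v|v]|[e|e]] [[v'|v']|[e'|e']] //=; case: eqP => // -[E] [<-].
Qed.

Lemma word_mul_left u v w : word_mul u v = Some w ->
  map is_left u = map is_left w /\
  map is_left v = map is_left w.
Proof.
elim: u v w => [|a u IH] [|b v] w; rewrite [word_mul _ _]/= //; first by case=> <-.
case ab: letter_mul => [c|] //; case uv: word_mul => [w'|] // [<-].
by have [la lb] := letter_mul_left ab; have [lu lv] := IH _ _ uv; rewrite /= la lb lu lv.
Qed.

Lemma word_cofact_left w p : p \in word_cofact w ->
  map is_left p.1 = map is_left w /\
  map is_left p.2 = map is_left w.
Proof. by case: p => u v; rewrite word_cofactP => /eqP/word_mul_left. Qed.

Lemma all_left_map u v : map is_left u = map is_left v ->
  all is_left u = all is_left v /\
  all (predC is_left) u = all (predC is_left) v.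
Proof.
move=> E; split; first by rewrite -[LHS]/(all (preim _ id) u) -all_map E all_map.
by rewrite -[LHS]/(all (preim is_left negb) u) -all_map E all_map.
Qed.

Lemma is_left_sigma a : is_left (letter_sigma a) = ~~ is_left a.
Proof. by case: a => [[[[v|v]|[e|e]] i] j]. Qed.

Lemma all_left_sigma w : all is_left (word_sigma w) = all (predC is_left) w.
Proof. by rewrite all_rev all_map; apply: eq_all => a /=; rewrite is_left_sigma. Qed.

Lemma diag_sigma w : all (@diag QQ n) (word_sigma w) = all (@diag QQ n) w.
Proof.
rewrite all_rev all_map; apply: eq_all => -[[[[v|v]|[e|e]] i] j] /=; exact: eq_sym.
Qed.

Lemma size_sigma w : size (word_sigma w) = size w.
Proof. by rewrite size_rev size_map. Qed.

Lemma coef_sigma w : unit_coef k (word_sigma w) = unit_coef k w /\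
  dword_coef k (word_sigma w) = dword_coef k w.
Proof.
have one_s a : one_coef k (letter_sigma a) = one_coef k a.
  by case: a => [[[[v|v]|[e|e]] i] j]; rewrite /one_coef //= eq_sym.
have d_s a : d_coef k (letter_sigma a) = d_coef k a.
  by case: a => [[[[v|v]|[e|e]] i] j]; rewrite /d_coef //= eq_sym.
elim: w => // a w [IHu IHd].
have -> : word_sigma (a :: w) = word_sigma w ++ [:: letter_sigma a].
  by rewrite /word_sigma /= rev_cons cats1.
rewrite unit_coef_cat dword_coef_cat IHu IHd /= one_s d_s; split; ring.
Qed.

End LeftWords.

Lemma ev_split_word (k : fieldType) (Q : quiver) (n : nat)
    (s t : seq (word Q n)) (G : word Q n -> word Q n -> k) (x : 'T[k]_(Q, n)) :
  uniq s -> uniq t ->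
  {in msupp x, forall u i, take i u \in s} -> {in msupp x, forall u i, drop i u \in t} ->
  ev (fun u => \sum_(i < (size u).+1) G (take i u) (drop i u)) x =
  \sum_(a <- s) \sum_(b <- t) x@_(a ++ b) * G a b.
Proof.
move=> us ut xs xt.
transitivity (ev (fun u => \sum_(a <- s) \sum_(b <- t) G a b * (u == a ++ b)%:R) x).
  apply: eq_ev => u xu; rewrite -(sum_cat_delta G us ut (xs u xu) (xt u xu)).
  by apply: eq_bigr => a _; apply: eq_bigr => b _; rewrite mulrC.
rewrite ev_sumf; apply: eq_bigr => a _; rewrite ev_sumf; apply: eq_bigr => b _.
by rewrite ev_scale ev_delta mulrC.
Qed.

Section DoubleRightMultiplication.
Variables (k : fieldType) (Q : quiver) (n r : nat).
Variables (out inn : vert Q -> edge Q).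
Hypotheses (outK : cancel out (@src Q)) (srcK : cancel (@src Q) out).
Hypotheses (innK : cancel inn (@tgt Q)) (tgtK : cancel (@tgt Q) inn).
Local Notation QQ := (dbl_quiver Q).
Local Notation L := (letter QQ n).
Local Notation W := (word QQ n).
Local Notation T := 'T[k]_(QQ, n).
Local Notation D := (dbl_space k Q n).
Local Notation sigma := (@word_sigma Q n).
Local Notation is_left := (@Defs.is_left Q n).
Local Notation inl_word := (map (@letter_inl Q n)).
Local Notation bd := (@bd k QQ n).
Local Notation dout := (dbl_out out inn).
Let dbloK := dbl_outK outK innK.
Let dblsK := dbl_srcK srcK tgtK.
Implicit Types (a b c d u v w : W) (x y : D) (f g h : W -> k).
Implicit Types (F : {fset r.-tuple (letter Q n)}).

(** The second factor of [d_r] is the unit, and pairing with it forces [a1] to be empty. *)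
Lemma dbl_core_nil f a1 b2 c :
  dbl_core f a1 b2 c [::] = (a1 == [::])%:R * wmul f (fun v => (v == sigma b2)%:R) c.
Proof.
rewrite dbl_coreEl /= big_seq1 mul1r; congr (_%:R * _).
  by rewrite -size_eq0 size_sigma size_eq0.
by apply: eq_wmul => // u; rewrite andbF mul1r.
Qed.

(** The element [d_r] uses only the edges of [Q], whereas [ddiff] is built from all edges of the
    doubled quiver. *)
Definition left_dword w : k := if all is_left w then dword_coef k w else 0.
Definition left_unit w : k := if all is_left w then unit_coef k w else 0.

Lemma left_dword_cat u v :
  left_dword (u ++ v) = left_dword u * left_unit v + left_unit u * left_dword v.
Proof.
rewrite /left_dword /left_unit all_cat dword_coef_cat.
by case: (all _ u); case: (all _ v); rewrite ?(mulr0, mul0r, addr0).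
Qed.

Definition dr_sum F : T := \sum_(t <- F) dr_coef k t *: << (inl_word t : W) >>.

Lemma mcoeff_dr_sum F w : size w = r ->
  (all is_left w -> left_dword w != 0 ->
     exists2 t, t \in F & inl_word t = w) ->
  (dr_sum F)@_w = left_dword w.
Proof.
move=> wr wF; rewrite raddf_sum /=.
have E (t : r.-tuple (letter Q n)) : (dr_coef k t *: << (inl_word t : W) >>)@_w =
    if inl_word t == w then left_dword w else 0.
  rewrite mcoeffZ mcoeffU dr_coefE -dword_coef_inl.
  by case: eqP => [<-|]; rewrite ?mulr0 // mulr1 /left_dword all_left_inl.
rewrite (eq_bigr _ (fun t _ => E t)) -big_mkcond /=.
have [z|nz] := eqVneq (left_dword w) 0; first by rewrite big1.
have wl : all is_left w by move: nz; rewrite /left_dword; case: (all _ _); rewrite ?eqxx.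
have [t0 tF tw] := wF wl nz.
rewrite -[RHS](@big_pred1_uniq _ _ F t0 (fun=> left_dword w)) ?fset_uniq //.
apply: eq_bigl => t; rewrite -tw -val_eqE /=.
by rewrite (inj_eq (inj_map (can_inj (@letter_inlK Q n)))).
Qed.

(** The window for the double: a candidate right factor of [p.1], followed by the image under
    [sigma] of a candidate right divisor of [p.2]. *)
Definition dr_terms (p : W * W) : seq W :=
  [seq b ++ sigma v | b <- dword_support dout p.1, v <- dword_support dout p.2].

Lemma left_unit_twist b (t : bool) : sg (parity b && t) * left_unit b = left_unit b.
Proof.
rewrite /left_unit; case: (all _ _); last by rewrite mulr0.
have [->|/unit_coef_parity->] := eqVneq (unit_coef k b) 0; first by rewrite mulr0.
by rewrite mul1r.
Qed.

Lemma left_dword_twist b (t : bool) : sg (parity b && t) * left_dword b = sg t * left_dword b.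
Proof.
rewrite /left_dword; case: (all _ _); last by rewrite !mulr0.
by have [->|/dword_coef_parity->] := eqVneq (dword_coef k b) 0; rewrite ?mulr0.
Qed.

Lemma dbl_mul_dr_sum F a c : all is_left a -> all (predC is_left) c ->
  (size a + size c)%N = r ->
  (forall t, (inl_word (t : r.-tuple _) : W) \in dr_terms (a, c) -> t \in F) ->
  lext (dbl_mul_basis k (a, c)) (\sum_(t <- F) dr_schiver k t) =
  ddiff_basis k out inn (a, c).
Proof.
move=> al cl acr FP; apply/malgP => -[w w'].
pose g u : k := (u == w)%:R; pose f u : k := (u == w')%:R.
have gf (t : D) : t@_(w, w') = ev (fun p => g p.1 * f p.2) t.
  by rewrite -ev_delta; apply: eq_ev => p _; rewrite eq_pairE -mulnb natrM.
pose K b1 b2 := sg (parity b1 && parity c) *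
  wmul f (fun v => (v == sigma b2)%:R) c * (mulw k a b1)@_w.
have JE b : ev (fun p => g p.1 * f p.2) (dbl_mul_basis k (a, c) (b, [::])) =
    \sum_(j < (size b).+1) K (take j b) (drop j b).
  rewrite (ev_dbl_mul_basis g f) big_ord_recl [X in _ + X]big1 ?addr0 => [|i _].
    apply: eq_bigr => j _; rewrite /dbl_term dbl_core_nil take0 drop0 eqxx mul1r.
    by rewrite ev_delta mul1r.
  rewrite big1 // => j _; rewrite /dbl_term dbl_core_nil (_ : _ == [::] = false).
    by rewrite mul0r mulr0 mul0r.
  by rewrite -size_eq0 size_take; case: ltnP => // ai; case: (a) i ai => [[[]]|].
rewrite !gf ev_lext ev_ddiff_basis.
have -> : ev (fun X : W * W => ev (fun p => g p.1 * f p.2) (dbl_mul_basis k (a, c) X))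
    (\sum_(t <- F) dr_schiver k t) =
    ev (fun b => \sum_(j < (size b).+1) K (take j b) (drop j b)) (dr_sum F).
  rewrite !ev_sum; apply: eq_bigr => t _; rewrite !evZ !evU; congr (_ * _); exact: JE.
pose P := undup (dword_support dout a ++
  [seq take i u | u <- msupp (dr_sum F), i <- iota 0 (size u).+1]).
pose P' := undup (map sigma (dword_support dout c) ++
  [seq drop i u | u <- msupp (dr_sum F), i <- iota 0 (size u).+1]).
rewrite (@ev_split_word _ _ _ P P') ?undup_uniq //; first last.
- by move=> u xu i; rewrite mem_undup mem_cat mem_drops ?orbT.
- by move=> u xu i; rewrite mem_undup mem_cat mem_takes ?orbT.
(* If [K b1 b2] is nonzero, then [b1] has the length of [a] and [b2] that of [c], so [b1 ++ b2] has
   length [r]; if its coefficient is nonzero as well, it comes from a tuple in [F]. The truncated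
   sum thus gives way to the full coefficient function. *)
have KE b1 b2 : (dr_sum F)@_(b1 ++ b2) * K b1 b2 = left_dword (b1 ++ b2) * K b1 b2.
  have [->|K0] := eqVneq (K b1 b2) 0; first by rewrite !mulr0.
  congr (_ * _); move: K0; rewrite /K mulf_eq0 negb_or mulf_eq0 negb_or -andbA.
  case/and3P => _ E0 m0.
  have [z ab] : exists z, word_mul a b1 = Some z.
    by move: m0; rewrite /mulw; case: word_mul => [z|]; [exists z | rewrite mcoeff0 eqxx].
  have [p pc pb] : exists2 p, p \in word_cofact c & p.2 = sigma b2.
    have [/hasP[p pc /eqP pb]|/hasPn no] :=
        boolP (has (fun p => p.2 == sigma b2) (word_cofact c)).
      by exists p.
    case/eqP: E0; rewrite /wmul big_seq big1 // => p /no /negbTE->.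
    by rewrite !mulr0.
  have [sa sb1] : size a = size z /\ size b1 = size z.
    by apply: (@size_word_cofact _ _ z (a, b1)); rewrite word_cofactP ab.
  have [_ sb2] := size_word_cofact pc; rewrite pb size_sigma in sb2.
  have br : size (b1 ++ b2) = r by rewrite size_cat sb1 -sa sb2.
  apply: mcoeff_dr_sum => // bl; rewrite /left_dword bl => /dword_coef_diag.
  rewrite all_cat => /andP[db1 db2].
  have tr : size (map (@letter_out Q n) (b1 ++ b2)) == r by rewrite size_map br.
  exists (Tuple tr); last by rewrite /= inl_word_out.
  apply: FP; rewrite /= inl_word_out //.
  rewrite -[b2](@word_sigmaK Q n); apply: (@allpairs_f _ _ _ (fun b v => b ++ sigma v)).
    exact: (word_mul_diag dblsK ab).
  apply: (@word_mul_diag_factor _ _ dout p.1); last by rewrite diag_sigma.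
  by rewrite -pb; apply/eqP; rewrite -word_cofactP -surjective_pairing.
under eq_bigr do under eq_bigr do rewrite KE.
have Pw h : (forall b, h b != 0 -> all (@diag QQ n) b) ->
    \sum_(b <- P) h b * (mulw k a b)@_w = wmul (fun u => (a == u)%:R) h w.
  move=> hd; apply: sum_wmulr; first exact: undup_uniq.
  move=> p; rewrite [p in p \in _]surjective_pairing word_cofactP => /eqP pw pa h0.
  rewrite mem_undup mem_cat; apply/orP; left.
  by rewrite -pa; apply: (word_mul_diag dblsK pw); apply: hd.
have Pc h : (forall b, h b != 0 -> all (@diag QQ n) b) ->
    \sum_(b <- P') h b * wmul f (fun v => (v == sigma b)%:R) c =
    wmul f (fun v => h (sigma v)) c.
  move=> hd; apply: sum_wmul_delta; [exact: word_sigmaK | exact: undup_uniq |].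
  move=> p; rewrite [p in p \in _]surjective_pairing word_cofactP => /eqP pc h0.
  rewrite mem_undup mem_cat; apply/orP; left; apply: map_f.
  by apply: (word_mul_diag_factor _ pc); rewrite -diag_sigma; apply: hd.
have ldd b : left_dword b != 0 -> all (@diag QQ n) b.
  by rewrite /left_dword; case: (all _ b); [apply: dword_coef_diag | rewrite eqxx].
have lud b : left_unit b != 0 -> all (@diag QQ n) b.
  by rewrite /left_unit; case: (all _ b); [apply: unit_coef_diag | rewrite eqxx].
(* Factors lie in the same copy as their product, so the restriction to letters of [Q] is invisible
   against [a] and, after [sigma], against [c]. *)
have wl h p : p \in word_cofact w -> (a == p.1)%:R * (if all is_left p.2 then h p.2 else 0) =
    (a == p.1)%:R * h p.2 :> k.
  move=> pw; case: eqP => [ap|]; last by rewrite !mul0r.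
  have [E1 E2] := word_cofact_left pw.
  by have [-> _] := all_left_map (etrans E2 (esym E1)); rewrite -ap al.
have cl' h p : p \in word_cofact c ->
    f p.1 * (if all is_left (sigma p.2) then h p.2 else 0) = f p.1 * h p.2 :> k.
  move=> pc; have [_ E2] := word_cofact_left pc.
  by rewrite all_left_sigma; have [_ ->] := all_left_map E2; rewrite cl.
(* The coproduct [left_dword_cat] separates the sums over [b1] and [b2]. Since [b1] is odd in the
   first part and even in the second, only the first receives the sign of [c]. *)
transitivity (sg (parity c) * (\sum_(b <- P) left_dword b * (mulw k a b)@_w) *
    (\sum_(b <- P') left_unit b * wmul f (fun v => (v == sigma b)%:R) c) +
    (\sum_(b <- P) left_unit b * (mulw k a b)@_w) *
    (\sum_(b <- P') left_dword b * wmul f (fun v => (v == sigma b)%:R) c)).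
  rewrite -[X in _ = X + _]mulrA !mulr_suml [X in _ = X + _]mulr_sumr -big_split.
  apply: eq_bigr => b1 _ /=.
  rewrite !mulr_sumr -big_split; apply: eq_bigr => b2 _ /=.
  rewrite left_dword_cat /K; set m := mcoeff w _; set E := wmul _ _ _.
  transitivity ((sg (parity b1 && parity c) * left_dword b1) * left_unit b2 * E * m +
    (sg (parity b1 && parity c) * left_unit b1) * left_dword b2 * E * m); first by ring.
  by rewrite left_unit_twist left_dword_twist; ring.
rewrite !Pw // !Pc //=.
have -> : wmul (fun u => (a == u)%:R) left_dword w = ev g (diff_word k dout a).
  transitivity (wmul (fun u => (a == u)%:R) (@dword_coef k QQ n) w).
    by apply: eq_wmul_in => p; apply: wl.
  rewrite wmul_dword ev_delta.
  rewrite (mcoeff_diff_word k dbloK dblsK) -ev_codiff -ev_delta.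
  by apply: eq_ev => u _; rewrite eq_sym.
have -> : wmul (fun u => (a == u)%:R) left_unit w = g a.
  rewrite -[RHS](wmul_unit (fun u => (a == u)%:R) w).
  by apply: eq_wmul_in => p; apply: wl.
have -> : wmul f (fun v => left_unit (sigma v)) c = f c.
  rewrite -[RHS]wmul_unit; apply: eq_wmul_in => p pc; rewrite -[RHS](cl' _ p pc).
  by rewrite /left_unit (coef_sigma k p.2).1.
have -> : wmul f (fun v => left_dword (sigma v)) c = bd f c.
  rewrite -[RHS]wmul_dword; apply: eq_wmul_in => p pc; rewrite -[RHS](cl' _ p pc).
  by rewrite /left_dword (coef_sigma k p.2).2.
by ring.
Qed.

Lemma dr_schiver_sum x : schiver_deg r x ->
  is_mul_sum (@dbl_mul k Q n) (@dr_schiver k Q n r) x (ddiff out inn x).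
Proof.
move=> [_ xr].
pose words := flatten [seq dr_terms p | p <- msupp x].
exists [fset t | t in (pmap insub (map (map (@letter_out Q n)) words)
  : seq (r.-tuple (letter Q n)))]%fset.
move=> F /fsubsetP F0; rewrite [dbl_mul _ _]bilinE; apply: eq_lext => -[a c] xac.
have [al cl ac] := xr _ xac; apply: dbl_mul_dr_sum => // t tac; apply: F0.
rewrite !inE /= mem_pmap_sub /=; apply/mapP; exists (inl_word t).
  by apply/flattenP; exists (dr_terms (a, c)) => //; apply: map_f.
by rewrite -map_comp map_id_in // => b _; apply: letter_inlK.
Qed.

End DoubleRightMultiplication.

(** * Supports, degrees and exactness for the double *)

Section DoubleSupport.
Variables (k : fieldType) (Q : quiver) (n : nat).
Variables (out inn : vert Q -> edge Q).
Hypotheses (outK : cancel out (@src Q)) (srcK : cancel (@src Q) out).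
Hypotheses (innK : cancel inn (@tgt Q)) (tgtK : cancel (@tgt Q) inn).
Local Notation QQ := (dbl_quiver Q).
Local Notation L := (letter QQ n).
Local Notation W := (word QQ n).
Local Notation D := (dbl_space k Q n).
Local Notation sigma := (@word_sigma Q n).
Local Notation is_left := (@Defs.is_left Q n).
Local Notation dout := (dbl_out out inn).
Let dbloK := dbl_outK outK innK.
Let dblsK := dbl_srcK srcK tgtK.
Implicit Types (p : W * W) (x y : D).

Lemma msuppD_or (K : choiceType) (x y : {malg k[K]}) u :
  u \in msupp (x + y) -> u \in msupp x \/ u \in msupp y.
Proof. by move=> /(fsubsetP (msuppD_le _ _)); rewrite in_fsetU => /orP. Qed.

Lemma msuppZ_neq0 (K : choiceType) (c : k) (x : {malg k[K]}) u :
  u \in msupp (c *: x) -> c != 0 /\ u \in msupp x.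
Proof. by rewrite msuppZ; case: eqP => //; rewrite in_fset0. Qed.

Lemma msuppZ_in (K : choiceType) (c : k) (x : {malg k[K]}) u :
  u \in msupp (c *: x) -> u \in msupp x.
Proof. by case/msuppZ_neq0. Qed.

Lemma msupp_sum (K : choiceType) (I : eqType) (s : seq I) (F : I -> {malg k[K]}) u :
  u \in msupp (\sum_(i <- s) F i) -> exists2 i, i \in s & u \in msupp (F i).
Proof.
elim: s => [|i s IH]; first by rewrite big_nil msupp0.
rewrite big_cons => /msuppD_or[ui|/IH[j js uj]]; first by exists i; rewrite ?mem_head.
by exists j; rewrite // inE js orbT.
Qed.

Lemma msuppU_eq (K : choiceType) (u v : K) : u \in msupp (<< v >> : {malg k[K]}) -> u = v.
Proof. by rewrite msuppU oner_eq0 inE => /eqP. Qed.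

Lemma ddiff_basis_supp q p : p \in msupp (ddiff_basis k out inn q) ->
  (raises dout q.1 p.1 /\ p.2 = q.2) \/ (p.1 = q.1 /\ raises dout p.2 q.2).
Proof.
case/msuppD_or => [/msuppZ_in|] /msupp_tens[].
  by move=> /diff_word_supp pq /msuppU_eq ->; left.
by move=> /msuppU_eq -> /(codiff_word_supp dbloK dblsK); right.
Qed.

Lemma dhomot_basis_supp q p : p \in msupp (dhomot_basis k out inn q) ->
  (raises dout p.1 q.1 /\ p.2 = q.2) \/ (p.1 = q.1 /\ raises dout q.2 p.2).
Proof.
case/msuppD_or => [/msuppZ_in /msupp_tens[]|].
  by move=> /(homot_word_supp dbloK) pq /msuppU_eq ->; left.
have [-> /msuppZ_in/msupp_tens[]|_] := eqVneq q.1 [::].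
  by move=> /msuppU_eq-> /cohomot_word_supp; right.
by rewrite scale0r msupp0.
Qed.

Lemma is_left_to_edge a : is_left (to_edge dout a) = is_left a.
Proof. by case: a => [[[[v|v]|[e|e]] i] j]. Qed.

Definition schiver_word r p : Prop :=
  [/\ all is_left p.1, all (predC is_left) p.2 & (size p.1 + size p.2)%N = r].

(** The differential moves pairs along this relation and the contraction moves them against it,
    whence an equivalence. *)
Lemma raises_schiver r (p q : W * W) :
  (raises dout p.1 q.1 /\ p.2 = q.2) \/ (p.1 = q.1 /\ raises dout q.2 p.2) ->
  schiver_word r p <-> schiver_word r q.
Proof.
have rl u v : raises dout u v -> all is_left v = all is_left u.
  by apply: raises_all => a; apply: is_left_to_edge.
have rr u v : raises dout u v -> all (predC is_left) v = all (predC is_left) u.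
  by apply: raises_all => a /=; rewrite is_left_to_edge.
rewrite /schiver_word => -[[pq ->]|[-> qp]].
  by rewrite (rl _ _ pq) (raises_size pq).
by rewrite (rr _ _ qp) (raises_size qp).
Qed.

(** The pairing gives [d] the length of the consumed prefix of [a], so the length lost by [a] in the
    first factor reappears in the second. *)
Lemma dbl_mul_basis_supp r q1 q2 p : schiver_word r q1 -> schiver_word r q2 ->
  p \in msupp (dbl_mul_basis k q1 q2) -> schiver_word r p.
Proof.
case: q1 q2 p => a c [b d] z [/= al cl acr] [/= bl dl bdr].
case/msupp_sum => i _ /msupp_sum[j _ /msupp_sum[p pc /msupp_sum[q qd]]].
case/msuppZ_neq0; rewrite /pairing !mulf_eq0 !negb_or -!andbA => /and5P[_ _ _ aq _].
have {aq} aq : sigma (take i a) = q.1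
  by apply/eqP; move: aq; case: (sigma _ == _) => //; rewrite eqxx.
case ab: word_mul => [u|]; last by rewrite msupp0.
move=> /msuppZ_in /msuppU_eq ->; rewrite /schiver_word /=.
have [ul _] := word_mul_left ab.
have [_ ql] := word_cofact_left qd; have [pl _] := word_cofact_left pc.
have [q1s q2s] := @size_word_cofact _ _ d q qd.
have [p1s _] := @size_word_cofact _ _ c p pc.
have abu : (drop i a, take j b) \in word_cofact u by rewrite word_cofactP ab.
have [/= us _] := @size_word_cofact _ _ u _ abu.
split.
- rewrite -(all_left_map ul).1; move: al; rewrite -{1}(cat_take_drop i a) all_cat.
  by case/andP.
- by rewrite all_cat (all_left_map ql).2 (all_left_map pl).2 dl.
rewrite size_cat q2s p1s -acr -us addnA; congr (_ + _)%N.
by rewrite -[in RHS](cat_take_drop i a) size_cat addnC -q1s -aq size_sigma.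
Qed.

Lemma schiver_ddiff r x : schiver_deg r x -> schiver_deg r (ddiff out inn x).
Proof.
move=> [xs xr]; split=> [w|p].
  rewrite contract_ddiff //; apply: schurD.
    by apply: (schur_diff dbloK dblsK); apply: schur_contract.
  exact: schur_contract.
case/msupp_lext => q /xr qr /ddiff_basis_supp H; apply: (iffLR (@raises_schiver r q p _) qr).
by case: H => -[H1 H2]; [left | right].
Qed.

Lemma schiver_dhomot r x : schiver_deg r x -> schiver_deg r (dhomot out inn x).
Proof.
move=> [xs xr]; split=> [w|p].
  rewrite contract_dhomot //; apply: schurD; last exact/schurZ/schur_nil.
  by apply: (schur_homot dbloK); apply: schur_contract.
by case/msupp_lext => q /xr qr /dhomot_basis_supp H; apply: (iffRL (raises_schiver r H) qr).
Qed.

Lemma schiver_linear_exact r : (1 <= r)%N ->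
  linear_exact_sequence (@schiver_deg k Q n r) (@dbl_null k Q n)
    (@dbl_mul k Q n) (@schiver_homog k Q n) (ddiff out inn).
Proof.
have null0 : dbl_null (0 : D).
  by move=> y _; rewrite contractE raddf0.
move=> r1; split.
- move=> x y [xs xr] [ys yr]; split=> [w|p]; first exact: schur_dbl_mul.
  rewrite [dbl_mul _ _]bilinE => /msupp_lext[q1 /xr q1r /msupp_lext[q2 /yr q2r]].
  exact: dbl_mul_basis_supp.
- move=> x y [xs _] [ys _] [x0|y0]; [exact: dbl_mul_nulll | exact: dbl_mul_nullr].
- exact: schiver_ddiff.
- by move=> x _; apply: (ddiff_null outK srcK innK tgtK).
- by move=> c x y _ _; rewrite linearP subrr.
- by move=> a x _ _; rewrite (ddiff_dbl_mul outK srcK innK tgtK) subrr.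
- move=> j x _ xj p /msupp_lext[q /xj qj /ddiff_basis_supp].
  case=> [[/raises_nb_edges -> ->]|[-> qp]]; first by rewrite -qj !addSn.
  (* In the second factor an edge of weight 1 becomes a vertex of weight 2, so the degree rises by 1
     here too. *)
  rewrite (raises_nb_verts qp) -qj (raises_nb_edges qp); lia.
- by move=> x _; apply: (ddiff_ddiff_null outK srcK innK tgtK).
move=> x xr dx0; exists (dhomot out inn x); first exact: schiver_dhomot.
apply: (ddiff_exact outK srcK innK tgtK) => //; first by case: xr.
(* The pair of empty words, out of reach of both contractions, has total length 0. *)
apply/eqP; rewrite mcoeff_eq0; apply/negP => /(xr.2)[_ _ /= r0].
by rewrite -r0 in r1.
Qed.

End DoubleSupport.

Theorem theorem182 (k : fieldType) (n r : nat) (hn : (1 <= n)%N) (hr : (1 <= r)%N) :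
  (exists d : 'T[k]_(Ainf, n) -> 'T[k]_(Ainf, n),
     (forall x, schur_deg r x ->
        is_mul_sum (@tmul k Ainf n) (@dr_schur k Ainf n r) x (d x)) /\
     linear_exact_sequence (@schur_deg k Ainf n r) (fun x => x = 0)
       (@tmul k Ainf n) (@schur_homog k Ainf n) d) /\
  (exists d : dbl_space k Ainf n -> dbl_space k Ainf n,
     (forall x, schiver_deg r x ->
        is_mul_sum (@dbl_mul k Ainf n) (@dr_schiver k Ainf n r) x (d x)) /\
     linear_exact_sequence (@schiver_deg k Ainf n r) (@dbl_null k Ainf n)
       (@dbl_mul k Ainf n) (@schiver_homog k Ainf n) d).
Proof.
(* The edge [e_i] goes from [v_(i+1)] to [v_i], so the edge leaving [v_i] is [e_(i-1)] and the edge
   entering it is [e_i]. *)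
pose out : vert Ainf -> edge Ainf := fun i : int => i - 1.
pose inn : vert Ainf -> edge Ainf := fun i : int => i.
have outK : cancel out (@src Ainf) by move=> i; apply: subrK.
have srcK : cancel (@src Ainf) out by move=> i; apply: addrK.
have innK : cancel inn (@tgt Ainf) by [].
have tgtK : cancel (@tgt Ainf) inn by [].
split.
  exists (diff out); split; last exact: schur_linear_exact.
  by move=> x; apply: dr_schur_sum.
exists (ddiff out inn); split; last exact: schiver_linear_exact.
by move=> x; apply: dr_schiver_sum.
Qed.
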